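(* Let $\theta$ be an irrational number such that for some constant $C=C(\theta)>0$ and all $q\in\mathbb{N}$, $$\|q\theta\|:=\min_{n\in\mathbb{Z}}|q\theta-n|\ge C\exp(-q^{1/50}).$$ Then, as $N\to\infty$, the random variable $$\frac{1}{\sqrt{N}}\sum_{n\le N}e^{2\pi i n\theta}f(n),$$ where $f$ is a Steinhaus random multiplicative function, converges in distribution to a standard complex normal random variable with mean $0$ and variance $1$.
   Context: A Steinhaus random multiplicative function $f$ is a completely multiplicative function whose values $f(p)$ at primes $p$ are independent random variables, each uniformly distributed on the unit circle. A standard complex normal random variable with mean $0$ and variance $1$ is $X+iY$ with $X,Y$ independent real normal random variables of mean $0$ and variance $\tfrac12$. *)

(* Defs.v *)
From HB Require Import structures.
From mathcomp Require Import all_boot all_order all_algebra finmap.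
From mathcomp Require Import complex.
From mathcomp Require Import all_classical all_reals all_analysis.

Set Implicit Arguments.
Unset Strict Implicit.
Unset Printing Implicit Defensive.

Import Order.TTheory GRing.Theory Num.Theory.
Import numFieldNormedType.Exports.

Local Open Scope classical_set_scope.
Local Open Scope ring_scope.

(* ||x||; the infimum over Z is attained, so this is the minimum. *)
Definition dist_int (R : realType) (x : R) : R :=
  inf (range (fun n : int => `|x - n%:~R|)).

Definition expi (R : realType) (x : R) : R[i] := Complex (cos x) (sin x).

(* R[i] carries no measurable structure in the library: Borel sets of C, and
   continuity on C, are those of R * R, transported by this bijection. *)
Definition ReIm (R : realType) (z : R[i]) : R * R :=
  (complex.Re z, complex.Im z).

Section random_variables.
Context (R : realType) (d : measure_display) (T : measurableType d).
Variable P : probability T R.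

Definition complex_RV (Z : T -> R[i]) : Prop :=
  measurable_fun setT (fun t => ReIm (Z t)).

Definition mutually_independent (I : choiceType) (D : set I)
    (d' : measure_display) (T' : measurableType d') (X : I -> T -> T') : Prop :=
  forall J : {fset I}, [set` J] `<=` D ->
  forall B : I -> set T', (forall i, measurable (B i)) ->
    P (\bigcap_(i in [set` J]) (X i @^-1` B i)) =
    (\prod_(i <- J) P (X i @^-1` B i))%E.

(* The uniform law on the circle is the law of exp(2 pi i U), U uniform on
   [0, 1]. *)
Definition uniform_on_circle (Z : T -> R[i]) : Prop :=
  complex_RV Z /\
  forall B : set (R * R), measurable B ->
    P [set t | B (ReIm (Z t))] =
    uniform_prob (@ltr01 R) [set u | B (ReIm (expi (2 * pi * u)))].

(* f 0 is left unconstrained: f is a function on the positive integers. *)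
Definition completely_multiplicative (a : nat -> R[i]) : Prop :=
  a 1%N = 1 /\
  forall m n, (0 < m)%N -> (0 < n)%N -> a (m * n)%N = a m * a n.

Definition steinhaus (f : nat -> T -> R[i]) : Prop :=
  [/\ forall t, completely_multiplicative (fun n => f n t),
      mutually_independent [set p | prime p] (fun p t => ReIm (f p t)) &
      forall p, prime p -> uniform_on_circle (f p)].

(* The second argument of [normal_prob] is the standard deviation. *)
Definition std_complex_normal (W : T -> R[i]) : Prop :=
  exists X Y : {RV P >-> R},
  [/\ forall t, W t = Complex (X t) (Y t),
      forall A, measurable A ->
        distribution P X A = normal_prob 0 (Num.sqrt 2^-1) A,
      forall A, measurable A ->
        distribution P Y A = normal_prob 0 (Num.sqrt 2^-1) A &
      forall A B, measurable A -> measurable B ->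
        P ((X @^-1` A) `&` (Y @^-1` B)) =
        (P (X @^-1` A) * P (Y @^-1` B))%E].

End random_variables.

Definition cvg_in_distribution (R : realType)
    (d : measure_display) (T : measurableType d) (P : probability T R)
    (Z : nat -> T -> R[i])
    (d' : measure_display) (T' : measurableType d') (P' : probability T' R)
    (W : T' -> R[i]) : Prop :=
  forall g : R * R -> R, continuous g -> (exists M, forall x, `|g x| <= M) ->
    ('E_P[fun t => g (ReIm (Z N t))])%E @[N --> \oo] -->
    ('E_P'[fun t => g (ReIm (W t))])%E.

(* For N = 0 the prefactor is 0^-1 = 0, which is irrelevant to the limit. *)
Definition normalized_sum (R : realType) (T : Type) (theta : R)
    (f : nat -> T -> R[i]) (N : nat) (t : T) : R[i] :=
  Complex (Num.sqrt N%:R)^-1 0 *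
  \sum_(1 <= n < N.+1) expi (2 * pi * n%:R * theta) * f n t.

(* Main.v *)
Require Import Defs.
From HB Require Import structures.
From mathcomp Require Import all_boot all_order all_algebra finmap.
From mathcomp Require Import complex.
From mathcomp Require Import all_classical all_reals all_analysis.
From mathcomp Require Import measurable_realfun.
From mathcomp Require Import ring lra zify.
Set Implicit Arguments.
Unset Strict Implicit.
Unset Printing Implicit Defensive.
Import Order.TTheory GRing.Theory Num.Theory.
Import numFieldNormedType.Exports.
Local Open Scope classical_set_scope.
Local Open Scope ring_scope.

(* Write [e n = exp(2 pi i n theta)]. Grouping the integers [n = p m] by their
   largest prime factor [p], which is large and simple for almost all [n], turns
   the normalized sum into [sum_p f(p) A_p] up to a small remainder, where [A_p]
   only involves the primes below [p]: this is a sum of martingale differences.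
   It is asymptotically normal as soon as [sum_p E |A_p|^4 -> 0] and
   [sum_p |A_p|^2 -> 1] in L^2.

   By orthogonality of the [f(a)/f(b)], [a, b] coprime, the second condition
   reduces to bounding the off-diagonal sums over [M = max(a, b)] and
   [h = |a - b|] of the squares of sums of [e(h g p)] over primes [p]. These are
   estimated by Cauchy-Schwarz over dyadic blocks of [p], replacing primes by
   integers: the geometric sums that result are small unless [|1 - e(h r)|] is
   tiny, and the Diophantine condition makes such pairs [(h, r)] rare.

   Cosines of linear forms in (Re, Im) then have the right limits, and weak
   convergence follows by tightness and approximation of bounded continuous
   functions on squares by trigonometric polynomials. *)

(** All parameters depend on one integer [lam], with [log N] about [lam^12]; primes are large above
    [2 ^ l], [l = 4 * lam^3]. Two demands on [l] conflict. Almost all [n <= N] need a large prime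
    factor, so [l] must be a small power of [log N]. But when [p * max(a, b)] is close to [N], the
    cofactor [g] runs over too few values for Cauchy-Schwarz to gain; there the only saving is the
    density [1 / j] of primes near [2 ^ j], and the total is of size [lam^2 / l], so [l] must exceed
    [lam^2]. Elsewhere Cauchy-Schwarz must beat a loss [J^3], where [J] is about [log N]; excluding
    resonances for [q <= lam^150] is enough, and there the exponent [1/50] turns the Diophantine
    bound into [exp(- lam^3)], which [2 ^ l] absorbs. The smoothness condition that ties [g] to [p]
    does no harm: for fixed [g] it is a threshold on [p], so the sums left after squaring still run
    over intervals. Conditional expectations are replaced throughout by expectations against bounded
    functions of the earlier primes. *)

Definition cabs (R : realType) (z : R[i]) : R :=
  Num.sqrt (complex.Re z ^+ 2 + complex.Im z ^+ 2).

(** * The complex modulus with values in the reals *)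

Section complex_modulus.
Context (R : realType).
Implicit Types (z w : R[i]) (x y : R).

Lemma cabsE z : cabs z = complex.ComplexField.Normc.normc z.
Proof. by case: z. Qed.

Lemma cabs_ge0 z : 0 <= cabs z. Proof. exact: sqrtr_ge0. Qed.

Lemma cabs_sqr z : cabs z ^+ 2 = complex.Re z ^+ 2 + complex.Im z ^+ 2.
Proof. by rewrite sqr_sqrtr // addr_ge0 // sqr_ge0. Qed.

Lemma cabsM z w : cabs (z * w) = cabs z * cabs w.
Proof. by rewrite !cabsE complex.ComplexField.Normc.normcM. Qed.

Lemma cabs0 : cabs (0 : R[i]) = 0.
Proof. by rewrite /cabs /= expr0n /= addr0 sqrtr0. Qed.

Lemma cabs1 : cabs (1 : R[i]) = 1.
Proof. by rewrite /cabs /= expr0n /= addr0 expr1n sqrtr1. Qed.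

Lemma cabsN z : cabs (- z) = cabs z.
Proof. by case: z => a b; rewrite /cabs /= !sqrrN. Qed.

Lemma cabs_conj z : cabs (conjc z) = cabs z.
Proof. by case: z => a b; rewrite /cabs /= !sqrrN. Qed.

Lemma cabs_real x : cabs (real_complex R x) = `|x|.
Proof. by rewrite /cabs /= expr0n /= addr0 sqrtr_sqr. Qed.

Lemma cabsD z w : cabs (z + w) <= cabs z + cabs w.
Proof. by rewrite !cabsE; exact: complex.le_normcD. Qed.

Lemma cabs_sum (I : Type) (s : seq I) (P : pred I) (F : I -> R[i]) :
  cabs (\sum_(i <- s | P i) F i) <= \sum_(i <- s | P i) cabs (F i).
Proof.
elim/big_rec2: _ => [|i y x _ IH]; first by rewrite cabs0.
exact: (le_trans (cabsD _ _) (lerD _ IH)).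
Qed.

Lemma normr_Re_le z : `|complex.Re z| <= cabs z.
Proof. by rewrite -sqrtr_sqr ler_wsqrtr // lerDl sqr_ge0. Qed.

Lemma normr_Im_le z : `|complex.Im z| <= cabs z.
Proof. by rewrite -sqrtr_sqr ler_wsqrtr // lerDr sqr_ge0. Qed.

Lemma mul_conjc z : z * conjc z = real_complex R (cabs z ^+ 2).
Proof.
by rewrite cabs_sqr; case: z => a b; apply/eqP; rewrite eq_complex /=;
   apply/andP; split; apply/eqP; ring.
Qed.

Lemma conjc_sum (I : Type) (s : seq I) (P : pred I) (F : I -> R[i]) :
  conjc (\sum_(i <- s | P i) F i) = \sum_(i <- s | P i) conjc (F i).
Proof. exact: rmorph_sum. Qed.

Lemma conjcM z w : conjc (z * w) = conjc z * conjc w.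
Proof. exact: rmorphM. Qed.

Lemma Re_sum (I : Type) (s : seq I) (P : pred I) (F : I -> R[i]) :
  complex.Re (\sum_(i <- s | P i) F i) = \sum_(i <- s | P i) complex.Re (F i).
Proof. by elim/big_rec2: _ => //= i y x _ <-; case: (F i) x => ? ? []. Qed.

Lemma ReD z w : complex.Re (z + w) = complex.Re z + complex.Re w.
Proof. by case: z w => ? ? []. Qed.

Lemma ImD z w : complex.Im (z + w) = complex.Im z + complex.Im w.
Proof. by case: z w => ? ? []. Qed.

Lemma ReM z w : complex.Re (z * w) =
  complex.Re z * complex.Re w - complex.Im z * complex.Im w.
Proof. by case: z w => ? ? []. Qed.

Lemma ImM z w : complex.Im (z * w) =
  complex.Re z * complex.Im w + complex.Im z * complex.Re w.
Proof. by case: z w => ? ? []. Qed.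

(** This expansion is the entry point both of Cauchy-Schwarz for the bilinear sums and of the
    Parseval identities; the cast to [R[i]] lets the double sum be manipulated termwise. *)
Lemma cabs_sum_sqr (I : finType) (P : pred I) (F : I -> R[i]) :
  real_complex R (cabs (\sum_(i | P i) F i) ^+ 2) =
  \sum_(i | P i) \sum_(j | P j) F i * conjc (F j).
Proof.
rewrite -mul_conjc conjc_sum mulr_suml; apply: eq_bigr => i _.
by rewrite mulr_sumr.
Qed.

(** Cauchy-Schwarz against the constant [1], by [x y <= x^2 / 2 + y^2 / 2] on the expanded
    square. *)
Lemma ler_sum_sqr (I : finType) (P : pred I) (x : I -> R) :
  (\sum_(i | P i) x i) ^+ 2 <= #|P|%:R * \sum_(i | P i) x i ^+ 2.
Proof.
rewrite expr2 mulr_suml.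
under eq_bigr do rewrite mulr_sumr.
have H : \sum_(i | P i) \sum_(j | P j) x i * x j <=
    \sum_(i | P i) \sum_(j | P j) (x i ^+ 2 / 2 + x j ^+ 2 / 2).
  apply: ler_sum => i _; apply: ler_sum => j _.
  by have := sqr_ge0 (x i - x j); nra.
apply: (le_trans H).
have -> : #|P|%:R * \sum_(i | P i) x i ^+ 2 =
  \sum_(i | P i) \sum_(j | P j) x i ^+ 2 / 2 +
  \sum_(i | P i) \sum_(j | P j) x j ^+ 2 / 2.
  rewrite [X in _ = X + _]exchange_big /= !sumr_const -mulr2n.
  rewrite -mulr_suml -[RHS]mulr_natr -[(_ / _) *+ _]mulr_natr; by field.
by rewrite -big_split; apply: ler_sum => i _; rewrite -big_split.
Qed.

End complex_modulus.

(** * Taylor and Lipschitz bounds for sine, cosine and exponential *)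

Section trigonometric_bounds.
Context (R : realType).
Implicit Types x y u v : R.

Lemma sin_le_norm x : `|sin x| <= `|x|.
Proof.
wlog x0 : x / 0 <= x => [H|].
  have [/H//|x0] := leP 0 x.
  by have := H (- x); rewrite sinN !normrN; apply; rewrite oppr_ge0 ltW.
move: x0; rewrite le_eqVlt => /predU1P[<-|x0]; first by rewrite sin0.
have [c cx] := @MVT R sin cos 0 x x0 (fun y _ => is_derive_sin y)
  (continuous_subspaceT (@continuous_sin R)).
rewrite sin0 !subr0 => ->.
by rewrite normrM ler_piMl // cos_max.
Qed.

Lemma cos_half x : cos x = 1 - 2 * sin (x / 2) ^+ 2.
Proof.
have {1}-> : x = (x / 2) *+ 2 by rewrite -mulr_natr divfK // pnatr_eq0.
by rewrite cos_mulr2n cos2sin2 mulr2n; ring.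
Qed.

Lemma cos_ge_quad x : 1 - x ^+ 2 / 2 <= cos x.
Proof.
rewrite cos_half.
have := sin_le_norm (x / 2).
rewrite -(@ler_pXn2r _ 2) ?nnegrE ?normr_ge0 // -!normrX !ger0_norm ?sqr_ge0 //.
by rewrite expr_div_n; lra.
Qed.

(** The mean value theorem gives [sin x - x = - (1 - cos c) x] with [c] between [0] and [x], and
    [1 - cos c <= c^2 / 2]. The constant is not optimal; only the order matters. *)
Lemma sin_taylor x : `|sin x - x| <= `|x| ^+ 3 / 2.
Proof.
wlog x0 : x / 0 <= x => [H|].
  have [/H//|x0] := leP 0 x.
  have := H (- x); rewrite oppr_ge0 ltW // => /(_ isT).
  by rewrite sinN -opprD !normrN.
move: x0; rewrite le_eqVlt => /predU1P[<-|x0].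
  by rewrite sin0 subr0 normr0 expr0n /= mul0r.
have [c cx] := @MVT R sin cos 0 x x0 (fun y _ => is_derive_sin y)
  (continuous_subspaceT (@continuous_sin R)).
rewrite sin0 !subr0 => ->.
have -> : cos c * x - x = - ((1 - cos c) * x) by ring.
rewrite normrN normrM exprS mulrC -mulrA ler_pM2l ?normr_gt0 ?gt_eqF //.
rewrite ger0_norm ?subr_ge0 ?cos_le1 //.
move: cx; rewrite in_itv /= => /andP[c0 cx].
rewrite (gtr0_norm x0).
have := cos_ge_quad c; have : c ^+ 2 <= x ^+ 2.
  by rewrite ler_pXn2r ?nnegrE ?ltW.
lra.
Qed.

(** With [s = sin (x / 2)] the error is [- 2 (s - x / 2) (s + x / 2)]: a factor of third order by
    [sin_taylor] and a factor of first order. *)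
Lemma cos_taylor x : `|cos x - (1 - x ^+ 2 / 2)| <= x ^+ 4 / 8.
Proof.
rewrite cos_half; set s := sin (x / 2).
have -> : 1 - 2 * s ^+ 2 - (1 - x ^+ 2 / 2) = - 2 * (s - x / 2) * (s + x / 2).
  by field.
rewrite !normrM normrN [ `|2|]ger0_norm //.
have h1 : `|s - x / 2| <= `|x| ^+ 3 / 16.
  apply: le_trans (sin_taylor _) _.
  by rewrite normrM exprMn [ `|2^-1|]ger0_norm ?invr_ge0 //; lra.
have h2 : `|s + x / 2| <= `|x|.
  apply: le_trans (ler_normD _ _) _.
  have := sin_le_norm (x / 2); rewrite -/s normrM [ `|2^-1|]ger0_norm ?invr_ge0 //.
  lra.
have -> : x ^+ 4 / 8 = 2 * (`|x| ^+ 3 / 16) * `|x|.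
  have -> : x ^+ 4 = `|x| ^+ 4 by rewrite -normrX ger0_norm // exprn_even_ge0.
  by field.
by rewrite ler_pM // ?mulr_ge0 // ler_pM2l.
Qed.

Lemma cos_lipschitz x y : `|cos x - cos y| <= `|x - y|.
Proof.
wlog xy : x y / y <= x => [H|].
  by have [/H//|/ltW/H] := leP y x; rewrite distrC [ `|y - x|]distrC.
move: xy; rewrite le_eqVlt => /predU1P[->|yx]; first by rewrite !subrr.
have [c cx ->] := @MVT R cos (fun z => - sin z) y x yx (fun z _ => is_derive_cos z)
  (continuous_subspaceT (@continuous_cos R)).
by rewrite normrM normrN ler_piMl // sin_max.
Qed.

Lemma expR_lipschitz x y : 0 <= x -> 0 <= y ->
  `|expR (- x) - expR (- y)| <= `|x - y|.
Proof.
wlog xy : x y / x <= y => [H|] x0 y0.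
  by have [/H->//|/ltW/H] := leP x y; rewrite distrC [ `|y - x|]distrC => ->.
rewrite ger0_norm ?subr_ge0 ?ler_expR ?lerN2 // distrC ger0_norm ?subr_ge0 //.
have -> : expR (- y) = expR (- x) * expR (- (y - x)).
  by rewrite -expRD; congr expR; ring.
have h1 : expR (- x) <= 1 by rewrite -expR0 ler_expR oppr_le0.
have h2 := expR_ge1Dx (- (y - x)).
have h3 := expR_ge0 (- x).
have h4 : expR (- (y - x)) <= 1 by rewrite -expR0 ler_expR oppr_le0 subr_ge0.
nra.
Qed.

(** For [x < 1] this is [exp(- x) <= 1 / (1 + x) <= 1 - x + x^2]; for larger [x] the bound
    [exp(- x) <= 1] is enough. *)
Lemma expR_taylor x : 0 <= x -> `|expR (- x) - (1 - x)| <= x ^+ 2.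
Proof.
move=> x0; have h1 := expR_ge1Dx (- x); rewrite ger0_norm; last by lra.
have [x1|x1] := leP 1 x.
  have : expR (- x) <= 1 by rewrite -expR0 ler_expR oppr_le0.
  nra.
have h2 := expR_ge1Dx x.
have e : expR (- x) * expR x = 1 by rewrite -expRD addNr expR0.
have h3 := expR_gt0 (- x).
nra.
Qed.

End trigonometric_bounds.

(** * Counting in intervals, Chebyshev's bound, smooth integers *)

Section counting.
Local Open Scope nat_scope.

Lemma card_ord_itv n a b : #|[pred i : 'I_n | a <= i < b]| <= b - a.
Proof.
rewrite cardE -(size_map val) -[b - a](size_iota a).
apply: uniq_leq_size.
  by rewrite map_inj_uniq ?enum_uniq //; exact: val_inj.
move=> x /seq.mapP[ i]; rewrite mem_enum inE => /andP[ai ib] ->.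
by rewrite mem_iota ai subnKC // (leq_trans ai (ltnW ib)).
Qed.

Lemma card_ord_range n G : #|[pred i : 'I_n | 0 < i <= G]| <= G.
Proof. by have := card_ord_itv n 1 G.+1; rewrite subSS subn0. Qed.

(** The map [r |-> r %/ D] is injective on the selected integers, since equal quotients would put
    two of them closer than [D]. The first hypothesis makes the quotient positive, which saves the
    usual extra point [+ 1]. *)
Lemma gap_count n (G D : nat) (Q : pred nat) : 0 < D ->
  (forall r, 0 < r -> Q r -> D <= r) ->
  (forall r r', 0 < r -> Q r -> Q r' -> r < r' -> D <= r' - r) ->
  #|[pred r : 'I_n | (0 < r <= G) && Q r]| * D <= G.
Proof.
move=> D0 Q1 Q2; rewrite -leq_divRL //.
pose f (i : 'I_n) : 'I_(G %/ D).+1 := inord (i %/ D).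
have fE (i : 'I_n) : i <= G -> f i = i %/ D :> nat.
  by move=> iG; rewrite inordK // ltnS leq_div2r.
rewrite -(@card_in_image _ _ f); last first.
  move=> i j; rewrite !inE => /andP[/andP[i0 iG] Qi] /andP[/andP[j0 jG] Qj].
  move=> /(congr1 val) /=; rewrite !fE // => ij.
  apply: val_inj => /=.
  have hi := divn_eq i D; have hj := divn_eq j D.
  have mi := ltn_pmod i D0; have mj := ltn_pmod j D0.
  rewrite ij in hi.
  have [h|h|//] := ltngtP i j.
    by have := Q2 _ _ i0 Qi Qj h; lia.
  by have := Q2 _ _ j0 Qj Qi h; lia.
apply: leq_trans (card_ord_range (G %/ D).+1 (G %/ D)).
apply: subset_leq_card; apply/fintype.subsetP => x /fintype.imageP[ i].
rewrite inE => /andP[/andP[i0 iG] Qi] ->.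
by rewrite inE fE // divn_gt0 // Q1 //= leq_div2r.
Qed.

Lemma prod_primes_dvd (s : seq nat) m : uniq s -> all prime s ->
  all (dvdn^~ m) s -> \prod_(p <- s) p %| m.
Proof.
elim: s => [|p s IH] /=; first by rewrite big_nil dvd1n.
move=> /andP[ps us] /andP[pp pr] /andP[pm dm]; rewrite big_cons Gauss_dvd.
  by rewrite pm IH.
rewrite prime_coprime // Euclid_dvd_prod // big_has; apply/hasPn => q qs.
rewrite dvdn_prime2 //; last by exact: (allP pr).
by apply: contraNneq ps => ->.
Qed.

Lemma prime_dvd_fact p n : prime p -> p %| n`! -> p <= n.
Proof.
move=> pp; elim: n => [|n IH]; first by rewrite Euclid_dvd1.
rewrite factS Euclid_dvdM // => /orP[/dvdn_leq->//|/IH]; lia.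
Qed.

Lemma bin_leq_exp2 n m : 'C(n, m) <= 2 ^ n.
Proof.
have [nm|mn] := ltnP n m; first by rewrite bin_small.
rewrite -[2]/(1 + 1) expnDn.
under eq_bigr do rewrite !exp1n !muln1.
by rewrite (bigD1 (Ordinal (mn : m < n.+1))) //= leq_addr.
Qed.

(* Chebyshev: the primes of the block all divide ['C(2 ^ j.+1, 2 ^ j)]. *)
Lemma card_primes_block n j : 1 < j ->
  j * #|[pred p : 'I_n | prime p && (2 ^ j <= p < 2 ^ j.+1)]| <= 2 ^ j.+1.
Proof.
move=> j1; set A := [pred p : 'I_n | _].
pose s := map val (enum A).
(* [2 ^ j] is not prime since [1 < j]; the strict inequality then keeps [p] from dividing the
   factorial of [2 ^ j]. *)
have sA p : p \in s -> [/\ prime p, 2 ^ j < p & p < 2 ^ j.+1].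
  move=> /seq.mapP[ i]; rewrite mem_enum inE => /and3P[pi ji ij] ->; split => //.
  rewrite ltn_neqAle ji andbT; apply/negP => /eqP e.
  have : 2 %| i by rewrite -e dvdn_exp //; lia.
  rewrite dvdn_prime2 // => /eqP e2.
  by move: e; rewrite /= -e2 => /eqP; rewrite -[X in _ == X]expn1 eqn_exp2l //; lia.
have : \prod_(p <- s) p %| 'C(2 ^ j.+1, 2 ^ j).
  apply: prod_primes_dvd.
  - by rewrite map_inj_uniq ?enum_uniq //; exact: val_inj.
  - by apply/allP => p /sA[].
  - apply/allP => p /sA[pp lp up].
    have le2 : 2 ^ j <= 2 ^ j.+1 by rewrite leq_exp2l.
    have : p %| (2 ^ j.+1)`! by rewrite dvdn_fact // (ltnW up) andbT prime_gt0.
    rewrite -(bin_fact le2) !Euclid_dvdM //.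
    have -> : 2 ^ j.+1 - 2 ^ j = 2 ^ j by rewrite expnS; lia.
    by rewrite orbb => /orP[//|/(prime_dvd_fact pp)]; lia.
move=> /dvdn_leq; rewrite bin_gt0 leq_exp2l // leqnSn => /(_ isT) h.
have {h} := leq_trans h (bin_leq_exp2 _ _).
have : (2 ^ j) ^ size s <= \prod_(p <- s) p.
  elim: s sA => [|p s IH] sA; first by rewrite big_nil expn0.
  rewrite big_cons expnS leq_mul //.
    by have [_ /ltnW] := sA p (mem_head _ _).
  by apply: IH => q qs; apply: sA; rewrite inE qs orbT.
move=> h1 h2; have {h1 h2} := leq_trans h1 h2.
by rewrite -expnM leq_exp2l // size_map -cardE.
Qed.

(** Legendre's formula: multiplied by [p - 1] the sum of the [n %/ p ^ k] telescopes, because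
    [p * (n %/ p ^ m.+1) <= n %/ p ^ m]. *)
Lemma logn_fact_bound p n : prime p -> logn p n`! * p.-1 <= n.
Proof.
move=> pp; rewrite logn_fact //.
have p1 := prime_gt1 pp.
suff H : forall m, (\sum_(1 <= k < m.+1) n %/ p ^ k) * p.-1 + n %/ p ^ m <= n.
  by apply: leq_trans (H n); rewrite leq_addr.
elim=> [|m IH]; first by rewrite big_geq // expn0 divn1.
rewrite big_nat_recr //= mulnDl -addnA.
apply: leq_trans IH; rewrite leq_add2l -mulnSr (ltn_predK p1).
by rewrite expnSr divnMA leq_trunc_div.
Qed.

(** The bound on the prime factors is strict, so that in [n = p * m] with [smooth p m] the prime [p]
    is the largest prime factor of [n] and occurs only once. *)
Definition smooth (p m : nat) := (0 < m) && all (fun q => q < p) (primes m).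

Lemma smoothP p m : reflect
  (0 < m /\ forall q, prime q -> q %| m -> q < p) (smooth p m).
Proof.
apply: (iffP andP) => [[m0 /allP h]|[m0 h]]; split => //.
  by move=> q pq qm; apply: h; rewrite mem_primes pq m0.
by apply/allP => q; rewrite mem_primes m0 => /andP[pq qm]; exact: h.
Qed.

Lemma smoothM p m n : smooth p (m * n) = smooth p m && smooth p n.
Proof.
apply/smoothP/andP => [[mn h]|[/smoothP[m0 hm] /smoothP[n0 hn]]].
  by split; apply/smoothP; split; try lia; move=> q pq qd; apply: h => //;
    [rewrite dvdn_mulr|rewrite dvdn_mull].
split; first by rewrite muln_gt0 m0.
by move=> q pq; rewrite Euclid_dvdM // => /orP[/(hm _ pq)|/(hn _ pq)].
Qed.

Lemma smooth_gt0 p m : smooth p m -> 0 < m. Proof. by case/andP. Qed.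

Definition maxprime (m : nat) := \max_(q <- primes m) q.

(** For fixed [m], smoothness is a lower threshold on [p]; this is what later turns sums over [p]
    into sums over intervals. *)
Lemma smooth_maxprime p m : 0 < p -> smooth p m = (0 < m) && (maxprime m < p).
Proof.
move=> p0; rewrite /smooth; congr andb; apply/allP/idP => [h|h q qm].
  rewrite /maxprime; elim: (primes m) h => [|q s IH] h; first by rewrite big_nil.
  rewrite big_cons gtn_max h ?mem_head //= IH // => r rs.
  by apply: h; rewrite inE rs orbT.
by apply: leq_ltn_trans h; exact: leq_bigmax_seq.
Qed.

(** The exponent is the number of prime factors of [n] with multiplicity, each of them at most
    [y]. *)
Lemma smooth_le_exp y n : smooth y.+1 n ->
  n <= y ^ (\sum_(0 <= p < n.+1 | (p <= y) && prime p) logn p n).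
Proof.
move=> /smoothP[n0 h]; rewrite -{1}(partnT n0) /partn.
rewrite expn_sum [X in _ <= X]big_mkcond.
elim/big_rec2: _ => [//|p a b _ ab]; rewrite leq_mul //.
case: ifP => [/andP[py _]|/negbT hp]; first by case: (logn p n) => [|k]; rewrite ?expn0 ?leq_exp2r.
have -> // : logn p n = 0.
rewrite lognE; case: ifP => // /and3P[pp _ pn].
by move: hp; rewrite pp andbT -ltnS h.
Qed.

End counting.

(** * Elementary bounds for finite sums *)

Lemma sum_inj_le (R : realType) (I J : finType) (P : pred I) (Q : pred J)
    (h : I -> J) (F : J -> R) :
  (forall i j, P i -> P j -> h i = h j -> i = j) -> (forall i, P i -> Q (h i)) ->
  (forall j, 0 <= F j) ->
  \sum_(i | P i) F (h i) <= \sum_(j | Q j) F j.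
Proof.
move=> hinj PQ F0.
rewrite -(big_imset F (h := h) (A := P)) /=; last first.
  by move=> i j; rewrite !unfold_in; exact: hinj.
rewrite [X in _ <= X](bigID (mem [set h i | i in P]%SET)) /=.
rewrite [X in _ <= X + _](_ : _ = \sum_(j in [set h i | i in P]%SET) F j).
  by rewrite lerDl sumr_ge0.
apply: eq_bigl => j; apply/andP/idP => [[]//|jh]; split => //.
by move/imsetP: jh => [k kP ->]; exact: PQ.
Qed.

Lemma sumr_ord_itv (R : zmodType) (F : nat -> R) m lo hi :
  \sum_(i < m | (lo <= i < hi)%N) F i = \sum_(lo <= i < minn m hi) F i.
Proof.
rewrite (@big_nat_widen _ _ _ lo (minn m hi) m) ?geq_minl // big_geq_mkord /=.
by apply: eq_bigl => i; rewrite leq_min ltn_ord /= andbC.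
Qed.

Lemma sumr_pred_le (R : realType) (I : finType) (P : pred I) (F : I -> R)
    (k : nat) (c : R) : 0 <= c ->
  (forall i, P i -> F i <= c) -> (#|P| <= k)%N -> \sum_(i | P i) F i <= k%:R * c.
Proof.
move=> c0 Fc Pk; apply: le_trans (_ : \sum_(i | P i) c <= _).
  exact: ler_sum.
rewrite (eq_bigl (fun i => i \in P)) // sumr_const -[X in X <= _]mulr_natl.
by rewrite ler_wpM2r // ler_nat.
Qed.

Lemma sumr_natr_pred (R : realType) (I : finType) (P Q : pred I) :
  \sum_(i | P i) (Q i)%:R = #|[pred i | P i && Q i]|%:R :> R.
Proof.
rewrite -sum1_card natr_sum [RHS](eq_bigl (fun i => P i && Q i)) //.
by rewrite big_mkcondr; apply: eq_bigr => i _; case: (Q i).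
Qed.

(** Each dyadic block [[2 ^ j, 2 ^ j.+1)] contributes at most [1]. *)
Lemma harmonic_dyadic (R : realType) n J : (n <= 2 ^ J)%N ->
  \sum_(i < n | (0 < i)%N) (i%:R : R)^-1 <= J%:R.
Proof.
elim: J n => [|J IH] n nJ.
  rewrite big1 // => i i0; exfalso; move: i0 (ltn_ord i) nJ; rewrite expn0; lia.
rewrite (bigID (fun i : 'I_n => (i < 2 ^ J)%N)) /= -natr1.
apply: lerD.
  apply: le_trans (IH (minn n (2 ^ J)) (geq_minr _ _)).
  have := sumr_ord_itv (fun i => (i%:R : R)^-1) n 1 (2 ^ J).
  have := sumr_ord_itv (fun i => (i%:R : R)^-1) (minn n (2 ^ J)) 1 (2 ^ J).
  rewrite -minnA minnn => <- h.
  rewrite (eq_bigl (fun i : 'I_n => (0 < i < 2 ^ J)%N)) // h.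
  rewrite le_eqVlt; apply/orP; left; apply/eqP; apply: eq_bigl => i.
  by have := ltn_ord i; rewrite leq_min => /andP[_ ->]; rewrite andbT.
apply: le_trans (_ : (2 ^ J)%:R * (2 ^ J)%:R^-1 <= _).
  apply: sumr_pred_le; first by rewrite invr_ge0.
    move=> i /andP[i0]; rewrite -leqNgt => Ji.
    by rewrite lef_pV2 ?posrE ?ltr0n ?expn_gt0 // ler_nat.
  apply: leq_trans (_ : #|[pred i : 'I_n | 2 ^ J <= i < 2 ^ J.+1]| <= _)%N.
    apply: subset_leq_card; apply/fintype.subsetP => i.
    rewrite unfold_in !inE -leqNgt => /andP[_ ->] /=.
    exact: leq_trans (ltn_ord i) nJ.
  by apply: leq_trans (card_ord_itv _ _ _) _; rewrite expnS; lia.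
by rewrite divff // pnatr_eq0 expn_eq0.
Qed.

(** The sharper bound [2 / l - 1 / (m - 1)] for the sum over [l <= k < m] passes from [m] to [m + 1]
    because [1 / k - 1 / (k + 1)] exceeds [1 / (k + 1)^2]. *)
Lemma sum_inv_sqr (R : realType) n l : (0 < l)%N ->
  \sum_(k < n | (l <= k)%N) (k%:R ^+ 2 : R)^-1 <= 2 / l%:R.
Proof.
move=> l0.
have H m : (l < m)%N ->
    \sum_(l <= k < m) (k%:R ^+ 2 : R)^-1 <= 2 / l%:R - m.-1%:R^-1.
  case: m => // m; rewrite ltnS /= => lm; rewrite -(subnKC lm).
  elim: (m - l)%N => [|d IH].
    rewrite addn0 big_nat1 [X in _ <= X](_ : _ = l%:R^-1).
      rewrite lef_pV2 ?posrE ?exprn_gt0 ?ltr0n //.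
      by rewrite expr2 -natrM ler_nat; nia.
    by rewrite mulr2n mulrDl mul1r addrK.
  rewrite addnS big_nat_recr /=; last by lia.
  apply: (le_trans (lerD IH (lexx _))).
  set k := (l + d)%N; have k0 : (0 : R) < k%:R by rewrite ltr0n /k; lia.
  rewrite -addrA lerD2l -natr1 -subr_ge0.
  have -> : - (k%:R + 1)^-1 - (- k%:R^-1 + ((k%:R + 1) ^+ 2)^-1) =
     (k%:R * (k%:R + 1) ^+ 2)^-1 :> R.
    by field; rewrite !gt_eqF // addr_gt0.
  by rewrite invr_ge0 mulr_ge0 // ?sqr_ge0 // ltW.
have [nl|ln] := leqP n l.
  rewrite big1 ?divr_ge0 // => i li; exfalso; have := ltn_ord i; lia.
have := sumr_ord_itv (fun k => (k%:R ^+ 2 : R)^-1) n l n.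
rewrite minnn (eq_bigl (fun i : 'I_n => (l <= i)%N)); last first.
  by move=> i /=; rewrite ltn_ord andbT.
by move=> ->; apply: (le_trans (H _ ln)); rewrite gerBl invr_ge0.
Qed.

(** The absolute difference: one of the two truncated subtractions is [0]. *)
Definition distn (a b : nat) := (a - b + (b - a))%N.

(** Each distance from [g1] is attained at most twice, once on either side. *)
Lemma sum_distn_le (R : realType) n G (f : nat -> R) (g1 : 'I_n) :
  (forall r, 0 <= f r) -> (g1 <= G)%N ->
  \sum_(g2 < n | (0 < g2 <= G)%N) f (distn g1 g2) <=
  2 * \sum_(r < n | (r <= G)%N) f r.
Proof.
move=> f0 g1G; rewrite (bigID (fun g2 : 'I_n => (g2 <= g1)%N)) /=.
rewrite mulr2n mulrDl mul1r; apply: lerD.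
  have hn (g2 : 'I_n) : (g1 - g2 < n)%N by apply: leq_ltn_trans (leq_subr _ _) _.
  rewrite (eq_bigr (fun g2 : 'I_n => f (Ordinal (hn g2)))); last first.
    move=> g2 /andP[_ h] /=; congr f; rewrite /distn; lia.
  apply: sum_inj_le => // [g2 g3|g2].
    move=> /andP[_ h2] /andP[_ h3] /(congr1 val) /= h.
    by apply: val_inj => /=; lia.
  by move=> _ /=; lia.
have hn (g2 : 'I_n) : (g2 - g1 < n)%N.
  by apply: leq_ltn_trans (leq_subr _ _) _.
rewrite (eq_bigr (fun g2 : 'I_n => f (Ordinal (hn g2)))); last first.
  move=> g2 /andP[_]; rewrite -ltnNge => h /=; congr f; rewrite /distn; lia.
apply: sum_inj_le => // [g2 g3|g2].
  rewrite -!ltnNge => /andP[_ h2] /andP[_ h3] /(congr1 val) /= h.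
  by apply: val_inj => /=; lia.
by move=> /andP[/andP[_ h] _] /=; lia.
Qed.

(** * Geometric sums of phases and the rarity of resonant pairs *)

Section exponential_sums.
Context (R : realType) (e : nat -> R[i]).
Hypothesis eD : forall m n, e (m + n)%N = e m * e n.
Hypothesis e_abs : forall n, cabs (e n) = 1.

(** For [e n = exp(2 pi i n theta)] this is comparable to the distance from [q * theta] to the
    nearest integer. The estimates on phases only use that [e] is a unimodular character. *)
Definition phase_gap (q : nat) := cabs (1 - e q).
Local Notation delta := phase_gap.

Lemma phase_conj n : e n * conjc (e n) = 1.
Proof. by rewrite mul_conjc e_abs expr1n. Qed.

Lemma phase_sub m n : (m <= n)%N -> e n * conjc (e m) = e (n - m).
Proof. by move=> mn; rewrite -{1}(subnK mn) eD -mulrA phase_conj mulr1. Qed.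

Lemma phase_gap_sub m n : (m <= n)%N -> delta (n - m) <= delta n + delta m.
Proof.
move=> mn; rewrite /delta -[X in X <= _]mul1r -(e_abs m) -cabsM.
have -> : e m * (1 - e (n - m)) = (1 - e n) + - (1 - e m).
  by rewrite mulrBr mulr1 -eD subnKC //; ring.
by apply: (le_trans (cabsD _ _)); rewrite cabsN.
Qed.

(** Multiplication by [1 - e k] telescopes the sum; the product form also covers [e k = 1]. *)
Lemma geometric_phase_sum k lo hi :
  cabs (\sum_(lo <= n < hi) e (k * n)) * delta k <= 2.
Proof.
rewrite /delta -cabsM.
have [hl|/ltnW lh] := leqP hi lo; first by rewrite big_geq // mul0r cabs0.
have -> : (\sum_(lo <= n < hi) e (k * n)) * (1 - e k) = e (k * lo) - e (k * hi).
  rewrite -(subnKC lh); elim: (hi - lo)%N => [|d IH].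
    by rewrite addn0 big_geq // mul0r subrr.
  rewrite addnS big_nat_recr ?leq_addr //= mulrDl IH mulrBr mulr1 -eD.
  by rewrite -mulnSr addrA subrK.
by apply: (le_trans (cabsD _ _)); rewrite cabsN !e_abs.
Qed.

Section pair_counting.
Context (eta : R) (D0 : nat).
Hypothesis D0_gt0 : (0 < D0)%N.
Hypothesis gap : forall q, (0 < q <= D0 ^ 2)%N -> 4 * eta < delta q.

Lemma small_gap_count n G D h : (0 < D)%N ->
  (forall q, (0 < q < D)%N -> 2 * eta < delta (h * q)) -> 0 <= eta ->
  (#|[pred r : 'I_n | (0 < r <= G) && (delta (h * r) <= eta)%R]| * D <= G)%N.
Proof.
move=> D1 hD eta0; apply: (@gap_count n G D (fun r => delta (h * r) <= eta)) => //.
  move=> r r0 hr; rewrite leqNgt; apply/negP => rD.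
  have /hD : (0 < r < D)%N by rewrite r0.
  by move=> h1; lra.
move=> r r' r0 hr hr' rr'; rewrite leqNgt; apply/negP => rD.
have /hD : (0 < r' - r < D)%N by rewrite subn_gt0 rr'.
rewrite mulnBr => h1.
have h2 : (h * r <= h * r')%N by rewrite leq_mul2l ltnW ?orbT.
by have := phase_gap_sub h2; lra.
Qed.

(* For fixed [h] the bad [r] have gaps at least the least [D] with
   [delta (h * D) <= 2 * eta]; for fixed small [D] the bad [h] are sparse in
   turn, because [gap] forbids small products. *)
Lemma pair_count n m G M : 0 <= eta ->
  \sum_(h < n | (0 < h <= M)%N) \sum_(r < m | (0 < r <= G)%N)
    (delta (h * r) <= eta)%R%:R <= 2 * G%:R * M%:R / D0%:R :> R.
Proof.
move=> eta0.
have DR : (0 : R) < D0%:R by rewrite ltr0n.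
pose c (h : nat) : nat :=
  #|[pred r : 'I_m | (0 < r <= G)%N && (delta (h * r) <= eta)%R]|.
have cE (h : nat) : \sum_(r < m | (0 < r <= G)%N) (delta (h * r) <= eta)%R%:R =
    (c h)%:R :> R.
  exact: sumr_natr_pred.
have c1 (h : nat) : (c h)%:R <= G%:R / D0%:R +
    \sum_(D < D0.+1 | (0 < D)%N) (delta (h * D) <= 2 * eta)%R%:R * (G%:R / D%:R) :> R.
  have [/existsP [D /andP[D1 hD]]|/existsPn hn] :=
    boolP [exists D : 'I_D0.+1, (0 < D)%N && (delta (h * D) <= 2 * eta)%R].
    pose Q := [pred D : nat | (0 < D <= D0)%N && (delta (h * D) <= 2 * eta)%R].
    have exQ : exists D, Q D by exists D; rewrite /Q /= D1 -ltnS ltn_ord.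
    case: (ex_minnP exQ) => D' /andP[/andP[D'0 D'1] hD'] minD'.
    have cD : (c h * D' <= G)%N.
      apply: small_gap_count => // q /andP[q0 qD]; rewrite ltNge; apply/negP => hq.
      by have := minD' q; rewrite /Q /= q0 hq (ltnW (leq_trans qD D'1)) => /(_ isT); lia.
    rewrite (bigD1 (Ordinal (D'1 : (D' < D0.+1)%N))) //= hD' mul1r.
    rewrite addrCA -[X in X <= _]addr0; apply: lerD.
      by rewrite ler_pdivlMr ?ltr0n // -natrM ler_nat.
    apply: addr_ge0; first by rewrite divr_ge0.
    by apply: sumr_ge0 => i _; rewrite mulr_ge0 // divr_ge0.
  rewrite -[X in X <= _]addr0; apply: lerD.
    rewrite ler_pdivlMr // -natrM ler_nat; apply: small_gap_count => //.
    move=> q /andP[q0 qD]; rewrite ltNge; apply/negP => hq.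
    have qD' : (q < D0.+1)%N by lia.
    by have /= := hn (Ordinal qD'); rewrite q0 hq.
  by apply: sumr_ge0 => i _; rewrite mulr_ge0 // divr_ge0.
(* The differences of bad [h] are bad for [4 * eta], so [gap] spaces them by more than [D0^2 / D].
   Against this density the count [G / D] contributes [G M / D0^2] for each of the [D0] values of
   [D]. *)
have c2 (D : nat) : (0 < D <= D0)%N ->
   \sum_(h < n | (0 < h <= M)%N) (delta (h * D) <= 2 * eta)%R%:R <=
   M%:R * D%:R / D0%:R ^+ 2 :> R.
  move=> /andP[D1 D2].
  set A := [pred h : 'I_n | (0 < h <= M)%N && (delta (h * D) <= 2 * eta)%R].
  have -> : \sum_(h < n | (0 < h <= M)%N) (delta (h * D) <= 2 * eta)%R%:R = #|A|%:R :> R.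
    exact: sumr_natr_pred.
  have : (#|A| * (D0 ^ 2 %/ D).+1 <= M)%N.
    apply: (@gap_count n M _ (fun h => delta (h * D) <= 2 * eta)) => //.
      move=> h h0 hh; rewrite ltnNge leq_divRL //; apply/negP => hD.
      have := @gap (h * D)%N; rewrite muln_gt0 h0 D1 hD => /(_ isT); lra.
    move=> h h' h0 hh hh' lt; rewrite ltnNge leq_divRL //; apply/negP => hD.
    have := @gap ((h' - h) * D)%N; rewrite muln_gt0 subn_gt0 lt D1 hD => /(_ isT).
    have h2 : (h * D <= h' * D)%N by rewrite leq_mul2r ltnW ?orbT.
    rewrite mulnBl; have := phase_gap_sub h2; lra.
  move=> hA; rewrite ler_pdivlMr ?exprn_gt0 // -natrX -!natrM ler_nat.
  have := ltn_ceil (D0 ^ 2) D1.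
  move: hA; set k := (_ %/ _).+1; set a := #|A| => hA kD.
  by nia.
under eq_bigr do rewrite cE.
apply: le_trans; first by apply: ler_sum => h _; exact: c1.
rewrite big_split /= exchange_big /=.
have -> : 2 * G%:R * M%:R / D0%:R =
   M%:R * (G%:R / D0%:R) + D0%:R * (G%:R * M%:R / D0%:R ^+ 2) :> R.
  by field; rewrite gt_eqF.
apply: lerD.
  apply: sumr_pred_le; rewrite ?divr_ge0 //; exact: card_ord_range.
apply: sumr_pred_le; first by rewrite divr_ge0 ?mulr_ge0 ?sqr_ge0.
  move=> D D1; rewrite -mulr_suml.
  have DD : (0 < D <= D0)%N by rewrite D1 -ltnS ltn_ord.
  apply: le_trans (_ : M%:R * D%:R / D0%:R ^+ 2 * (G%:R / D%:R) <= _).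
    by rewrite ler_wpM2r ?divr_ge0 // c2.
  rewrite le_eqVlt; apply/orP; left; apply/eqP; field.
  by rewrite gt_eqF //= pnatr_eq0 -lt0n.
apply: leq_trans (card_ord_range D0.+1 D0); apply: subset_leq_card.
by apply/fintype.subsetP => D; rewrite unfold_in inE => -> /=; rewrite -ltnS ltn_ord.
Qed.

End pair_counting.
End exponential_sums.

(** * Sums over dyadic blocks of primes *)

Section bilinear_sums.
Context (R : realType) (e : nat -> R[i]).
Hypothesis eD : forall m n, e (m + n)%N = e m * e n.
Hypothesis e_abs : forall n, cabs (e n) = 1.
Context (N : nat).
Local Notation delta := (phase_gap e).

(** For coprime [a], [b] with maximum [M] and difference [h], and a prime [n], this bounds in
    modulus the coefficient of [f(a) / f(b)] in [|A_n|^2], up to normalization ([cross_le_inner]).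
    It is defined for every integer [n] because primes will be replaced by integers. *)
Definition inner_sum (M h n : nat) : R[i] :=
  \sum_(g < N.+1 | smooth n g && (n * g * M <= N)%N) e (h * g * n).

Definition block_sum (j M h : nat) : R :=
  \sum_(p < N.+1 | prime p && (2 ^ j <= p < 2 ^ j.+1)%N) cabs (inner_sum M h p).

Lemma block_sum_ge0 j M h : 0 <= block_sum j M h.
Proof. by apply: sumr_ge0 => p _; exact: cabs_ge0. Qed.

Definition overlap (j M g1 g2 n : nat) :=
  [&& (2 ^ j <= n < 2 ^ j.+1)%N, smooth n g1 && (n * g1 * M <= N)%N &
      smooth n g2 && (n * g2 * M <= N)%N].

(** For fixed [g1], [g2] each condition on [n] is one-sided: smoothness bounds [n] from below by the
    largest prime factors, the size conditions bound it from above. *)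
Lemma overlap_itv j M g1 g2 : (0 < M)%N -> (0 < g1)%N -> (0 < g2)%N ->
  exists lo hi, forall n, overlap j M g1 g2 n = (lo <= n < hi)%N.
Proof.
move=> M0 g10 g20.
exists (maxn (2 ^ j) (maxn (maxprime g1).+1 (maxprime g2).+1)).
exists (minn (2 ^ j.+1) (minn (N %/ (g1 * M)).+1 (N %/ (g2 * M)).+1)).
move=> n; rewrite /overlap !geq_max !leq_min !ltnS.
rewrite !leq_divRL ?muln_gt0 ?g10 ?g20 // !mulnA.
have [hn|] := leqP (2 ^ j) n => //=.
have n0 : (0 < n)%N by apply: leq_trans hn; rewrite expn_gt0.
rewrite !smooth_maxprime // g10 g20 /=.
by case: (n < _)%N; case: (maxprime g1 < n)%N; case: (maxprime g2 < n)%N;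
   case: (_ <= N)%N; case: (_ <= N)%N.
Qed.

Lemma overlap_sum_trivial j M g1 g2 (F : nat -> R[i]) :
  (forall n, cabs (F n) <= 1) ->
  cabs (\sum_(n < N.+1 | overlap j M g1 g2 n) F n) <= (2 ^ j)%:R.
Proof.
move=> F1; apply: le_trans (cabs_sum _ _ _) _.
rewrite -[X in _ <= X]mulr1; apply: sumr_pred_le => //.
apply: leq_trans (_ : #|[pred n : 'I_N.+1 | 2 ^ j <= n < 2 ^ j.+1]| <= _)%N.
  by apply: subset_leq_card; apply/fintype.subsetP => n; rewrite unfold_in inE => /and3P[].
by apply: leq_trans (card_ord_itv _ _ _) _; rewrite expnS; lia.
Qed.

(** [L] is the saving over the trivial bound [2 ^ j]: the geometric sum, at most [2 / delta], is
    below [2 ^ j / L] unless [delta <= 2 * L / 2 ^ j]. At [r = 0] all phases cancel and nothing is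
    saved. *)
Definition minor (j : nat) (L : R) (h r : nat) : R :=
  if r == 0%N then (2 ^ j)%:R
  else (2 ^ j)%:R * (delta (h * r) <= 2 * L / (2 ^ j)%:R)%R%:R + (2 ^ j)%:R / L.

Lemma minor_ge0 j L h r : 0 < L -> 0 <= minor j L h r.
Proof.
by move=> L0; rewrite /minor; case: eqP => // _; rewrite addr_ge0 ?divr_ge0 ?mulr_ge0 // ltW.
Qed.

Lemma overlap_sum_le j M L h g1 g2 :
  0 < L -> (0 < M)%N -> (0 < g1)%N -> (0 < g2)%N ->
  cabs (\sum_(n < N.+1 | overlap j M g1 g2 n)
          e (h * g1 * n) * conjc (e (h * g2 * n))) <= minor j L h (distn g1 g2).
Proof.
move=> L0 M0; wlog le21 : g1 g2 / (g2 <= g1)%N => [H|].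
  move=> g10 g20; have [/H->//|/ltnW/H] := leqP g2 g1.
  have -> : distn g1 g2 = distn g2 g1 by rewrite /distn addnC.
  move=> /(_ g20 g10) h1; apply: le_trans h1.
  rewrite -cabs_conj conjc_sum le_eqVlt; apply/orP; left; apply/eqP.
  congr cabs; apply: eq_big => [n|n _]; first by congr (_ && _); exact: andbC.
  by rewrite conjcM conjcK mulrC.
move=> g10 g20.
rewrite (eq_bigr (fun n : 'I_N.+1 => e (h * (g1 - g2) * n))); last first.
  move=> n _; rewrite phase_sub // ?leq_mul // ; congr e.
  by rewrite -mulnBl -mulnBr.
have -> : distn g1 g2 = (g1 - g2)%N by rewrite /distn; lia.
rewrite /minor; case: ifPn => [_|r0].
  apply: (@overlap_sum_trivial _ _ _ _ (fun n => e (h * (g1 - g2) * n))) => n.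
  by rewrite e_abs.
case: (leP (delta (h * (g1 - g2))) (2 * L / (2 ^ j)%:R)) => hd.
  rewrite mulr1; apply: le_trans (_ : (2 ^ j)%:R <= _).
    apply: (@overlap_sum_trivial _ _ _ _ (fun n => e (h * (g1 - g2) * n))) => n.
    by rewrite e_abs.
  by rewrite lerDl divr_ge0 // ltW.
rewrite mulr0 add0r.
have [lo [hi hE]] := overlap_itv j M0 g10 g20.
rewrite (eq_bigl (fun n : 'I_N.+1 => (lo <= n < hi)%N)) //.
rewrite (sumr_ord_itv (fun n => e (h * (g1 - g2) * n))).
have j0 : (0 : R) < (2 ^ j)%:R by rewrite ltr0n expn_gt0.
have d0 : 0 < delta (h * (g1 - g2)).
  by apply: le_lt_trans hd; rewrite divr_ge0 ?mulr_ge0 ?ltW.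
have := geometric_phase_sum eD e_abs (h * (g1 - g2)) lo (minn N.+1 hi).
rewrite -ler_pdivlMr // => /le_trans; apply.
rewrite ler_pdivrMr // mulrAC ler_pdivlMr // [X in _ <= X]mulrC -ler_pdivrMr //.
exact: ltW.
Qed.

(* Cauchy-Schwarz: extending the primes of a block to all its integers leaves,
   for each pair [g1, g2], a sum over an interval. *)
Lemma block_sum_sqr j M L h : (0 < M)%N -> 0 < L ->
  block_sum j M h ^+ 2 <= (2 ^ j)%:R * (2 * (N %/ (2 ^ j * M))%:R *
    \sum_(r < N.+1 | (r <= N %/ (2 ^ j * M))%N) minor j L h r).
Proof.
move=> M0 L0; set G := (N %/ _)%N.
set B := fun n : 'I_N.+1 => (2 ^ j <= n < 2 ^ j.+1)%N.
set Q := fun (n : 'I_N.+1) (g : 'I_N.+1) => smooth n g && (n * g * M <= N)%N.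
set K := fun g : 'I_N.+1 => (0 < g <= G)%N.
have cB : (#|B| <= 2 ^ j)%N.
  by apply: leq_trans (card_ord_itv N.+1 (2 ^ j) (2 ^ j.+1)) _; rewrite expnS; lia.
apply: le_trans (ler_sum_sqr _ _) _.
apply: le_trans (_ : (2 ^ j)%:R * \sum_(n | B n) cabs (inner_sum M h n) ^+ 2 <= _).
  apply: ler_pM => //.
  - by apply: sumr_ge0 => i _; exact: sqr_ge0.
  - rewrite ler_nat; apply: leq_trans cB; apply: subset_leq_card.
    by apply/fintype.subsetP => n; rewrite !unfold_in => /andP[].
  - rewrite [X in X <= _]big_mkcond [X in _ <= X]big_mkcond; apply: ler_sum => n _.
    by rewrite /B; case: (prime n) => /=; case: ifP => // _; exact: sqr_ge0.
rewrite ler_wpM2l //.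
have BQK n g : B n -> Q n g -> K g.
  rewrite /B /Q /K => /andP[hn _] /andP[/smooth_gt0 -> /=].
  rewrite leq_divRL ?muln_gt0 ?expn_gt0 // => h1; apply: leq_trans h1.
  by rewrite mulnA [(g * _)%N]mulnC leq_mul2r leq_mul2r hn !orbT.
have E : real_complex R (\sum_(n | B n) cabs (inner_sum M h n) ^+ 2) =
  \sum_(g1 | K g1) \sum_(g2 | K g2) \sum_(n < N.+1 | overlap j M g1 g2 n)
     e (h * g1 * n) * conjc (e (h * g2 * n)).
  rewrite rmorph_sum /=; under eq_bigr do rewrite cabs_sum_sqr.
  rewrite (exchange_big_dep K) /=; last exact: BQK.
  apply: eq_bigr => g1 _.
  rewrite (exchange_big_dep K) /=; last by move=> n g /andP[Bn _]; exact: BQK.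
  apply: eq_bigr => g2 _; apply: eq_bigl => n.
  by rewrite /overlap -/(B n) -!andbA.
(* A nonnegative real is its own modulus, so the triangle inequality can be applied to the complex
   triple sum [E]. *)
have -> : \sum_(n | B n) cabs (inner_sum M h n) ^+ 2 =
    cabs (real_complex R (\sum_(n | B n) cabs (inner_sum M h n) ^+ 2)).
  by rewrite cabs_real ger0_norm // sumr_ge0 // => n _; exact: sqr_ge0.
rewrite E; apply: le_trans (cabs_sum _ _ _) _.
rewrite [2 * _]mulrC -mulrA; apply: sumr_pred_le; last exact: card_ord_range.
  by rewrite mulr_ge0 // sumr_ge0 // => r _; exact: minor_ge0.
move=> g1 /andP[g10 g1G].
apply: le_trans (cabs_sum _ _ _) _.
apply: le_trans (_ : \sum_(g2 | K g2) minor j L h (distn g1 g2) <= _).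
  by apply: ler_sum => g2 /andP[g20 _]; exact: overlap_sum_le.
by apply: sum_distn_le => // r; exact: minor_ge0.
Qed.

(** Relative to the trivial bound, the terms [r = 0] contribute [1 / G <= 1 / L], the resonant pairs
    [2 / D0] by [pair_count], and the remaining ones [1 / L]. The condition on [L] says that [g] has
    at least [L] values at its disposal. *)
Lemma block_sum_sqr_avg j M L D0 : (0 < M)%N -> (0 < D0)%N -> 0 < L ->
  (forall q, (0 < q <= D0 ^ 2)%N -> 4 * (2 * L / (2 ^ j)%:R) < delta q) ->
  L <= (N %/ (2 ^ j * M))%:R ->
  \sum_(h < N.+1 | (0 < h <= M)%N) block_sum j M h ^+ 2 <=
    4 * N%:R ^+ 2 / M%:R * (L^-1 + D0%:R^-1).
Proof.
move=> M0 D00 L0 gap LG; set G := (N %/ _)%N in LG *.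
set P : R := (2 ^ j)%:R.
have P0 : 0 < P by rewrite ltr0n expn_gt0.
have MR : (0 : R) < M%:R by rewrite ltr0n.
have DR : (0 : R) < D0%:R by rewrite ltr0n.
have G0 : (0 : R) < G%:R by apply: lt_le_trans LG.
apply: le_trans; first by apply: ler_sum => h _; exact: (block_sum_sqr j h M0 L0).
rewrite -mulr_sumr -mulr_sumr -/G -/P.
have eta0 : 0 <= 2 * L / P by rewrite divr_ge0 ?mulr_ge0 ?ltW.
have S : \sum_(h < N.+1 | (0 < h <= M)%N) \sum_(r < N.+1 | (r <= G)%N) minor j L h r <=
   P * M%:R + (P * (2 * G%:R * M%:R / D0%:R) + M%:R * (G%:R * (P / L))).
  rewrite (eq_bigr (fun h : 'I_N.+1 => P + \sum_(r < N.+1 | (0 < r <= G)%N)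
     (P * (delta (h * r) <= 2 * L / P)%R%:R + P / L))); last first.
    move=> h _; rewrite (bigD1 ord0) //=; congr (_ + _).
    apply: eq_big => [r|r /andP[rG r0]]; last first.
      by move: r0; rewrite -val_eqE /= => /negbTE r0; rewrite /minor r0.
    by rewrite -val_eqE /= -lt0n andbC.
  rewrite big_split /=; apply: lerD.
    rewrite [X in _ <= X]mulrC; apply: sumr_pred_le => //; exact: card_ord_range.
  under eq_bigr do rewrite big_split /=.
  rewrite big_split /=; apply: lerD.
    under eq_bigr do rewrite -mulr_sumr.
    rewrite -mulr_sumr ler_wpM2l ?(ltW P0) //.
    exact: (pair_count eD e_abs D00 gap).
  apply: sumr_pred_le; last exact: card_ord_range.
    by rewrite mulr_ge0 // divr_ge0 // ltW.
  move=> h _; apply: sumr_pred_le => //; last exact: card_ord_range.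
  by rewrite divr_ge0 // ltW.
apply: le_trans (_ : P * (2 * G%:R * (P * M%:R +
  (P * (2 * G%:R * M%:R / D0%:R) + M%:R * (G%:R * (P / L))))) <= _).
  rewrite ler_wpM2l ?(ltW P0) // ler_wpM2l // mulr_ge0 //.
have PG : P * G%:R <= N%:R / M%:R.
  rewrite ler_pdivlMr // -!natrM ler_nat -mulnA [(G * M)%N]mulnC mulnA mulnC.
  exact: leq_trunc_div.
have -> : P * (2 * G%:R * (P * M%:R +
  (P * (2 * G%:R * M%:R / D0%:R) + M%:R * (G%:R * (P / L))))) =
  (P * G%:R) ^+ 2 * (2 * M%:R * (G%:R^-1 + 2 / D0%:R + L^-1)).
  by field; rewrite !gt_eqF.
have -> : 4 * N%:R ^+ 2 / M%:R * (L^-1 + D0%:R^-1) =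
  (N%:R / M%:R) ^+ 2 * (2 * M%:R * (L^-1 + 2 / D0%:R + L^-1)) :> R.
  by field; rewrite !gt_eqF.
apply: ler_pM.
- exact: sqr_ge0.
- by rewrite !mulr_ge0 ?addr_ge0 ?invr_ge0 ?divr_ge0 ?ltW.
- by rewrite ler_pXn2r // nnegrE ?divr_ge0 // mulr_ge0 // ltW.
- by rewrite ler_pM2l ?mulr_gt0 // !lerD2r lef_pV2 // posrE.
Qed.

Lemma inner_sum_le M h n : (0 < M)%N -> (0 < n)%N ->
  cabs (inner_sum M h n) <= (N %/ (n * M))%:R.
Proof.
move=> M0 n0; apply: le_trans (cabs_sum _ _ _) _.
rewrite -[X in _ <= X]mulr1; apply: sumr_pred_le => // [g _|]; first by rewrite e_abs.
apply: leq_trans (card_ord_range N.+1 _); apply: subset_leq_card.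
apply/fintype.subsetP => g; rewrite unfold_in inE => /andP[/smooth_gt0 -> /=].
by rewrite leq_divRL ?muln_gt0 ?n0 // mulnA [(g * n)%N]mulnC.
Qed.

(** Trivial bound for each prime, times the Chebyshev count. It saves only a factor of order [j],
    but for every single [M] and [h] and without any condition on the length of the [g]-sum. *)
Lemma block_sum_le j M h : (0 < M)%N -> (1 < j)%N ->
  block_sum j M h <= 2 * (N%:R / M%:R) / j%:R.
Proof.
move=> M0 j1; have j0 : (0 : R) < j%:R by rewrite ltr0n; lia.
have MR : (0 : R) < M%:R by rewrite ltr0n.
set A := [pred p : 'I_N.+1 | prime p && (2 ^ j <= p < 2 ^ j.+1)%N].
apply: le_trans (_ : #|A|%:R * (N %/ (2 ^ j * M))%:R <= _).
  apply: sumr_pred_le => //; move=> p /andP[pp /andP[jp _]].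
  have p0 := prime_gt0 pp.
  apply: le_trans (inner_sum_le _ M0 p0) _; rewrite ler_nat leq_div2l //.
    by rewrite muln_gt0 expn_gt0.
  by rewrite leq_mul2r jp orbT.
have h1 : #|A|%:R <= (2 ^ j)%:R * 2 / j%:R :> R.
  rewrite ler_pdivlMr // -!natrM ler_nat mulnC.
  by apply: leq_trans (card_primes_block _ j1) _; rewrite expnS mulnC.
have h2 : (2 ^ j)%:R * (N %/ (2 ^ j * M))%:R <= N%:R / M%:R :> R.
  rewrite ler_pdivlMr // -!natrM ler_nat mulnAC mulnC.
  exact: leq_trunc_div.
apply: le_trans (ler_wpM2r _ h1) _ => //.
have -> : (2 ^ j)%:R * 2 / j%:R * (N %/ (2 ^ j * M))%:R =
  2 / j%:R * ((2 ^ j)%:R * (N %/ (2 ^ j * M))%:R) :> R by ring.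
by rewrite [X in _ <= X]mulrAC ler_pM2l // divr_gt0.
Qed.

Lemma block_sum_eq0 j M h : (N < 2 ^ j * M)%N -> block_sum j M h = 0.
Proof.
move=> hN; apply: big1 => p /andP[pp /andP[jp _]].
rewrite /inner_sum big_pred0 ?cabs0 // => g; apply/negbTE/negP.
move=> /andP[/smooth_gt0 g0 h1]; have : (2 ^ j * M <= N)%N; last by lia.
apply: leq_trans h1; rewrite leq_mul2r; apply/orP; right.
by apply: leq_trans jp _; rewrite leq_pmulr.
Qed.

End bilinear_sums.

(** * The total off-diagonal contribution *)

Section off_diagonal.
Context (R : realType) (e : nat -> R[i]).
Hypothesis eD : forall m n, e (m + n)%N = e m * e n.
Hypothesis e_abs : forall n, cabs (e n) = 1.
Context (N l J lam D0 : nat).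
Hypothesis NJ : (N < 2 ^ J)%N.
Local Notation delta := (phase_gap e).
Local Notation block_sum := (block_sum e N).
Local Notation inner_sum := (inner_sum e N).

Definition prime_sum (M h : nat) : R :=
  \sum_(p < N.+1 | prime p && (2 ^ l < p)%N) cabs (inner_sum M h p).

Lemma prime_sum_le_blocks M h :
  prime_sum M h <= \sum_(j < J | (l <= j)%N) block_sum j M h.
Proof.
rewrite /block_sum (exchange_big_dep (fun p : 'I_N.+1 => prime p)) /=; last first.
  by move=> j p _ /andP[].
rewrite /prime_sum big_mkcondr; apply: ler_sum => p pp.
case: ifPn => [lp|_]; last by apply: sumr_ge0 => j _; exact: cabs_ge0.
have p0 := prime_gt0 pp.
have tJ : (trunc_log 2 p < J)%N.
  rewrite -(@ltn_exp2l 2) //; apply: leq_ltn_trans (trunc_logP _ p0) _ => //.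
  by apply: leq_ltn_trans NJ; rewrite -ltnS.
rewrite (bigD1 (Ordinal tJ)) /=; first last.
  have /andP[tb1 tb2] := trunc_log_bounds (isT : (1 < 2)%N) p0.
  rewrite pp tb1 tb2 /= !andbT.
  by apply: trunc_log_max => //; exact: ltnW.
by rewrite lerDl; apply: sumr_ge0 => j _; exact: cabs_ge0.
Qed.

(** The [g]-sum then has room for [2 ^ lam] values, enough for Cauchy-Schwarz to save that factor.
    Blocks that are not far are either empty or have [2 ^ j * M] within a factor [2 ^ lam] of
    [N]. *)
Definition far (j M : nat) := (2 ^ lam * 2 ^ j * M <= N)%N.

(** One factor [J] comes from Cauchy-Schwarz over the blocks, one from their number, one from the
    harmonic sum over [M]. *)
Lemma far_total :
  (0 < D0)%N ->
  (forall q, (0 < q <= D0 ^ 2)%N -> 8 * (2 ^ lam)%:R / (2 ^ l)%:R < delta q) ->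
  \sum_(M < N.+1 | (0 < M)%N) \sum_(h < N.+1 | (0 < h <= M)%N)
    (\sum_(j < J | (l <= j)%N && far j M) block_sum j M h) ^+ 2 <=
  4 * J%:R ^+ 3 * N%:R ^+ 2 * ((2 ^ lam)%:R^-1 + D0%:R^-1).
Proof.
move=> D00 gap.
have L0 : (0 : R) < (2 ^ lam)%:R by rewrite ltr0n expn_gt0.
set c : R := _ + _.
have c0 : 0 <= c by rewrite addr_ge0 // invr_ge0.
apply: le_trans (_ : \sum_(M < N.+1 | (0 < M)%N)
    J%:R * (J%:R * (4 * N%:R ^+ 2 / M%:R * c)) <= _); last first.
  rewrite (eq_bigr (fun M : 'I_N.+1 => J%:R ^+ 2 * (4 * N%:R ^+ 2 * c) * (M%:R)^-1)); last first.
    by move=> M _; ring.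
  rewrite -mulr_sumr.
  have -> : 4 * J%:R ^+ 3 * N%:R ^+ 2 * c = J%:R ^+ 2 * (4 * N%:R ^+ 2 * c) * J%:R by ring.
  by rewrite ler_wpM2l ?mulr_ge0 ?sqr_ge0 // harmonic_dyadic.
apply: ler_sum => M M0.
apply: le_trans (_ : \sum_(h < N.+1 | (0 < h <= M)%N)
   J%:R * \sum_(j < J | (l <= j)%N && far j M) block_sum j M h ^+ 2 <= _).
  apply: ler_sum => h _; apply: le_trans (ler_sum_sqr _ _) _.
  rewrite ler_wpM2r // ?sumr_ge0 // => [j _|]; first exact: sqr_ge0.
  by rewrite ler_nat -[X in (_ <= X)%N]card_ord max_card.
rewrite -mulr_sumr ler_wpM2l // exchange_big /=.
apply: sumr_pred_le.
- by rewrite mulr_ge0 // divr_ge0 // mulr_ge0 // sqr_ge0.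
- move=> j /andP[lj fj]; apply: block_sum_sqr_avg => //.
    move=> q hq; apply: le_lt_trans (gap q hq).
    rewrite mulrA mulrA -natrM ler_pM2l ?mulr_gt0 //.
    by rewrite lef_pV2 ?posrE ?ltr0n ?expn_gt0 // ler_nat leq_exp2l.
  by rewrite ler_nat leq_divRL ?muln_gt0 ?expn_gt0 // mulnA.
- by rewrite -[X in (_ <= X)%N]card_ord max_card.
Qed.

(** The index of the last block [j] with [2 ^ j * M <= N]; later blocks are empty. *)
Definition level (M : nat) := trunc_log 2 (N %/ M).

(** Only blocks with [level M - lam < j <= level M] survive, at most [lam] of them. As
    [2 * lam <= l <= j], the saving [j] may be replaced by [level M] at the cost of a factor [2]. *)
Lemma near_sum_le M h : (0 < M)%N -> (1 < l)%N -> (2 * lam <= l)%N ->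
  \sum_(j < J | (l <= j)%N && ~~ far j M) block_sum j M h <=
  if (l <= level M)%N then lam%:R * (4 * (N%:R / M%:R) / (level M)%:R) else 0.
Proof.
move=> M0 l1 laml; set k := level M.
have MR : (0 : R) < M%:R by rewrite ltr0n.
rewrite (bigID (fun j : 'I_J => (2 ^ j * M <= N)%N)) /=.
rewrite [X in _ + X]big1 ?addr0; last first.
  by move=> j /andP[_]; rewrite -ltnNge => /block_sum_eq0->.
have jk (j : 'I_J) : (2 ^ j * M <= N)%N -> (j <= k)%N.
  by move=> hj; apply: trunc_log_max => //; rewrite leq_divRL.
case: ifPn => [lk|lk]; last first.
  rewrite big_pred0 // => j; apply/negbTE/negP => /andP[/andP[lj _] /jk jk'].
  by move/negP: lk; apply; exact: leq_trans jk'.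
have k0 : (0 : R) < k%:R by rewrite ltr0n; lia.
have kj (j : 'I_J) : (2 ^ j * M <= N)%N -> ~~ far j M -> (k < lam + j)%N.
  move=> hj; rewrite /far -ltnNge -expnD => hf.
  rewrite -(@ltn_exp2l 2) //; apply: leq_ltn_trans (trunc_logP _ _) _ => //.
    rewrite divn_gt0 //; apply: leq_trans hj; rewrite leq_pmull // expn_gt0 //.
  by rewrite ltn_divLR.
apply: sumr_pred_le; first by rewrite divr_ge0 // mulr_ge0 // divr_ge0.
  move=> j /andP[/andP[lj fj] hj].
  apply: le_trans (block_sum_le e_abs _ _ M0 _) _; first by lia.
  have j0 : (0 : R) < j%:R by rewrite ltr0n; lia.
  have kj2 : k%:R <= 2 * j%:R :> R.
    by rewrite -natrM ler_nat; have := kj _ hj fj; have := jk _ hj; lia.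
  rewrite ler_pdivrMr // mulrAC ler_pdivlMr //.
  have x0 : 0 <= N%:R / M%:R :> R by rewrite divr_ge0.
  by move: (N%:R / M%:R) x0 => x x0; nra.
apply: leq_trans (_ : #|[pred j : 'I_J | (k.+1 - lam <= j < k.+1)%N]| <= _)%N.
  apply: subset_leq_card; apply/fintype.subsetP => j; rewrite unfold_in inE.
  by move=> /andP[/andP[lj fj] hj]; have := kj _ hj fj; have := jk _ hj; lia.
by apply: leq_trans (card_ord_itv _ _ _) _; lia.
Qed.

(** These [M] lie in the dyadic range from [N / 2 ^ k.+1] to [N / 2 ^ k]. *)
Lemma level_class_le k :
  \sum_(M < N.+1 | (0 < M)%N && (level M == k) && (2 ^ k * M <= N)%N) (M%:R : R)^-1 <= 2.
Proof.
have [->|N0] := posnP N.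
  rewrite big1 // => i /andP[/andP[i0 _] _]; exfalso; have := ltn_ord i; lia.
have NR : (0 : R) < N%:R by rewrite ltr0n.
have kR : (0 : R) < (2 ^ k)%:R by rewrite ltr0n expn_gt0.
apply: le_trans (_ : (N %/ 2 ^ k)%:R * ((2 ^ k.+1)%:R / N%:R) <= _).
  apply: sumr_pred_le; first by rewrite divr_ge0.
    move=> M /andP[/andP[M0 /eqP kM] _].
    rewrite ler_pdivlMr // mulrC ler_pdivrMr ?ltr0n // -natrM ler_nat.
    rewrite -kM; apply: ltnW; rewrite -ltn_divLR //; exact: trunc_log_ltn.
  apply: leq_trans (card_ord_range N.+1 _); apply: subset_leq_card.
  apply/fintype.subsetP => M; rewrite unfold_in inE => /andP[/andP[-> _]] /=.
  by rewrite leq_divRL ?expn_gt0 // mulnC.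
rewrite mulrA ler_pdivrMr // expnS -!natrM ler_nat mulnCA leq_mul2l /=.
exact: leq_trunc_div.
Qed.

(** Sort [M] by its level [k]. The sum over [h] cancels one of the two factors [1 / M], a level
    carries at most [2] in the sum of [1 / M], and the sum of [1 / k^2] over [k >= l] yields the
    saving [1 / l]. *)
Lemma near_total : (1 < l)%N -> (2 * lam <= l)%N ->
  \sum_(M < N.+1 | (0 < M)%N) \sum_(h < N.+1 | (0 < h <= M)%N)
    (\sum_(j < J | (l <= j)%N && ~~ far j M) block_sum j M h) ^+ 2 <=
  64 * lam%:R ^+ 2 * N%:R ^+ 2 / l%:R.
Proof.
move=> l1 laml.
have lR : (0 : R) < l%:R by rewrite ltr0n; lia.
apply: le_trans (_ : \sum_(M < N.+1 | (0 < M)%N && (l <= level M)%N)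
    16 * lam%:R ^+ 2 * N%:R ^+ 2 * (M%:R^-1 * ((level M)%:R ^+ 2)^-1) <= _).
  rewrite [X in _ <= X]big_mkcondr; apply: ler_sum => M M0.
  have MR : (0 : R) < M%:R by rewrite ltr0n.
  case: ifPn => lM; last first.
    rewrite big1 // => h _; apply/eqP; rewrite expf_eq0 /=.
    rewrite eq_le; apply/andP; split; last by apply: sumr_ge0 => j _; exact: block_sum_ge0.
    by have := near_sum_le h M0 l1 laml; rewrite (negbTE lM).
  have k0 : (0 : R) < (level M)%:R by rewrite ltr0n; lia.
  apply: le_trans (_ : M%:R * (lam%:R * (4 * (N%:R / M%:R) / (level M)%:R)) ^+ 2 <= _).
    apply: sumr_pred_le; [exact: sqr_ge0| |exact: card_ord_range].
    move=> h _; rewrite ler_pXn2r ?nnegrE //.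
    - by have := near_sum_le h M0 l1 laml; rewrite lM.
    - by apply: sumr_ge0 => j _; exact: block_sum_ge0.
  rewrite le_eqVlt; apply/orP; left; apply/eqP; field.
  by rewrite !gt_eqF.
rewrite -mulr_sumr.
have -> : 64 * lam%:R ^+ 2 * N%:R ^+ 2 / l%:R =
  16 * lam%:R ^+ 2 * N%:R ^+ 2 * (2 * (2 / l%:R)) :> R by field; rewrite gt_eqF.
rewrite ler_wpM2l ?mulr_ge0 ?sqr_ge0 //.
apply: le_trans (_ : \sum_(k < J | (l <= k)%N) 2 * (k%:R ^+ 2)^-1 <= _); last first.
  by rewrite -mulr_sumr ler_wpM2l // sum_inv_sqr // ; lia.
apply: le_trans (_ : \sum_(k < J | (l <= k)%N) \sum_(M < N.+1 |
   (0 < M)%N && (level M == k) && (2 ^ k * M <= N)%N) M%:R^-1 * (k%:R ^+ 2)^-1 <= _); last first.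
  apply: ler_sum => k _; rewrite -mulr_suml ler_wpM2r ?invr_ge0 ?sqr_ge0 //.
  exact: level_class_le.
rewrite (exchange_big_dep (fun M : 'I_N.+1 => (0 < M)%N)) /=; last first.
  by move=> k M _ /andP[/andP[]].
rewrite big_mkcondr; apply: ler_sum => M M0.
have nonneg (k : nat) : 0 <= M%:R^-1 * (k%:R ^+ 2)^-1 :> R.
  by rewrite mulr_ge0 ?invr_ge0 ?sqr_ge0.
case: ifPn => [lM|_]; last by apply: sumr_ge0.
have h1 : (0 < N %/ M)%N by rewrite divn_gt0 // -ltnS.
have h2 := trunc_logP (isT : (1 < 2)%N) h1.
have kJ : (level M < J)%N.
  rewrite -(@ltn_exp2l 2) //; apply: leq_ltn_trans h2 _.
  exact: leq_ltn_trans (leq_div _ _) NJ.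
rewrite (bigD1 (Ordinal kJ)) /=; last by rewrite lM M0 eqxx -leq_divRL.
by rewrite lerDl; apply: sumr_ge0.
Qed.

Lemma off_diagonal_bound :
  (0 < D0)%N -> (1 < l)%N -> (2 * lam <= l)%N ->
  (forall q, (0 < q <= D0 ^ 2)%N -> 8 * (2 ^ lam)%:R / (2 ^ l)%:R < delta q) ->
  \sum_(M < N.+1 | (0 < M)%N) \sum_(h < N.+1 | (0 < h <= M)%N)
    prime_sum M h ^+ 2 <=
  N%:R ^+ 2 * (8 * J%:R ^+ 3 * ((2 ^ lam)%:R^-1 + D0%:R^-1) +
               128 * lam%:R ^+ 2 / l%:R).
Proof.
move=> D00 l1 laml gap.
have -> : N%:R ^+ 2 * (8 * J%:R ^+ 3 * ((2 ^ lam)%:R^-1 + D0%:R^-1) +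
               128 * lam%:R ^+ 2 / l%:R) =
  2 * (4 * J%:R ^+ 3 * N%:R ^+ 2 * ((2 ^ lam)%:R^-1 + D0%:R^-1)) +
  2 * (64 * lam%:R ^+ 2 * N%:R ^+ 2 / l%:R) :> R by ring.
apply: le_trans (lerD (ler_wpM2l _ (far_total D00 gap))
                      (ler_wpM2l _ (near_total l1 laml))) => //.
rewrite !mulr_sumr -big_split; apply: ler_sum => M M0 /=.
rewrite !mulr_sumr -big_split; apply: ler_sum => h _ /=.
have := prime_sum_le_blocks M h.
rewrite (bigID (fun j : 'I_J => far j M)) /=.
set x := \sum_(_ < _ | _) _; set y := \sum_(_ < _ | _) _ => h1.
have h0 : 0 <= prime_sum M h by apply: sumr_ge0 => p _; exact: cabs_ge0.
have h2 : prime_sum M h ^+ 2 <= (x + y) ^+ 2.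
  by rewrite ler_pXn2r ?nnegrE // (le_trans h0).
apply: le_trans h2 _; have := sqr_ge0 (x - y); nra.
Qed.

End off_diagonal.

(** * Integers with a large and simple largest prime factor *)

Section largest_prime_factor.
Context (N l : nat).
Local Open Scope nat_scope.

Definition factors_at (p n : nat) :=
  [&& prime p, 2 ^ l < p, p %| n & smooth p (n %/ p)].

(** Always [0] or [1]. Keeping it as a count makes the grouping by largest prime an exact identity,
    with remainder weights [1 - multiplicity n]. *)
Definition multiplicity (n : nat) := #|[pred p : 'I_N.+1 | factors_at p n]|.

Lemma factors_at_uniq n p q : factors_at p n -> factors_at q n -> p = q.
Proof.
move=> /and4P[pp _ pn /smoothP[_ hp]] /and4P[qp _ qn /smoothP[_ hq]].
have h (a b : nat) : prime a -> prime b -> a %| n -> b %| n ->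
    (forall q, prime q -> q %| n %/ a -> q < a) -> b <= a.
  move=> pa pb an bn ha; rewrite leqNgt; apply/negP => ab.
  move: bn; rewrite -(divnK an) Euclid_dvdM // => /orP[/(ha _ pb)|]; first by lia.
  by rewrite dvdn_prime2 // => /eqP h; lia.
by apply/eqP; rewrite eqn_leq; apply/andP; split; apply: h.
Qed.

Lemma multiplicity_le1 n : multiplicity n <= 1.
Proof.
rewrite leqNgt; apply/negP => /card_gt1P[p [q [/=]]].
rewrite !inE => hp hq /eqP; apply; apply: val_inj.
exact: factors_at_uniq hp hq.
Qed.

(** If the largest prime factor [p] exceeds [2 ^ l] and [p^2] does not divide [n], then [p] itself
    is counted; so either [p] is small or [d = p] is a witness. *)
Lemma multiplicity_eq0 n : 0 < n <= N -> multiplicity n = 0 ->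
  smooth (2 ^ l).+1 n || [exists d : 'I_N.+1, (2 ^ l < d) && (d * d %| n)].
Proof.
move=> /andP[n0 nN] h0.
have [//|hs] := boolP (smooth (2 ^ l).+1 n).
have n1 : 1 < n.
  rewrite ltn_neqAle n0 andbT; apply: contra hs => /eqP <-.
  by rewrite /smooth.
have pp := max_pdiv_prime n1; have pn := max_pdiv_dvd n.
set p := max_pdiv n in pp pn.
have pmax q : prime q -> q %| n -> q <= p.
  by move=> qp qn; apply: max_pdiv_max; rewrite mem_primes qp n0.
have lp : 2 ^ l < p.
  rewrite ltnNge; apply: contra hs => pl; apply/smoothP; split => // q qp qn.
  by rewrite ltnS (leq_trans (pmax _ qp qn)).
have pN : p < N.+1 by rewrite ltnS (leq_trans _ nN) // dvdn_leq.
apply/existsP; exists (Ordinal pN) => /=; rewrite lp /=.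
apply/negPn/negP => hd.
have : 0 < multiplicity n; last by rewrite h0.
apply/card_gt0P; exists (Ordinal pN); rewrite inE /factors_at /= pp lp pn /=.
apply/smoothP; split; first by rewrite divn_gt0 ?prime_gt0 // dvdn_leq.
move=> q qp qd; rewrite ltn_neqAle; apply/andP; split.
  apply: contra hd => /eqP e; rewrite -{1}(divnK pn) dvdn_pmul2r ?prime_gt0 //.
  by rewrite -{1}e.
by apply: pmax => //; apply: dvdn_trans qd (dvdn_div pn).
Qed.

Lemma card_multiples m D : 0 < D ->
  #|[pred r : 'I_m | (0 < r <= N) && (D %| r)]| * D <= N.
Proof.
move=> D0; apply: (@gap_count m N D (fun r => D %| r)) => //.
  by move=> r r0 /dvdn_leq; apply.
move=> r r' r0 Dr Dr' rr'; apply: dvdn_leq; first by rewrite subn_gt0.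
exact: dvdn_sub.
Qed.

Lemma sum_logn p : prime p -> \sum_(n < N.+1 | 0 < n) logn p n = logn p N`!.
Proof.
move=> pp; elim: N => [|m IH].
  by rewrite big1 ?fact0 ?logn1 // => i i0; exfalso; have := ltn_ord i; lia.
by rewrite big_mkcond big_ord_recr -big_mkcond /= IH factS lognM ?fact_gt0 // addnC.
Qed.

End largest_prime_factor.

(** * The exceptional integers are few *)

Section exceptional_set.
Context (R : realType) (N l t : nat).
Hypothesis l_gt0 : (0 < l)%N.
Hypothesis t_gt0 : (0 < t)%N.

(** Markov's inequality for the number [Om n] of prime factors at most [2 ^ l], with multiplicity: a
    smooth [n] above [2 ^ (l * t)] has more than [t] of them. The total of [Om] is a sum of
    valuations of the factorial of [N], each at most [N / (p - 1) <= 2 N / p], and the harmonic sum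
    up to [2 ^ l] is at most [l + 1]. *)
Lemma card_large_smooth :
  #|[pred n : 'I_N.+1 | smooth (2 ^ l).+1 n && (2 ^ (l * t) < n)%N]|%:R <=
  2 * N%:R * l.+1%:R / t%:R :> R.
Proof.
set A := [pred n : 'I_N.+1 | _].
have tR : (0 : R) < t%:R by rewrite ltr0n.
rewrite ler_pdivlMr //.
pose Om (n : nat) := (\sum_(p < (2 ^ l).+1 | prime p) logn p n)%N.
have h1 (n : 'I_N.+1) : A n -> (t <= Om n)%N.
  move=> /andP[sn tn].
  have := smooth_le_exp sn => h; have {h} := leq_trans tn h.
  rewrite expnM ltn_exp2l; last by rewrite -[1%N](expn0 2) ltn_exp2l.
  move=> /ltnW/leq_trans; apply.
  have H (F : nat -> nat) (a b : nat) :
    (\sum_(0 <= p < a | (p <= b) && prime p) F p <= \sum_(p < b.+1 | prime p) F p)%N.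
    rewrite big_mkord [X in (_ <= X)%N](eq_bigl (fun p : 'I_b.+1 => (p < b.+1)%N && prime p)); last first.
      by move=> i /=; rewrite ltn_ord.
    rewrite -(big_mkord (fun p => (p < b.+1)%N && prime p) F).
    rewrite -(big_mkord (fun p => (p <= b)%N && prime p) F).
    rewrite (@big_nat_widen _ _ _ 0 a (maxn a b.+1)) ?leq_maxl //.
    rewrite [X in (_ <= X)%N](@big_nat_widen _ _ _ 0 b.+1 (maxn a b.+1)) ?leq_maxr //.
    rewrite [X in (X <= _)%N]big_mkcond [X in (_ <= X)%N]big_mkcond.
    apply: leq_sum => i _ /=; case: (prime i) => /=; rewrite ?andbF ?andbT //=.
    by rewrite andbb; case: (i < b.+1)%N => //=; case: (i < a)%N.
  exact: H.
have h2 : (#|A| * t <= \sum_(n < N.+1 | 0 < n) Om n)%N.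
  rewrite -sum_nat_const; apply: leq_trans (_ : \sum_(n in A) Om n <= _)%N.
    by apply: leq_sum => n; exact: h1.
  rewrite big_mkcond [X in (_ <= X)%N]big_mkcond; apply: leq_sum => n _.
  by case: ifPn => // /andP[/smooth_gt0 ->].
apply: le_trans (_ : (\sum_(n < N.+1 | 0 < n) Om n)%N%:R <= _).
  by rewrite -natrM ler_nat.
rewrite /Om exchange_big /= natr_sum.
apply: le_trans (_ : \sum_(p < (2 ^ l).+1 | (0 < p)%N) 2 * N%:R * p%:R^-1 <= _); last first.
  rewrite -mulr_sumr ler_wpM2l ?mulr_ge0 // harmonic_dyadic //.
  by rewrite expnS mul2n -addnn -addn1 leq_add2l expn_gt0.
rewrite big_mkcond [X in _ <= X]big_mkcond; apply: ler_sum => p _.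
case: ifPn => [pp|_]; last first.
  by case: ifP => // _; rewrite mulr_ge0 ?mulr_ge0 ?invr_ge0.
rewrite prime_gt0 // (sum_logn N pp).
have pR : (0 : R) < p%:R by rewrite ltr0n prime_gt0.
rewrite ler_pdivlMr // -!natrM ler_nat.
have := logn_fact_bound N pp; have := prime_gt1 pp; nia.
Qed.

Lemma card_large_square :
  #|[pred n : 'I_N.+1 | (0 < n)%N &&
      [exists d : 'I_N.+1, (2 ^ l < d)%N && (d * d %| n)%N]]|%:R <=
  2 * N%:R / (2 ^ l)%:R :> R.
Proof.
set A := [pred n : 'I_N.+1 | _].
apply: le_trans (_ : \sum_(d < N.+1 | (2 ^ l < d)%N) N%:R * (d%:R ^+ 2)^-1 <= _); last first.
  rewrite -mulr_sumr [2 * _]mulrC -mulrA ler_wpM2l //.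
  apply: le_trans (sum_inv_sqr _ _ _) _ => //.
  rewrite ler_pM2l // lef_pV2 ?posrE ?ltr0n ?expn_gt0 // ler_nat //.
apply: le_trans (_ : \sum_(n in A) \sum_(d < N.+1 | (2 ^ l < d)%N) (d * d %| n)%:R <= _).
  rewrite -sum1_card natr_sum; apply: ler_sum => n /andP[_ /existsP[d /andP[ld dn]]].
  by rewrite (bigD1 d) //= dn lerDl sumr_ge0.
rewrite exchange_big /=; apply: ler_sum => d ld.
have d0 : (0 < d)%N by apply: leq_ltn_trans ld.
have dR : (0 : R) < d%:R ^+ 2 by rewrite exprn_gt0 // ltr0n.
rewrite ler_pdivlMr //.
apply: le_trans (_ : #|[pred r : 'I_N.+1 | (0 < r <= N)%N && (d * d %| r)%N]|%:R * d%:R ^+ 2 <= _).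
  rewrite ler_wpM2r ?(ltW dR) // sumr_natr_pred ler_nat; apply: subset_leq_card.
  apply/fintype.subsetP => n; rewrite !inE => /andP[/andP[-> _] ->] /=.
  by rewrite andbT -ltnS ltn_ord.
by rewrite expr2 -!natrM ler_nat card_multiples // muln_gt0 d0.
Qed.

(** The three terms count the small integers, the larger smooth ones, and those with a large square
    divisor. *)
Lemma exceptional_bound :
  \sum_(n < N.+1 | (0 < n)%N) (1 - (multiplicity N l n)%:R) <=
  (2 ^ (l * t))%:R + 2 * N%:R * l.+1%:R / t%:R + 2 * N%:R / (2 ^ l)%:R :> R.
Proof.
set A := [pred n : 'I_N.+1 | (0 < n <= 2 ^ (l * t))%N].
set B := [pred n : 'I_N.+1 | smooth (2 ^ l).+1 n && (2 ^ (l * t) < n)%N].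
set C := [pred n : 'I_N.+1 | (0 < n)%N &&
      [exists d : 'I_N.+1, (2 ^ l < d)%N && (d * d %| n)%N]].
apply: le_trans (_ : #|A|%:R + #|B|%:R + #|C|%:R <= _); last first.
  apply: lerD; last exact: card_large_square.
  apply: lerD; last exact: card_large_smooth.
  by rewrite ler_nat card_ord_range.
rewrite -!sum1_card !natr_sum.
rewrite [X in _ <= X + _ + _]big_mkcond [X in _ <= _ + X + _]big_mkcond
  [X in _ <= _ + X]big_mkcond [X in X <= _]big_mkcond -!big_split /=.
apply: ler_sum => n _; rewrite /A /B /C !inE.
have b01 (b : bool) : 0 <= (if b then 1 else 0) :> R by case: b.
case: ifPn => [n0|_]; last by rewrite !addr_ge0.
have [m0|m1] := posnP (multiplicity N l n); last first.
  have -> : multiplicity N l n = 1%N by apply/eqP; rewrite eqn_leq multiplicity_le1.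
  by rewrite subrr !addr_ge0.
rewrite m0 subr0 /=.
have nN : (0 < n <= N)%N by rewrite n0 -ltnS ltn_ord.
case/orP: (multiplicity_eq0 nN m0) => [->|->]; last first.
  by rewrite lerDr addr_ge0.
case: (leqP n (2 ^ (l * t))) => _ /=; first by rewrite addr0 lerDl.
by rewrite add0r lerDl.
Qed.

End exceptional_set.

(** * Expectation of bounded measurable functions *)

(** This class is closed under the operations used below and integrable for every probability, so a
    single side condition serves for all expectations. *)
Definition bmeas (R : realType) (d : measure_display) (T : measurableType d)
    (X : T -> R) : Prop :=
  measurable_fun setT X /\ exists M : R, forall t, `|X t| <= M.

Section bounded_measurable.
Context (R : realType) (d : measure_display) (T : measurableType d).
Implicit Types X Y : T -> R.

Lemma bmeas_cst c : bmeas (fun _ : T => c : R).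
Proof. by split; [exact: measurable_cst|exists `|c|]. Qed.

Lemma bmeasD X Y : bmeas X -> bmeas Y -> bmeas (fun t => X t + Y t).
Proof.
move=> [mX [MX bX]] [mY [MY bY]]; split; first exact: measurable_funD.
by exists (MX + MY) => t; apply: (le_trans (ler_normD _ _)); exact: lerD.
Qed.

Lemma bmeasM X Y : bmeas X -> bmeas Y -> bmeas (fun t => X t * Y t).
Proof.
move=> [mX [MX bX]] [mY [MY bY]]; split; first exact: measurable_funM.
by exists (MX * MY) => t; rewrite normrM ler_pM.
Qed.

Lemma bmeasZ c X : bmeas X -> bmeas (fun t => c * X t).
Proof. by move=> hX; apply: bmeasM => //; exact: bmeas_cst. Qed.

Lemma bmeasN X : bmeas X -> bmeas (fun t => - X t).
Proof.
move=> [mX [MX bX]]; split; first exact: measurableT_comp.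
by exists MX => t; rewrite normrN.
Qed.

Lemma bmeasB X Y : bmeas X -> bmeas Y -> bmeas (fun t => X t - Y t).
Proof. by move=> hX hY; apply: bmeasD => //; exact: bmeasN. Qed.

Lemma bmeasX n X : bmeas X -> bmeas (fun t => X t ^+ n).
Proof.
move=> hX; elim: n => [|n IH]; first exact: bmeas_cst.
by under eq_fun do rewrite exprS; exact: bmeasM.
Qed.

Lemma bmeas_norm X : bmeas X -> bmeas (fun t => `|X t|).
Proof.
move=> [mX [MX bX]]; split; first exact: measurableT_comp.
by exists MX => t; rewrite normr_id.
Qed.

Lemma bmeas_sum (I : Type) (s : seq I) (P : pred I) (F : I -> T -> R) :
  (forall i, P i -> bmeas (F i)) -> bmeas (fun t => \sum_(i <- s | P i) F i t).
Proof.
move=> hF; elim: s => [|i s IH].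
  by under eq_fun do rewrite big_nil; exact: bmeas_cst.
under eq_fun do rewrite big_cons.
case Pi: (P i) => //; apply: bmeasD => //; exact: hF.
Qed.

Lemma bmeas_comp (phi : R -> R) X : continuous phi ->
  (exists M : R, forall x, `|phi x| <= M) -> measurable_fun setT X ->
  bmeas (fun t => phi (X t)).
Proof.
move=> cphi [M bphi] mX; split; last by exists M.
by apply: measurableT_comp => //; exact: continuous_measurable_fun.
Qed.

Lemma bmeas_cos X : measurable_fun setT X -> bmeas (fun t => cos (X t)).
Proof.
apply: bmeas_comp; first exact: continuous_cos.
by exists 1 => x; exact: cos_max.
Qed.

Lemma bmeas_sin X : measurable_fun setT X -> bmeas (fun t => sin (X t)).
Proof.
apply: bmeas_comp; first exact: continuous_sin.
by exists 1 => x; exact: sin_max.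
Qed.

End bounded_measurable.

(** A real number; for [bmeas] functions the integral is finite and [fine] loses nothing ([ExE]). *)
Definition Ex (R : realType) (d : measure_display) (T : measurableType d)
  (P : probability T R) (X : T -> R) : R := fine (\int[P]_t (X t)%:E).

Section expectation.
Context (R : realType) (d : measure_display) (T : measurableType d).
Variable P : probability T R.
Implicit Types X Y : T -> R.

Lemma bmeas_integrable X : bmeas X -> P.-integrable setT (EFin \o X).
Proof.
move=> [mX [M bX]]; apply: measurable_bounded_integrable => //.
  by rewrite [X in (X < _)%E](probability_setT P) ltry.
exists M; split; first exact: num_real.
by move=> x Mx t _; apply: le_trans (bX t) (ltW Mx).
Qed.

Lemma ExE X : bmeas X -> (\int[P]_t (X t)%:E)%E = (Ex P X)%:E.
Proof.
by move=> hX; rewrite /Ex fineK // integrable_fin_num //; exact: bmeas_integrable.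
Qed.

Lemma expectation_Ex X : bmeas X -> ('E_P[X])%E = (Ex P X)%:E.
Proof. by move=> hX; rewrite unlock ExE. Qed.

Lemma eq_Ex X Y : (forall t, X t = Y t) -> Ex P X = Ex P Y.
Proof. by move=> h; congr Ex; apply/funext. Qed.

Lemma ExD X Y : bmeas X -> bmeas Y -> Ex P (fun t => X t + Y t) = Ex P X + Ex P Y.
Proof.
move=> hX hY; apply: EFin_inj; rewrite EFinD -!ExE //; last exact: bmeasD.
under eq_integral do rewrite EFinD.
by rewrite integralD //; exact: bmeas_integrable.
Qed.

Lemma ExZ c X : bmeas X -> Ex P (fun t => c * X t) = c * Ex P X.
Proof.
move=> hX; apply: EFin_inj; rewrite EFinM -!ExE //; last exact: bmeasZ.
under eq_integral do rewrite EFinM.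
by rewrite integralZl //; exact: bmeas_integrable.
Qed.

Lemma ExN X : bmeas X -> Ex P (fun t => - X t) = - Ex P X.
Proof.
move=> hX; rewrite -mulN1r -ExZ //; apply: eq_Ex => t; by rewrite mulN1r.
Qed.

Lemma ExB X Y : bmeas X -> bmeas Y -> Ex P (fun t => X t - Y t) = Ex P X - Ex P Y.
Proof. by move=> hX hY; rewrite ExD ?ExN //; exact: bmeasN. Qed.

Lemma Ex_cst c : Ex P (fun=> c) = c.
Proof.
apply: EFin_inj; rewrite -ExE; last exact: bmeas_cst.
by rewrite integral_cst // [X in (_ * X)%E](probability_setT P) mule1.
Qed.

Lemma Ex_sum (I : Type) (s : seq I) (Q : pred I) (F : I -> T -> R) :
  (forall i, Q i -> bmeas (F i)) ->
  Ex P (fun t => \sum_(i <- s | Q i) F i t) = \sum_(i <- s | Q i) Ex P (F i).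
Proof.
move=> hF; elim: s => [|i s IH].
  rewrite big_nil -[RHS](Ex_cst 0); apply: eq_Ex => t; by rewrite big_nil.
rewrite big_cons -IH; case: ifP => Qi; last first.
  by apply: eq_Ex => t; rewrite big_cons Qi.
rewrite -ExD; [|exact: hF|exact: bmeas_sum].
by apply: eq_Ex => t; rewrite big_cons Qi.
Qed.

Lemma Ex_ge0 X : (forall t, 0 <= X t) -> 0 <= Ex P X.
Proof. by move=> h; apply: fine_ge0; apply: integral_ge0 => t _; rewrite lee_fin. Qed.

Lemma Ex_le X Y : bmeas X -> bmeas Y -> (forall t, X t <= Y t) -> Ex P X <= Ex P Y.
Proof.
move=> hX hY h; rewrite -subr_ge0 -ExB //; apply: Ex_ge0 => t.
by rewrite subr_ge0.
Qed.

Lemma Ex_norm X : bmeas X -> `|Ex P X| <= Ex P (fun t => `|X t|).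
Proof.
move=> hX; have hN := bmeas_norm hX.
rewrite ler_norml -ExN //; apply/andP; split; apply: Ex_le => //.
- exact: bmeasN.
- by move=> t; exact: lerNnormlW.
- by move=> t; exact: ler_norm.
Qed.

End expectation.

Lemma Ex_same_law (R : realType) (d1 d2 d' : measure_display)
    (T1 : measurableType d1) (T2 : measurableType d2) (T' : measurableType d')
    (P1 : probability T1 R) (P2 : probability T2 R)
    (Y1 : T1 -> T') (Y2 : T2 -> T') (psi : T' -> R) :
  measurable_fun setT Y1 -> measurable_fun setT Y2 ->
  (forall A, measurable A -> P1 (Y1 @^-1` A) = P2 (Y2 @^-1` A)) ->
  bmeas psi ->
  Ex P1 (fun t => psi (Y1 t)) = Ex P2 (fun t => psi (Y2 t)).
Proof.
move=> mY1 mY2 h [mpsi [M bpsi]].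
pose Z1 : {mfun T1 >-> T'} := mfun_Sub (mem_set mY1).
pose Z2 : {mfun T2 >-> T'} := mfun_Sub (mem_set mY2).
have b1 : bmeas (fun t => psi (Z1 t)).
  by split; [exact: measurableT_comp|exists M].
have b2 : bmeas (fun t => psi (Z2 t)).
  by split; [exact: measurableT_comp|exists M].
have e1 := @integral_distribution _ _ _ _ R P1 Z1 (EFin \o psi) _ (bmeas_integrable P1 b1).
have e2 := @integral_distribution _ _ _ _ R P2 Z2 (EFin \o psi) _ (bmeas_integrable P2 b2).
rewrite /Ex; congr fine.
transitivity (\int[distribution P1 Z1]_w (psi w)%:E)%E.
  by rewrite e1 //; exact/measurable_EFinP.
transitivity (\int[distribution P2 Z2]_w (psi w)%:E)%E; last first.
  by rewrite e2 //; exact/measurable_EFinP.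
by apply: eq_measure_integral => A mA _; exact: h.
Qed.

Section product_of_independent.
Context (R : realType) (d d1 d2 : measure_display) (T : measurableType d)
  (T1 : measurableType d1) (T2 : measurableType d2).
Variable P : probability T R.

(** The joint law agrees with the product of the laws on rectangles, hence everywhere; Fubini then
    splits the integral. The target spaces are arbitrary so that a whole sigma-algebra can serve as
    one variable. *)
Lemma Ex_mul_indep (X : {mfun T >-> T1}) (Y : {mfun T >-> T2})
    (phi : T1 -> R) (psi : T2 -> R) :
  (forall A B, measurable A -> measurable B ->
     P (X @^-1` A `&` Y @^-1` B) = (P (X @^-1` A) * P (Y @^-1` B))%E) ->
  bmeas phi -> bmeas psi ->
  Ex P (fun t => phi (X t) * psi (Y t)) =
  Ex P (fun t => phi (X t)) * Ex P (fun t => psi (Y t)).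
Proof.
move=> indep hphi hpsi.
have mXY : measurable_fun setT (fun t => (X t, Y t)).
  by apply/measurable_fun_pairP; split.
pose XY : {mfun T >-> (T1 * T2)%type} := mfun_Sub (mem_set mXY).
have bcomp d' (T' : measurableType d') (Z : {mfun T >-> T'}) (f : T' -> R) :
    bmeas f -> bmeas (fun t => f (Z t)).
  by move=> [mf [M bf]]; split; [exact: measurableT_comp|exists M].
have ExZ' d' (T' : measurableType d') (Z : {mfun T >-> T'}) (f : T' -> R) :
    bmeas f -> Ex P (fun t => f (Z t)) = Ex (distribution P Z) f.
  move=> hf; rewrite /Ex (@integral_distribution _ _ _ _ _ P Z (EFin \o f)) //.
    by apply/measurable_EFinP; case: hf.
  exact: bmeas_integrable (bcomp _ _ Z _ hf).
have hpp : bmeas (fun z : T1 * T2 => phi z.1 * psi z.2).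
  apply: bmeasM.
    by case: hphi => mf [M bf]; split; [exact: measurableT_comp|exists M].
  by case: hpsi => mf [M bf]; split; [exact: measurableT_comp|exists M].
rewrite (ExZ' _ _ X) // (ExZ' _ _ Y) //.
have -> : Ex P (fun t => phi (X t) * psi (Y t)) = Ex (distribution P XY) (fun z => phi z.1 * psi z.2).
  by rewrite -(ExZ' _ _ XY).
set m1 := distribution P X; set m2 := distribution P Y.
have E : (\int[distribution P XY]_z (phi z.1 * psi z.2)%:E =
          \int[m1 \x m2]_z (phi z.1 * psi z.2)%:E)%E.
  apply: eq_measure_integral => A mA _; apply/esym.
  apply: (@product_measure_unique _ _ _ _ R m1 m2 (distribution P XY)) => // B C mB mC.
rewrite /Ex E.
have hint : (m1 \x m2)%E.-integrable setT (EFin \o (fun z => phi z.1 * psi z.2)).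
  case: hpp => mpp [M bM].
  apply: measurable_bounded_integrable => //.
    have h : ((m1 \x m2) (setT `*` setT) < +oo)%E.
      rewrite product_measure1E // [X in (X * _)%E](probability_setT m1).
      by rewrite [X in (_ * X)%E](probability_setT m2) mule1 ltry.
    by rewrite setXTT in h.
  exists M; split; first exact: num_real.
  by move=> x Mx t _; apply: le_trans (bM t) (ltW Mx).
rewrite -(integral12_prod_meas1 hint) /=.
rewrite (eq_integral (fun x => ((Ex m2 psi) * phi x)%:E)); last first.
  move=> x _; rewrite /fubini_F /=.
  under eq_integral do rewrite EFinM.
  by rewrite integralZl ?ExE // ?EFinM 1?muleC //; exact: bmeas_integrable.
by rewrite mulrC -ExZ.
Qed.

End product_of_independent.

(** * Integrals of characters over the circle *)

Section integration_by_primitive.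
Context (R : realType).

Lemma integral_primitive (F f : R -> R) (a b : R) : a < b ->
  (forall x : R, is_derive x (1 : R) F (f x)) -> continuous f ->
  (\int[lebesgue_measure]_(x in `[a, b]) (f x)%:E = (F b - F a)%:E)%E.
Proof.
move=> ab dF cf.
have cF : continuous F.
  move=> x; apply: differentiable_continuous; apply/derivable1_diffP.
  exact: ex_derive.
rewrite (@continuous_FTC2 _ f F) ?EFinB //.
- exact: continuous_subspaceT.
- split.
  + by move=> x _; exact: ex_derive.
  + by apply: cvg_at_right_filter; exact: cF.
  + by apply: cvg_at_left_filter; exact: cF.
- by move=> x _; rewrite derive1E derive_val.
Qed.

Lemma uniform_cos_integral (a c : R) : a != 0 ->
  sin (a + c) = sin c ->
  Ex (uniform_prob (@ltr01 R)) (fun u => cos (a * u + c)) = 0.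
Proof.
move=> a0 hs; set P := uniform_prob _.
have hb : bmeas (fun u : R => cos (a * u + c)).
  by apply: bmeas_cos; apply: measurable_funD => //.
(* Adding [1] makes the integrand nonnegative, as the formula for integrals under the uniform law
   requires. *)
have E1 : (\int[P]_u (1 + cos (a * u + c))%:E = 1%:E)%E.
  rewrite integral_uniform; first last.
  - by move=> x; rewrite lee_fin -lerBlDl sub0r cos_geN1.
  - apply/measurable_EFinP; apply: measurable_funD => //.
    by case: hb.
  rewrite subr0 invr1 mul1e.
  have dF (x : R) : is_derive x (1 : R) (fun u => u + a^-1 * sin (a * u + c))
      (1 + cos (a * x + c)).
    apply: is_deriveD => //.
    have h : is_derive x 1 (fun u => a * u + c) a.
      rewrite -[X in is_derive _ _ _ X]addr0; apply: is_deriveD.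
      rewrite -[X in is_derive _ _ _ X]mulr1.
      exact: is_deriveZ.
    have h2 := @is_derive1_comp _ sin (fun u => a * u + c) x _ _ (is_derive_sin _) h.
    have h3 := @is_deriveZ _ _ _ (sin \o (fun u => a * u + c)) a^-1 x 1 _ h2.
    rewrite (_ : cos (a * x + c) = a^-1 *: (cos (a * x + c) * a)); first exact: h3.
    by rewrite /GRing.scale /= mulrCA mulVf ?mulr1.
  have cf : continuous (fun u : R => 1 + cos (a * u + c)).
    move=> x; apply: cvgD; first exact: cvg_cst.
    apply: continuous_comp; last exact: continuous_cos.
    apply: cvgD; last exact: cvg_cst.
    by apply: cvgMr; exact: cvg_id.
  rewrite (integral_primitive ltr01 dF cf).
  by rewrite mulr1 mulr0 !add0r hs addrK.
have := ExD P (bmeas_cst _ 1) hb; rewrite Ex_cst.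
rewrite [X in X = _]/Ex E1 /= => /eqP.
by rewrite -{1}[1]addr0 => /eqP/addrI.
Qed.

End integration_by_primitive.

(** * Projection onto the unit circle *)

Section unit_part.
Context (R : realType).

Lemma expiD (x y : R) : expi (x + y) = expi x * expi y.
Proof.
by apply/eqP; rewrite eq_complex /= cosD sinD; apply/andP; split; apply/eqP; ring.
Qed.

Lemma expi0 : expi (0 : R) = 1.
Proof. by rewrite /expi cos0 sin0. Qed.

Lemma expiX (x : R) n : expi x ^+ n = expi (n%:R * x).
Proof.
elim: n => [|n IH]; first by rewrite expr0 mul0r expi0.
by rewrite exprS IH -expiD -[in RHS]natr1 mulrDl mul1r addrC.
Qed.

Lemma cabs_expi (x : R) : cabs (expi x) = 1.
Proof. by rewrite /cabs /= cos2Dsin2 sqrtr1. Qed.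

(* A Steinhaus variable lies on the circle only almost surely; replacing the
   exceptional values by 1 makes everything below bounded. *)
Definition unit_part (w : R * R) : R[i] :=
  if w.1 ^+ 2 + w.2 ^+ 2 == 1 then Complex w.1 w.2 else 1.

Lemma cabs_unit_part w : cabs (unit_part w) = 1.
Proof.
rewrite /unit_part; case: ifPn => [/eqP h|_]; last exact: cabs1.
by rewrite /cabs /= h sqrtr1.
Qed.

Lemma unit_part_expi x : unit_part (ReIm (expi x)) = expi x :> R[i].
Proof. by rewrite /unit_part /= cos2Dsin2 eqxx. Qed.

Lemma measurable_unit_part_pred :
  measurable_fun setT (fun w : R * R => w.1 ^+ 2 + w.2 ^+ 2 == 1).
Proof.
apply: measurable_fun_eqr => //.
by apply: measurable_funD; apply: measurable_funX; [exact: measurable_fst|exact: measurable_snd].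
Qed.

Lemma measurable_Re_unit_part :
  measurable_fun setT (fun w : R * R => complex.Re (unit_part w)).
Proof.
rewrite (_ : (fun w => _) = (fun w : R * R =>
  if w.1 ^+ 2 + w.2 ^+ 2 == 1 then w.1 else 1)); last first.
  by apply/funext => w; rewrite /unit_part; case: ifP.
apply: measurable_fun_ifT => //; first exact: measurable_unit_part_pred.
Qed.

Lemma measurable_Im_unit_part :
  measurable_fun setT (fun w : R * R => complex.Im (unit_part w)).
Proof.
rewrite (_ : (fun w => _) = (fun w : R * R =>
  if w.1 ^+ 2 + w.2 ^+ 2 == 1 then w.2 else 0)); last first.
  by apply/funext => w; rewrite /unit_part; case: ifP.
apply: measurable_fun_ifT => //; first exact: measurable_unit_part_pred.
Qed.

End unit_part.

(** * Complex-valued bounded functions and their expectation *)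

Definition cbmeas (R : realType) (d : measure_display) (T : measurableType d)
    (Z : T -> R[i]) : Prop :=
  bmeas (fun t => complex.Re (Z t)) /\ bmeas (fun t => complex.Im (Z t)).

Section complex_bounded_measurable.
Context (R : realType) (d : measure_display) (T : measurableType d).
Implicit Types Z W : T -> R[i].

Lemma cbmeas_cst c : cbmeas (fun _ : T => c : R[i]).
Proof. by split; exact: bmeas_cst. Qed.

Lemma cbmeasD Z W : cbmeas Z -> cbmeas W -> cbmeas (fun t => Z t + W t).
Proof.
move=> [rZ iZ] [rW iW]; split.
  by under eq_fun do rewrite ReD; exact: bmeasD.
by under eq_fun do rewrite ImD; exact: bmeasD.
Qed.

Lemma cbmeasM Z W : cbmeas Z -> cbmeas W -> cbmeas (fun t => Z t * W t).
Proof.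
move=> [rZ iZ] [rW iW]; split.
  by under eq_fun do rewrite ReM; apply: bmeasB; exact: bmeasM.
by under eq_fun do rewrite ImM; apply: bmeasD; exact: bmeasM.
Qed.

Lemma cbmeas_conj Z : cbmeas Z -> cbmeas (fun t => conjc (Z t)).
Proof.
move=> [rZ iZ]; split.
  by rewrite (_ : (fun t => _) = (fun t => complex.Re (Z t))) //;
     apply/funext => t; case: (Z t).
rewrite (_ : (fun t => _) = (fun t => - complex.Im (Z t))); last first.
  by apply/funext => t; case: (Z t).
exact: bmeasN.
Qed.

Lemma cbmeasX n Z : cbmeas Z -> cbmeas (fun t => Z t ^+ n).
Proof.
move=> hZ; elim: n => [|n IH]; first exact: cbmeas_cst.
by under eq_fun do rewrite exprS; exact: cbmeasM.
Qed.

Lemma cbmeas_sum (I : Type) (s : seq I) (P : pred I) (F : I -> T -> R[i]) :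
  (forall i, P i -> cbmeas (F i)) -> cbmeas (fun t => \sum_(i <- s | P i) F i t).
Proof.
move=> hF; elim: s => [|i s IH].
  by under eq_fun do rewrite big_nil; exact: cbmeas_cst.
under eq_fun do rewrite big_cons.
case Pi: (P i) => //; apply: cbmeasD => //; exact: hF.
Qed.

Lemma cbmeas_prod (I : Type) (s : seq I) (P : pred I) (F : I -> T -> R[i]) :
  (forall i, P i -> cbmeas (F i)) -> cbmeas (fun t => \prod_(i <- s | P i) F i t).
Proof.
move=> hF; elim: s => [|i s IH].
  by under eq_fun do rewrite big_nil; exact: cbmeas_cst.
under eq_fun do rewrite big_cons.
case Pi: (P i) => //; apply: cbmeasM => //; exact: hF.
Qed.

Lemma bmeas_cabs_sqr Z : cbmeas Z -> bmeas (fun t => cabs (Z t) ^+ 2).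
Proof.
move=> [rZ iZ]; under eq_fun do rewrite cabs_sqr.
by apply: bmeasD; exact: bmeasX.
Qed.

End complex_bounded_measurable.

Definition Exc (R : realType) (d : measure_display) (T : measurableType d)
    (P : probability T R) (Z : T -> R[i]) : R[i] :=
  Complex (Ex P (fun t => complex.Re (Z t))) (Ex P (fun t => complex.Im (Z t))).

Section complex_expectation.
Context (R : realType) (d : measure_display) (T : measurableType d).
Variable P : probability T R.
Implicit Types Z W : T -> R[i].

Lemma eq_Exc Z W : (forall t, Z t = W t) -> Exc P Z = Exc P W.
Proof. by move=> h; congr Exc; apply/funext. Qed.

Lemma Exc_cst c : Exc P (fun=> c) = c.
Proof. by rewrite /Exc !Ex_cst; case: c. Qed.

Lemma ExcD Z W : cbmeas Z -> cbmeas W ->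
  Exc P (fun t => Z t + W t) = Exc P Z + Exc P W.
Proof.
move=> [rZ iZ] [rW iW]; rewrite /Exc.
rewrite (eq_Ex P (fun t => ReD (Z t) (W t))) (eq_Ex P (fun t => ImD (Z t) (W t))).
by rewrite !ExD.
Qed.

Lemma ExcZ c Z : cbmeas Z -> Exc P (fun t => c * Z t) = c * Exc P Z.
Proof.
move=> [rZ iZ]; rewrite /Exc.
rewrite (eq_Ex P (fun t => ReM c (Z t))) (eq_Ex P (fun t => ImM c (Z t))).
rewrite ExB ?ExD ?ExZ //; try exact: bmeasZ.
by case: c.
Qed.

Lemma Exc_sum (I : Type) (s : seq I) (Q : pred I) (F : I -> T -> R[i]) :
  (forall i, Q i -> cbmeas (F i)) ->
  Exc P (fun t => \sum_(i <- s | Q i) F i t) = \sum_(i <- s | Q i) Exc P (F i).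
Proof.
move=> hF; elim: s => [|i s IH].
  rewrite big_nil -[RHS](Exc_cst 0); apply: eq_Exc => t; by rewrite big_nil.
rewrite big_cons -IH; case: ifP => Qi; last first.
  by apply: eq_Exc => t; rewrite big_cons Qi.
rewrite -ExcD; [|exact: hF|exact: cbmeas_sum].
by apply: eq_Exc => t; rewrite big_cons Qi.
Qed.

Lemma Exc_conj Z : cbmeas Z -> Exc P (fun t => conjc (Z t)) = conjc (Exc P Z).
Proof.
move=> [rZ iZ]; rewrite /Exc /= -ExN //; congr Complex; apply: eq_Ex => t;
  by case: (Z t).
Qed.

Lemma Exc_real X : bmeas X -> Exc P (fun t => real_complex R (X t)) = real_complex R (Ex P X).
Proof. by move=> hX; rewrite /Exc /= Ex_cst. Qed.

End complex_expectation.

(** * Unimodular version, filtration by primes, independence from the past *)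

Section steinhaus_model.
Context (R : realType) (d : measure_display) (T : measurableType d).
Variables (P : probability T R) (f : nat -> T -> R[i]).
Hypothesis f_steinhaus : steinhaus P f.

Let f_mul : forall t, completely_multiplicative (fun n => f n t).
Proof. by case: f_steinhaus. Qed.
Let f_indep : mutually_independent P [set p | prime p] (fun p t => ReIm (f p t)).
Proof. by case: f_steinhaus. Qed.
Let f_unif : forall p, prime p -> uniform_on_circle P (f p).
Proof. by case: f_steinhaus. Qed.

(** Rebuilt from the unit parts at primes, so that modulus one and multiplicativity at positive
    integers hold at every point of [T], while equality with [f] holds almost surely
    ([unit_version_ae]). *)
Definition unit_version (n : nat) (t : T) : R[i] :=
  \prod_(p < n.+1 | prime p) unit_part (ReIm (f p t)) ^+ logn p n.
Local Notation F := unit_version.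

Lemma unit_version_widen n B t : (0 < n < B)%N ->
  F n t = \prod_(p < B | prime p) unit_part (ReIm (f p t)) ^+ logn p n.
Proof.
move=> /andP[n0 nB]; rewrite /F.
rewrite (big_ord_widen_cond B (fun p => prime p)
  (fun p => unit_part (ReIm (f p t)) ^+ logn p n)) //.
rewrite big_mkcondr /=; apply: eq_bigr => p pp.
case: ifPn => //; rewrite -leqNgt => np.
by rewrite ltn_log0 // expr0.
Qed.

Lemma unit_versionM m n t : (0 < m)%N -> (0 < n)%N -> F (m * n) t = F m t * F n t.
Proof.
move=> m0 n0; have mn0 : (0 < m * n)%N by rewrite muln_gt0 m0.
rewrite (@unit_version_widen m (m * n).+1) ?m0 ?ltnS ?leq_pmulr //.
rewrite (@unit_version_widen n (m * n).+1) ?n0 ?ltnS ?leq_pmull //.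
rewrite /F -big_split /=; apply: eq_bigr => p pp.
by rewrite lognM // exprD.
Qed.

Lemma unit_version1 t : F 1 t = 1.
Proof. by rewrite /F big1 // => p _; rewrite logn1. Qed.

Lemma unit_version_prime p t : prime p -> F p t = unit_part (ReIm (f p t)).
Proof.
move=> pp; rewrite /F (bigD1 ord_max) //= big1 ?mulr1.
  by rewrite logn_prime // eqxx expr1.
move=> q /andP[qp qm]; rewrite logn_prime // .
case: eqP => [e|]; last by rewrite expr0.
by move: qm; rewrite -val_eqE /= e eqxx.
Qed.

Lemma unit_versionX p k t : prime p -> F (p ^ k) t = F p t ^+ k.
Proof.
move=> pp; elim: k => [|k IH]; first by rewrite expn0 unit_version1.
by rewrite expnS unit_versionM ?expn_gt0 ?prime_gt0 // IH exprS.
Qed.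

Lemma cabs_unit_version n t : cabs (F n t) = 1.
Proof.
rewrite /F; elim/big_rec: _ => [|p x _ IH]; first exact: cabs1.
rewrite cabsM IH mulr1; elim: (logn p n) => [|k IHk]; first exact: cabs1.
by rewrite exprS cabsM IHk cabs_unit_part mulr1.
Qed.

Lemma unit_version_conj n t : F n t * conjc (F n t) = 1.
Proof. by rewrite mul_conjc cabs_unit_version expr1n. Qed.

Lemma prime_factorization n t : (0 < n)%N ->
  f n t = \prod_(p < n.+1 | prime p) f p t ^+ logn p n.
Proof.
move=> n0; have [f1 fM] := f_mul t.
have fX p k : (0 < p)%N -> f (p ^ k) t = f p t ^+ k.
  move=> p0; elim: k => [|k IH]; first by rewrite expn0 f1.
  by rewrite expnS fM ?expn_gt0 ?p0 // IH exprS.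
have fP (s : seq nat) (g : nat -> nat) (Q : pred nat) :
    (forall p, Q p -> 0 < g p)%N ->
    f (\prod_(p <- s | Q p) g p)%N t = \prod_(p <- s | Q p) f (g p) t.
  move=> hg; elim: s => [|p s IH]; first by rewrite !big_nil f1.
  rewrite !big_cons; case: ifP => // Qp; rewrite fM ?IH ?hg //.
  by apply: prodn_cond_gt0.
rewrite -{1}(partnT n0) /partn (bigID prime) /= [X in (_ * X)%N]big1 ?muln1; last first.
  by move=> p /negbTE pp; rewrite lognE pp.
rewrite fP => [|p pp]; last by rewrite expn_gt0 prime_gt0.
rewrite big_mkord; apply: eq_bigr => p pp.
by rewrite fX ?prime_gt0.
Qed.

Lemma measurable_ReIm p : prime p -> measurable_fun setT (fun t => ReIm (f p t)).
Proof. by move=> /f_unif[]. Qed.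

Lemma off_circle_null p : prime p ->
  P [set t | (ReIm (f p t)).1 ^+ 2 + (ReIm (f p t)).2 ^+ 2 != 1] = 0%E.
Proof.
move=> pp; have [_ hu] := f_unif pp.
pose B : set (R * R) := [set w | w.1 ^+ 2 + w.2 ^+ 2 != 1].
have mB : measurable B.
  have := @measurable_unit_part_pred R measurableT [set false] I.
  rewrite setTI (_ : _ @^-1` _ = B) //; apply/seteqP; split => w; rewrite /B /=.
    by move=> ->.
  by move/negbTE.
rewrite (hu B mB) (_ : [set u | _] = set0) ?measure0 //.
by apply/seteqP; split => // u; rewrite /B /= cos2Dsin2 eqxx.
Qed.

Lemma unit_version_ae N :
  P.-negligible [set t | ~ forall n, (0 < n <= N)%N -> F n t = f n t].
Proof.
have mA p : prime p -> measurable
    [set t | (ReIm (f p t)).1 ^+ 2 + (ReIm (f p t)).2 ^+ 2 != 1].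
  move=> pp.
  have := measurableT_comp (@measurable_unit_part_pred R) (measurable_ReIm pp).
  move=> /(_ measurableT [set false] I).
  rewrite setTI (_ : _ @^-1` _ =
    [set t | (ReIm (f p t)).1 ^+ 2 + (ReIm (f p t)).2 ^+ 2 != 1]) //.
  by apply/seteqP; split => t /= => [->|/negbTE].
apply: (@negligibleS _ _ _ _ (\bigcup_p (if prime p then
    [set t | (ReIm (f p t)).1 ^+ 2 + (ReIm (f p t)).2 ^+ 2 != 1] else set0))).
  move=> t /= h; apply: contrapT => h'; apply: h => n /andP[n0 nN].
  rewrite prime_factorization // /F; apply: eq_bigr => p pp; congr (_ ^+ _).
  rewrite /unit_part; case: ifPn => [_|hp]; first by case: (f p t).
  by exfalso; apply: h'; exists p => //; rewrite pp.
apply: negligible_bigcup => p; case: ifPn => pp; last exact: negligible_set0.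
by exists [set t | (ReIm (f p t)).1 ^+ 2 + (ReIm (f p t)).2 ^+ 2 != 1]; split => //;
  [exact: mA|exact: off_circle_null].
Qed.

Definition primes_below (n : nat) : {fset nat} := 
  [fset p | p in [seq q <- iota 0 n | prime q]]%fset.

(** A pi-system generating the sigma-algebra of the [f p] with [p < n], on which the independence
    assumption can be applied directly. *)
Definition cylinder (n : nat) : set (set T) :=
  [set A | exists2 B : nat -> set (R * R), (forall p, measurable (B p)) &
     A = \bigcap_(p in [set` primes_below n]) ((fun t => ReIm (f p t)) @^-1` B p)].

Lemma mem_primes_below n p : (p \in primes_below n) = prime p && (p < n)%N.
Proof. by rewrite in_fset_ /= mem_filter mem_iota add0n. Qed.

Lemma cylinderI n : setI_closed (cylinder n).
Proof.
move=> A A' [B mB ->] [B' mB' ->]; exists (fun p => B p `&` B' p).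
  by move=> p; exact: measurableI.
by rewrite -bigcapI.
Qed.

Lemma cylinderT n : cylinder n setT.
Proof.
exists (fun=> setT) => //.
by apply/seteqP; split.
Qed.

Lemma cylinder_measurable n : cylinder n `<=` measurable.
Proof.
move=> A [B mB ->]; apply: fin_bigcap_measurable => //.
move=> p /=; rewrite mem_primes_below => /andP[pp _].
by rewrite -[X in measurable X]setTI; exact: (measurable_ReIm pp).
Qed.

(** The set [T] with the smaller sigma-algebra, as a type of its own: being adapted is then [bmeas]
    over [past n], and the closure lemmas apply as they are. *)
Definition past (n : nat) := g_sigma_algebraType (cylinder n).
Definition adapted (n : nat) (X : T -> R) := @bmeas R _ (past n) X.
Definition cadapted (n : nat) (Z : T -> R[i]) := @cbmeas R _ (past n) Z.

Lemma past_measurable n (A : set T) : <<s cylinder n >> A -> measurable A.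
Proof.
apply: smallest_sub; last exact: cylinder_measurable.
exact: sigma_algebra_measurable.
Qed.

Lemma adapted_bmeas n X : adapted n X -> bmeas X.
Proof.
move=> [mX [M bX]]; split; last by exists M.
by move=> _ B mB; apply: (@past_measurable n); exact: mX.
Qed.

Lemma cylinder_le m n : (m <= n)%N -> cylinder m `<=` cylinder n.
Proof.
move=> mn A [B mB ->]; exists (fun p => if (p < m)%N then B p else setT).
  by move=> p; case: ifP.
apply/seteqP; split => t ht p /=; rewrite mem_primes_below => /andP[pp pn].
  by case: ifP => // pm; apply: ht; rewrite /= mem_primes_below pp.
have := ht p; rewrite /= mem_primes_below pp pn (leq_trans pn mn).
by apply.
Qed.

Lemma adapted_le m n X : (m <= n)%N -> adapted m X -> adapted n X.
Proof.
move=> mn [mX [M bX]]; split; last by exists M.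
move=> _ B mB; have h := mX measurableT B mB.
apply: (@smallest_sub _ _ _ <<s cylinder n >> (smallest_sigma_algebra _ _) _ _ h).
exact: (subset_trans (@cylinder_le _ _ mn) (@sub_sigma_algebra _ _ _)).
Qed.

Lemma cadapted_le m n Z : (m <= n)%N -> cadapted m Z -> cadapted n Z.
Proof. by move=> mn [h1 h2]; split; exact: (adapted_le mn). Qed.

Lemma cadapted_cbmeas n Z : cadapted n Z -> cbmeas Z.
Proof. by move=> [h1 h2]; split; exact: (@adapted_bmeas n). Qed.

Lemma ReIm_past_measurable n p : prime p -> (p < n)%N ->
  @measurable_fun _ _ (past n) _ setT (fun t => ReIm (f p t)).
Proof.
move=> pp pn _ B mB; rewrite setTI; apply: sub_sigma_algebra.
exists (fun q => if q == p then B else setT); first by move=> q; case: ifP.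
apply/seteqP; split => t /= h.
  by move=> q /= _; case: ifPn => [/eqP ->|].
by have := h p; rewrite /= mem_primes_below pp pn eqxx; exact.
Qed.

Lemma unit_part_bmeas n p : prime p -> (p < n)%N -> cadapted n (F p).
Proof.
move=> pp pn; have -> : F p = fun t => unit_part (ReIm (f p t)).
  by apply/funext => t; exact: unit_version_prime.
split; split.
- exact: (measurableT_comp (@measurable_Re_unit_part R) (ReIm_past_measurable pp pn)).
- by exists 1 => t; rewrite -[X in _ <= X](cabs_unit_part (ReIm (f p t))) normr_Re_le.
- exact: (measurableT_comp (@measurable_Im_unit_part R) (ReIm_past_measurable pp pn)).
- by exists 1 => t; rewrite -[X in _ <= X](cabs_unit_part (ReIm (f p t))) normr_Im_le.
Qed.

Lemma unit_version_adapted n m : smooth n m -> cadapted n (F m).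
Proof.
move=> /smoothP[m0 hm].
apply: (@cbmeas_prod R _ (past n)) => p pp.
have [pm|] := boolP (p %| m)%N.
  have := @unit_part_bmeas n p pp (hm _ pp pm).
  rewrite (_ : F p = fun t => unit_part (ReIm (f p t))); last first.
    by apply/funext => t; exact: unit_version_prime.
  exact: (@cbmeasX R _ (past n)).
move=> pm; have -> : logn p m = 0%N by rewrite lognE (negbTE pm) !andbF.
exact: (@cbmeas_cst R _ (past n)).
Qed.

(** For fixed [C], the finite measures [A |-> P (A & C)] and [A |-> P A * P C] agree on cylinders,
    hence on the generated sigma-algebra. *)
Lemma past_indep n p (A : set T) (B : set (R * R)) : prime p -> (n <= p)%N ->
  <<s cylinder n >> A -> measurable B ->
  P (A `&` (fun t => ReIm (f p t)) @^-1` B) =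
  (P A * P ((fun t => ReIm (f p t)) @^-1` B))%E.
Proof.
move=> pp np sA mB; set C := _ @^-1` B.
have mC : measurable C by rewrite -[C]setTI; exact: (measurable_ReIm pp).
have PC1 : (0 <= fine (P C))%R by exact: fine_ge0.
have PCE : P C = (fine (P C))%:E.
  by rewrite fineK // ge0_fin_numE // (le_lt_trans (probability_le1 _ _)) // ltry.
pose m1 : {measure set T -> \bar R} := mrestr P mC.
pose m2 : {measure set T -> \bar R} := mscale (NngNum PC1) P.
suff : m1 A = m2 A by rewrite /m1 /m2 /= /mrestr /mscale /= -PCE muleC.
apply: (@g_sigma_algebra_measure_unique _ R T (cylinder n) (@cylinder_measurable n)
  (fun=> setT) (fun=> cylinderT n) _ m1 m2 (@cylinderI n)) => //.
- by rewrite bigcup_const.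
- move=> D [D' mD' ->]; rewrite /m1 /m2 /= /mrestr /mscale /= -PCE [RHS]muleC.
  (* Independence is applied to the primes below [n], and again with [p] added; the second product
     has the extra factor [P C]. *)
  pose J := (p |` primes_below n)%fset.
  pose D'' q := if q == p then B else D' q.
  have pJ : p \notin primes_below n by rewrite mem_primes_below pp /= -leqNgt.
  have JP : [set` J] `<=` [set p | prime p].
    move=> q /=; rewrite in_fset1U => /orP[/eqP->//|].
    by rewrite mem_primes_below => /andP[].
  have JP' : [set` primes_below n] `<=` [set p | prime p].
    by move=> q /=; rewrite mem_primes_below => /andP[].
  have mD'' q : measurable (D'' q) by rewrite /D''; case: ifP.
  have := f_indep JP mD''; have := f_indep JP' mD'.
  rewrite big_fsetU1 //= => h1 h2.
  have -> : \bigcap_(q in [set` primes_below n]) (fun t => ReIm (f q t)) @^-1` D' q `&` C =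
      \bigcap_(q in [set` J]) ((fun t => ReIm (f q t)) @^-1` D'' q).
    apply/seteqP; split => t.
      move=> [h hC] q /=; rewrite in_fset1U /D''; case: ifPn => [/eqP->//|_ /= hq].
      exact: h.
    move=> h; split => [q hq|].
      have := h q; rewrite /= in_fset1U hq orbT /D'' => /(_ isT).
      by case: ifPn => // /eqP e; move: hq pJ; rewrite /= e => ->.
    by have := h p; rewrite /= in_fset1U eqxx /D'' eqxx /=; apply.
  rewrite h2 h1 /D'' eqxx muleC; congr (_ * _)%E.
  rewrite big_seq [RHS]big_seq; apply: eq_bigr => q hq.
  by case: ifPn => // /eqP e; move: hq pJ; rewrite e => ->.
- move=> _; rewrite /m1 /= /mrestr /= (le_lt_trans (probability_le1 _ _)) ?ltry //.
  exact: measurableI.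
Qed.

Lemma Ex_circle p (psi : R * R -> R) : prime p -> bmeas psi ->
  Ex P (fun t => psi (ReIm (f p t))) =
  Ex (uniform_prob (@ltr01 R)) (fun u => psi (ReIm (expi (2 * pi * u)))).
Proof.
move=> pp hpsi; have [mY hu] := f_unif pp.
apply: (Ex_same_law (Y1 := fun t => ReIm (f p t))
  (Y2 := fun u : measurableTypeR R => ReIm (expi (2 * pi * u)))) => //.
have h1 : measurable_fun setT (fun u : R => cos (2 * pi * u)).
  apply: continuous_measurable_fun => x; apply: continuous_comp.
    by apply: cvgMr; exact: cvg_id.
  exact: continuous_cos.
have h2 : measurable_fun setT (fun u : R => sin (2 * pi * u)).
  apply: continuous_measurable_fun => x; apply: continuous_comp.
    by apply: cvgMr; exact: cvg_id.
  exact: continuous_sin.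
exact: (measurable_fun_pair h1 h2).
Qed.

(** The past enters as the single variable [idfun : T -> past n], of which every adapted function is
    a function. *)
Lemma Ex_past_mul n p H (psi : R * R -> R) : prime p -> (n <= p)%N ->
  adapted n H -> bmeas psi ->
  Ex P (fun t => H t * psi (ReIm (f p t))) =
  Ex P H * Ex P (fun t => psi (ReIm (f p t))).
Proof.
move=> pp np hH hpsi.
have mI : measurable_fun setT (idfun : T -> past n).
  by move=> _ A mA; rewrite setTI; exact: (@past_measurable n).
pose X : {mfun T >-> past n} := mfun_Sub (mem_set mI).
pose Y : {mfun T >-> (R * R)%type} := mfun_Sub (mem_set (measurable_ReIm pp)).
apply: (@Ex_mul_indep R _ _ _ T _ _ P X Y H psi) => // A B mA mB.
exact: (@past_indep n p A B).
Qed.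

(** Given the primes below [p], a positive power of [F p] has mean zero, because [exp(2 pi i k u)]
    integrates to [0] over a period. The sine is treated as a cosine shifted by [pi / 2]. *)
Lemma Ex_character n p k H : prime p -> (n <= p)%N -> (0 < k)%N -> adapted n H ->
  Ex P (fun t => H t * complex.Re (F p t ^+ k)) = 0 /\
  Ex P (fun t => H t * complex.Im (F p t ^+ k)) = 0.
Proof.
move=> pp np k0 hH.
have hu : cbmeas (fun w : R * R => unit_part w ^+ k).
  apply: cbmeasX; split; split.
  - exact: measurable_Re_unit_part.
  - by exists 1 => w; rewrite -[X in _ <= X](cabs_unit_part w) normr_Re_le.
  - exact: measurable_Im_unit_part.
  - by exists 1 => w; rewrite -[X in _ <= X](cabs_unit_part w) normr_Im_le.
have FE t : F p t ^+ k = unit_part (ReIm (f p t)) ^+ k by rewrite unit_version_prime.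
have a0 : k%:R * (2 * pi) != 0 :> R.
  by rewrite !mulf_neq0 // ?pnatr_eq0 -?lt0n // gt_eqF // pi_gt0.
have per (c : R) : sin (k%:R * (2 * pi) + c) = sin c.
  have -> : k%:R * (2 * pi) + c = c + (pi *+ 2) *+ k :> R.
    by rewrite addrC -[pi *+ 2]mulr_natl -[X in _ = _ + X]mulr_natl.
  by rewrite (periodicn (@sinD2pi R)).
have [hr hi] := hu.
split.
  rewrite (eq_Ex P (fun t => congr1 (fun z => H t * complex.Re z) (FE t))).
  rewrite (Ex_past_mul pp np hH hr) (Ex_circle pp hr).
  rewrite [X in _ * X](_ : _ = 0) ?mulr0 //.
  rewrite -[RHS](uniform_cos_integral a0 (per 0)); apply: eq_Ex => u.
  by rewrite unit_part_expi expiX /= addr0 mulrA.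
rewrite (eq_Ex P (fun t => congr1 (fun z => H t * complex.Im z) (FE t))).
rewrite (Ex_past_mul pp np hH hi) (Ex_circle pp hi).
rewrite [X in _ * X](_ : _ = 0) ?mulr0 //.
rewrite -[RHS](uniform_cos_integral a0 (per (- (pi / 2)))); apply: eq_Ex => u.
by rewrite unit_part_expi expiX /= cosBpihalf mulrA.
Qed.

End steinhaus_model.

(** * Orthogonality relations and Parseval identities *)

Section orthogonality.
Context (R : realType) (d : measure_display) (T : measurableType d).
Variables (P : probability T R) (f : nat -> T -> R[i]).
Hypothesis f_steinhaus : steinhaus P f.
Local Notation F := (unit_version f).

Lemma Exc_character n p k H : prime p -> (n <= p)%N -> (0 < k)%N ->
  cadapted f n H -> Exc P (fun t => H t * F p t ^+ k) = 0.
Proof.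
move=> pp np k0 [hr hi].
have [r1 r2] := Ex_character f_steinhaus pp np k0 hr.
have [i1 i2] := Ex_character f_steinhaus pp np k0 hi.
have hF : cbmeas (fun t => F p t ^+ k).
  apply: cbmeasX; apply: (cadapted_cbmeas f_steinhaus (n := p.+1)).
  exact: unit_part_bmeas.
have [br bi] := hF.
have cr := adapted_bmeas f_steinhaus hr; have ci := adapted_bmeas f_steinhaus hi.
rewrite /Exc (eq_Ex P (fun t => ReM (H t) (F p t ^+ k))).
rewrite (eq_Ex P (fun t => ImM (H t) (F p t ^+ k))).
rewrite ExB ?ExD; try exact: bmeasM.
by rewrite r1 r2 i1 i2 subr0 addr0.
Qed.

Lemma cbmeas_unit_version n : (0 < n)%N -> cbmeas (F n).
Proof.
move=> n0; apply: (cadapted_cbmeas f_steinhaus (n := n.+1)).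
apply: unit_version_adapted => //; apply/smoothP; split => // q _ qn.
by rewrite ltnS dvdn_leq.
Qed.

(** Induction on the smoothness bound, removing the largest admissible prime [B]. If its exponents
    in [m] and [n] differ, the surplus power of [F B] has mean zero against the smooth cofactors; if
    they agree, it cancels and the cofactors differ. *)
Lemma Exc_pair_eq0 B m n : smooth B m -> smooth B n -> m <> n ->
  Exc P (fun t => F m t * conjc (F n t)) = 0.
Proof.
elim: B m n => [|B IH] m n.
  move=> /smoothP[m0 hm] /smoothP[n0 hn] mn; exfalso; apply: mn.
  have h k : (0 < k)%N -> (forall q, prime q -> (q %| k)%N -> (q < 0)%N) -> k = 1%N.
    move=> k0 hk; apply/eqP; rewrite eqn_leq k0 andbT leqNgt; apply/negP => k1.
    by have := hk _ (pdiv_prime k1) (pdiv_dvd k).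
  by rewrite (h m) // (h n).
have [pB|npB] := boolP (prime B); last first.
  have h k : smooth B.+1 k -> smooth B k.
    move=> /smoothP[k0 hk]; apply/smoothP; split => // q pq qk.
    have := hk _ pq qk; rewrite ltnS leq_eqVlt => /orP[/eqP e|//].
    by move: npB; rewrite -e pq.
  by move=> /h sm /h sn; exact: IH.
have dec k : smooth B.+1 k -> exists2 m, smooth B m & k = (m * B ^ logn B k)%N.
  move=> /smoothP[k0 hk]; have [k1 cop kE] := pfactor_coprime pB k0.
  exists k1 => //; apply/smoothP; split.
    by move: k0; rewrite kE muln_gt0 => /andP[].
  move=> q pq qk; have := hk _ pq; rewrite kE dvdn_mulr // => /(_ isT).
  rewrite ltnS leq_eqVlt => /orP[/eqP e|//]; exfalso.
  by move: cop; rewrite prime_coprime // -e qk.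
move=> /dec[m1 sm1 mE] /dec[n1 sn1 nE]; move: mE nE.
set a := logn B m; set b := logn B n => mE nE.
have B0 := prime_gt0 pB.
have m10 := smooth_gt0 sm1; have n10 := smooth_gt0 sn1.
have hFB c : (0 < B ^ c)%N by rewrite expn_gt0 B0.
have gen m' n' a' b' : smooth B m' -> smooth B n' -> (b' < a')%N ->
    Exc P (fun t => F (m' * B ^ a') t * conjc (F (n' * B ^ b') t)) = 0.
  move=> sm sn ab; have m'0 := smooth_gt0 sm; have n'0 := smooth_gt0 sn.
  rewrite -(@Exc_character B B (a' - b') (fun t => F m' t * conjc (F n' t))) //.
  - apply: eq_Exc => t; rewrite !unit_versionM // !unit_versionX // conjcM.
    rewrite -{1}(subnK (ltnW ab)) exprD.
    have h := unit_version_conj f (B ^ b') t; rewrite unit_versionX // in h.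
    rewrite -[RHS]mulr1 -[X in _ = _ * X]h; ring.
  - by rewrite subn_gt0.
  - by apply: (@cbmeasM R _ (past f B)); [|apply: (@cbmeas_conj R _ (past f B))];
       exact: unit_version_adapted.
move=> mn; have [ab|ba|ab] := ltngtP a b.
- rewrite mE nE -[RHS](conjcK 0) conjc0 -(gen n1 m1 b a) // -Exc_conj.
    by apply: eq_Exc => t; rewrite conjcM conjcK mulrC.
  apply: cbmeasM; first by apply: cbmeas_unit_version; rewrite muln_gt0 n10 hFB.
  by apply: cbmeas_conj; apply: cbmeas_unit_version; rewrite muln_gt0 m10 hFB.
- by rewrite mE nE gen.
- rewrite -(IH m1 n1) //; last by move=> e; apply: mn; rewrite mE nE e ab.
  apply: eq_Exc => t; rewrite mE nE ab !unit_versionM // conjcM mulrACA.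
  by rewrite unit_version_conj mulr1.
Qed.

Lemma Exc_pair m n : (0 < m)%N -> (0 < n)%N ->
  Exc P (fun t => F m t * conjc (F n t)) = (m == n)%:R.
Proof.
move=> m0 n0; case: eqP => [->|mn].
  rewrite -[RHS](Exc_cst P); apply: eq_Exc => t; exact: unit_version_conj.
apply: (@Exc_pair_eq0 (maxn m n).+1) => //; apply/smoothP; split => // q _ qd.
  by rewrite ltnS (leq_trans (dvdn_leq _ qd)) // leq_maxl.
by rewrite ltnS (leq_trans (dvdn_leq _ qd)) // leq_maxr.
Qed.

(** Pairs standing for fractions in lowest terms; the corresponding [F a * conjc (F b)] form an
    orthonormal system. *)
Definition reduced N (x : 'I_N * 'I_N) := [&& (0 < x.1)%N, (0 < x.2)%N & coprime x.1 x.2].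

Lemma reduced_cross (a b a' b' : nat) : (0 < b)%N -> (0 < b')%N ->
  coprime a b -> coprime a' b' ->
  ((a * b')%N == (a' * b)%N) = (a == a') && (b == b').
Proof.
move=> b0 b0' cop cop'; apply/eqP/andP => [h|[/eqP-> /eqP->]//].
have bb : (b %| b')%N by rewrite -(Gauss_dvdr _ (n := a)) ?[coprime b a]coprime_sym // h dvdn_mull.
have bb' : (b' %| b)%N by rewrite -(Gauss_dvdr _ (n := a')) ?[coprime b' a']coprime_sym // -h dvdn_mull.
have e : b = b' by apply/eqP; rewrite eqn_dvd bb.
split; last by rewrite e.
by move/eqP: h; rewrite e eqn_pmul2r.
Qed.

(** The product of two terms involves [F (a * b') * conjc (F (a' * b))], whose mean vanishes unless
    the reduced fractions [a / b] and [a' / b'] coincide. *)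
Lemma parseval_reduced N (C : 'I_N * 'I_N -> R[i]) :
  Ex P (fun t => cabs (\sum_(x | reduced x) C x * (F x.1 t * conjc (F x.2 t))) ^+ 2) =
  \sum_(x | reduced x) cabs (C x) ^+ 2.
Proof.
have hF x : @reduced N x -> cbmeas (fun t => F x.1 t * conjc (F x.2 t)).
  move=> /and3P[x1 x2 _]; apply: cbmeasM; first exact: cbmeas_unit_version.
  by apply: cbmeas_conj; exact: cbmeas_unit_version.
have hC c Z : cbmeas Z -> cbmeas (fun t => c * Z t : R[i]).
  by move=> hZ; apply: cbmeasM => //; exact: cbmeas_cst.
apply: (@complexI R) => /=; rewrite -Exc_real; last first.
  by apply: bmeas_cabs_sqr; apply: cbmeas_sum => x /hF; exact: hC.
rewrite (eq_Exc P (fun t => cabs_sum_sqr (@reduced N)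
  (fun x => C x * (F x.1 t * conjc (F x.2 t))))).
have hxy x y : @reduced N x -> @reduced N y -> cbmeas (fun t =>
  C x * (F x.1 t * conjc (F x.2 t)) * conjc (C y * (F y.1 t * conjc (F y.2 t)))).
  move=> rx ry; apply: cbmeasM; first exact: hC (hF _ rx).
  by apply: cbmeas_conj; exact: hC (hF _ ry).
rewrite Exc_sum; last by move=> x rx; apply: cbmeas_sum => y; exact: hxy.
rewrite rmorph_sum /=; apply: eq_bigr => x rx.
rewrite Exc_sum; last by move=> y; exact: hxy.
rewrite (bigD1 x) //= big1 ?addr0; last first.
  move=> y /andP[ry yx]; move: (rx) (ry) => /and3P[x1 x2 cx] /and3P[y1 y2 cy].
  transitivity (C x * conjc (C y) * Exc P (fun t => F (x.1 * y.2) t * conjc (F (y.1 * x.2) t))).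
    rewrite -ExcZ; last first.
      apply: cbmeasM; first by apply: cbmeas_unit_version; rewrite muln_gt0 x1.
      by apply: cbmeas_conj; apply: cbmeas_unit_version; rewrite muln_gt0 y1.
    apply: eq_Exc => t; rewrite !unit_versionM // !conjcM conjcK; ring.
  rewrite Exc_pair ?muln_gt0 ?x1 ?y1 // reduced_cross //.
  rewrite (_ : _ && _ = false) ?mulr0 //; apply/negbTE; apply: contra yx.
  by move=> /andP[/eqP e1 /eqP e2]; apply/eqP; case: x y e1 e2 {rx ry x1 x2 cx y1 y2 cy} => [? ?] [? ?] /= /val_inj -> /val_inj ->.
rewrite -mul_conjc -[RHS](Exc_cst P); apply: eq_Exc => t.
rewrite conjcM mulrACA; have := unit_version_conj f x.1 t.
have := unit_version_conj f x.2 t; rewrite !conjcM conjcK => h2 h1.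
have -> : F x.1 t * conjc (F x.2 t) * (conjc (F x.1 t) * F x.2 t) =
  (F x.1 t * conjc (F x.1 t)) * (F x.2 t * conjc (F x.2 t)) by ring.
by rewrite h1 h2 !mulr1.
Qed.

Lemma parseval N (Q : pred 'I_N) (C : 'I_N -> R[i]) :
  (forall n, Q n -> 0 < n)%N ->
  Ex P (fun t => cabs (\sum_(n | Q n) C n * F n t) ^+ 2) =
  \sum_(n | Q n) cabs (C n) ^+ 2.
Proof.
move=> Q0.
have hF n : Q n -> cbmeas (fun t => C n * F n t).
  move=> /Q0 n0; apply: cbmeasM; first exact: cbmeas_cst.
  exact: cbmeas_unit_version.
apply: (@complexI R) => /=; rewrite -Exc_real; last first.
  by apply: bmeas_cabs_sqr; apply: cbmeas_sum.
rewrite (eq_Exc P (fun t => cabs_sum_sqr Q (fun n => C n * F n t))).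
have hxy m n : Q m -> Q n -> cbmeas (fun t => C m * F m t * conjc (C n * F n t)).
  by move=> Qm Qn; apply: cbmeasM; [exact: hF|apply: cbmeas_conj; exact: hF].
rewrite Exc_sum; last by move=> m Qm; apply: cbmeas_sum => n; exact: hxy.
rewrite rmorph_sum /=; apply: eq_bigr => m Qm.
rewrite Exc_sum; last by move=> n; exact: hxy.
have E n : Q n -> Exc P (fun t => C m * F m t * conjc (C n * F n t)) =
    C m * conjc (C n) * (m == n)%:R.
  move=> Qn; rewrite -[(m == n)%:R](Exc_pair (Q0 _ Qm) (Q0 _ Qn)) -ExcZ.
    by apply: eq_Exc => t; rewrite conjcM mulrACA.
  apply: cbmeasM; first exact: cbmeas_unit_version (Q0 _ Qm).
  by apply: cbmeas_conj; exact: cbmeas_unit_version (Q0 _ Qn).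
rewrite (bigD1 m) //= E // eqxx mulr1 mul_conjc big1 ?addr0 // => n /andP[Qn nm].
by rewrite E // eq_sym (negbTE nm) mulr0.
Qed.

End orthogonality.

(** * Changes of variables in sums over pairs and over multiples *)

(** Every pair is uniquely a reduced pair times its gcd [g]. *)
Lemma gcd_reindex (V : zmodType) N (G : nat -> nat -> V) :
  \sum_(y : 'I_N.+1 * 'I_N.+1 | (0 < y.1)%N && (0 < y.2)%N) G y.1 y.2 =
  \sum_(x : 'I_N.+1 * 'I_N.+1 | reduced x)
    \sum_(g < N.+1 | [&& (0 < g)%N, (x.1 * g <= N)%N & (x.2 * g <= N)%N])
      G (x.1 * g)%N (x.2 * g)%N.
Proof.
pose red (y : 'I_N.+1 * 'I_N.+1) : 'I_N.+1 * 'I_N.+1 :=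
  (inord (y.1 %/ gcdn y.1 y.2), inord (y.2 %/ gcdn y.1 y.2)).
have redE y : (red y).1 = (y.1 %/ gcdn y.1 y.2)%N :> nat /\
              (red y).2 = (y.2 %/ gcdn y.1 y.2)%N :> nat.
  by split; rewrite inordK // (leq_ltn_trans (leq_div _ _)).
rewrite (partition_big red (@reduced N.+1)) /=; last first.
  move=> y /andP[y1 y2]; have [e1 e2] := redE y; rewrite /reduced e1 e2.
  have g0 : (0 < gcdn y.1 y.2)%N by rewrite gcdn_gt0 y1.
  apply/and3P; split.
  - by rewrite divn_gt0 // dvdn_leq // dvdn_gcdl.
  - by rewrite divn_gt0 // dvdn_leq // dvdn_gcdr.
  rewrite /coprime -(eqn_pmul2r g0) muln_gcdl !divnK ?dvdn_gcdl ?dvdn_gcdr //.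
  by rewrite mul1n.
apply: eq_bigr => x /and3P[x1 x2 cx].
pose h (g : 'I_N.+1) : 'I_N.+1 * 'I_N.+1 := (inord (x.1 * g), inord (x.2 * g)).
pose h' (y : 'I_N.+1 * 'I_N.+1) : 'I_N.+1 := inord (gcdn y.1 y.2).
rewrite (reindex_onto h h'); last first.
  move=> y /andP[/andP[y1 y2] /eqP ry]; have [e1 e2] := redE y.
  have gE : h' y = gcdn y.1 y.2 :> nat.
    rewrite inordK // ltnS (leq_trans (dvdn_leq _ (dvdn_gcdl _ _))) //.
    by rewrite -ltnS.
  rewrite /h gE -ry e1 e2 !divnK ?dvdn_gcdl ?dvdn_gcdr // !inord_val.
  by case: y {y1 y2 ry e1 e2 gE}.
have hE (g : 'I_N.+1) : (x.1 * g <= N)%N -> (x.2 * g <= N)%N ->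
   (h g).1 = (x.1 * g)%N :> nat /\ (h g).2 = (x.2 * g)%N :> nat.
  by move=> h1 h2; split; rewrite inordK.
(* Beyond [N], [inord] takes the value [0]; the positivity conditions on the pair thus encode
   [x.1 * g <= N] and [x.2 * g <= N]. *)
have out k : (N < k)%N -> (inord k : 'I_N.+1) = 0%N :> nat.
  by move=> hk; rewrite /inord val_insubd ltnS leqNgt hk.
apply: eq_big => [g|g].
  have [g1|g1] := leqP (x.1 * g) N; last by rewrite /h /= out // andbF.
  have [g2|g2] := leqP (x.2 * g) N; last first.
    by rewrite /h /= (out (x.2 * g)%N) //= !(andbF, andFb).
  have [e1 e2] := hE g g1 g2.
  rewrite e1 e2 !muln_gt0 x1 x2 /= andbT andbb.
  have [//|g0] := posnP g.
  have gg : gcdn (h g).1 (h g).2 = g.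
    by rewrite e1 e2 -muln_gcdl (eqP cx) mul1n.
  have [r1 r2] := redE (h g).
  have -> : red (h g) == x.
    apply/eqP; rewrite [LHS]surjective_pairing [RHS]surjective_pairing.
    by congr pair; apply: val_inj; rewrite /= ?r1 ?r2 gg ?e1 ?e2 mulnK.
  by apply/eqP; apply: val_inj; rewrite /= inordK ?gg.
rewrite /h; move=> /andP[/andP[/andP[h1 h2] _] _].
have g1 : (x.1 * g <= N)%N by rewrite leqNgt; apply/negP => hh; move: h1; rewrite /= out.
have g2 : (x.2 * g <= N)%N by rewrite leqNgt; apply/negP => hh; move: h2; rewrite /= out.
by rewrite !inordK.
Qed.

(** At most [2 m] pairs have maximum [m], which leaves twice a harmonic sum. *)
Lemma sum_inv_max_sqr (R : realType) N J : (N < 2 ^ J)%N ->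
  \sum_(a < N.+1 | (0 < a)%N) \sum_(b < N.+1 | (0 < b)%N)
    ((maxn a b)%:R ^+ 2 : R)^-1 <= 2 * J%:R.
Proof.
move=> NJ.
have H : \sum_(a < N.+1 | (0 < a)%N) \sum_(b < N.+1 | (0 < b <= a)%N)
    (a%:R ^+ 2 : R)^-1 <= J%:R.
  apply: le_trans (harmonic_dyadic R NJ); apply: ler_sum => a a0.
  have aR : (0 : R) < a%:R by rewrite ltr0n.
  apply: le_trans (_ : a%:R * (a%:R ^+ 2)^-1 <= _).
    by apply: sumr_pred_le => //; exact: card_ord_range.
  by rewrite expr2 invfM mulrA divff ?mul1r // gt_eqF.
rewrite mulr2n mulrDl mul1r; apply: le_trans (lerD H H).
rewrite [X in _ <= _ + X](exchange_big_dep (fun b : 'I_N.+1 => (0 < b)%N)) /=; last first.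
  by move=> i j _ /andP[].
rewrite -big_split; apply: ler_sum => a a0 /=.
rewrite [X in _ <= X + _]big_mkcondr [X in _ <= _ + X](eq_bigl (fun b : 'I_N.+1 => (0 < b)%N && (a <= b)%N)); last first.
  by move=> b; rewrite a0.
rewrite [X in _ <= _ + X]big_mkcondr -big_split; apply: ler_sum => b b0 /=.
have nn (k : nat) : 0 <= (k%:R ^+ 2 : R)^-1 by rewrite invr_ge0 sqr_ge0.
case: (leqP b a) => [ba|ab].
  by rewrite lerDl; case: ifP.
by rewrite (ltnW ab) add0r.
Qed.

Lemma prime_multiple_reindex (V : zmodType) N p (G : nat -> V) : prime p ->
  \sum_(g < N.+1 | smooth p g && (p * g <= N)%N) G (p * g)%N =
  \sum_(n < N.+1 | [&& (0 < n)%N, (p %| n)%N & smooth p (n %/ p)]) G n.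
Proof.
move=> pp; have p0 := prime_gt0 pp.
pose h (g : 'I_N.+1) : 'I_N.+1 := inord (p * g).
pose h' (n : 'I_N.+1) : 'I_N.+1 := inord (n %/ p).
have h'E n : h' n = (n %/ p)%N :> nat.
  by rewrite inordK // (leq_ltn_trans (leq_div _ _)).
rewrite [RHS](reindex_onto h h'); last first.
  move=> n /and3P[n0 pn _]; apply: val_inj; rewrite /= /h h'E mulnC divnK //.
  by rewrite inord_val.
have out k : (N < k)%N -> (inord k : 'I_N.+1) = 0%N :> nat.
  by move=> hk; rewrite /inord val_insubd ltnS leqNgt hk.
apply: eq_big => [g|g /andP[_ gN]]; last by rewrite inordK.
have [gN|gN] := leqP (p * g) N; last first.
  by rewrite andbF; apply/esym/negbTE; rewrite /h out.
have hE : h g = (p * g)%N :> nat by rewrite inordK.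
rewrite andbT hE dvdn_mulr // mulKn // muln_gt0 p0 /=.
have -> : h' (h g) == g by apply/eqP/val_inj; rewrite /= h'E hE mulKn.
rewrite andbT; case sg: (smooth p g); last by rewrite andbF.
by rewrite (smooth_gt0 sg).
Qed.

(** * Moments of the martingale differences and of the remainder *)

Section moments.
Context (R : realType) (d : measure_display) (T : measurableType d).
Variables (P : probability T R) (f : nat -> T -> R[i]).
Hypothesis f_steinhaus : steinhaus P f.
Context (e : nat -> R[i]).
Hypothesis eD : forall m n, e (m + n)%N = e m * e n.
Hypothesis e_abs : forall n, cabs (e n) = 1.
Context (N l J : nat).
Hypothesis N_gt0 : (0 < N)%N.
Hypothesis NJ : (N < 2 ^ J)%N.
Local Notation F := (unit_version f).
Local Notation c := (real_complex R).
Local Notation kap := (multiplicity N l).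

Definition scaling : R := (Num.sqrt N%:R)^-1.

Definition large_prime (p : nat) := prime p && (2 ^ l < p)%N.

Definition coefficient (p : nat) (t : T) : R[i] :=
  c scaling * \sum_(m < N.+1 | smooth p m && (p * m <= N)%N) e (p * m) * F m t.
Local Notation A := coefficient.

Definition remainder (t : T) : R[i] :=
  c scaling * \sum_(n < N.+1 | (0 < n)%N) c (1 - (kap n)%:R) * e n * F n t.

Definition total_variance (t : T) : R :=
  \sum_(p < N.+1 | large_prime p) cabs (A p t) ^+ 2.

(** The coefficient of [F a * conjc (F b)] in [N * |A_p|^2], collecting the pairs
    [(m1, m2) = (a * g, b * g)]. The range conditions overlap because they are kept as [gcd_reindex]
    produces them. *)
Definition cross (p a b : nat) : R[i] :=
  \sum_(g < N.+1 | [&& (0 < g)%N, (a * g <= N)%N & (b * g <= N)%N] &&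
     ((smooth p (a * g) && (p * (a * g) <= N)%N) &&
      (smooth p (b * g) && (p * (b * g) <= N)%N)))
    e (p * (a * g)) * conjc (e (p * (b * g))).

Let NR : (0 : R) < N%:R. Proof. by rewrite ltr0n. Qed.

Lemma scaling_sqr : scaling ^+ 2 = N%:R^-1.
Proof. by rewrite /scaling exprVn sqr_sqrtr // ltW. Qed.

Lemma scaling_ge0 : 0 <= scaling.
Proof. by rewrite invr_ge0 sqrtr_ge0. Qed.

Lemma coefficient_adapted p : cadapted f p (A p).
Proof.
apply: (@cbmeasM R _ (past f p)); first exact: (@cbmeas_cst R _ (past f p)).
apply: (@cbmeas_sum R _ (past f p)) => m /andP[sm _].
apply: (@cbmeasM R _ (past f p)); first exact: (@cbmeas_cst R _ (past f p)).
exact: unit_version_adapted.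
Qed.

Lemma coefficient_cbmeas p : cbmeas (A p).
Proof. exact: (cadapted_cbmeas f_steinhaus (coefficient_adapted p)). Qed.

(** Group the pairs [(m1, m2)] by the reduced form of [m1 / m2]; the common factor drops out since
    [F g] is unimodular. *)
Lemma coefficient_sqr p t :
  A p t * conjc (A p t) = c N%:R^-1 *
    \sum_(x : 'I_N.+1 * 'I_N.+1 | reduced x)
      cross p x.1 x.2 * (F x.1 t * conjc (F x.2 t)).
Proof.
rewrite /A conjcM mulrACA.
have -> : c scaling * conjc (c scaling) = c N%:R^-1.
  by rewrite mul_conjc cabs_real ger0_norm ?scaling_ge0 // scaling_sqr.
congr (_ * _).
pose Q (m : nat) := smooth p m && (p * m <= N)%N.
pose G (m1 m2 : nat) : R[i] := if Q m1 && Q m2 then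
  e (p * m1) * conjc (e (p * m2)) * (F m1 t * conjc (F m2 t)) else 0.
transitivity (\sum_(y : 'I_N.+1 * 'I_N.+1 | (0 < y.1)%N && (0 < y.2)%N) G y.1 y.2).
  rewrite conjc_sum mulr_suml.
  under eq_bigr do rewrite mulr_sumr.
  rewrite pair_big /= big_mkcond [RHS]big_mkcond /=.
  apply: eq_bigr => -[m1 m2] _ /=; rewrite /G -!/(Q _).
  have Q0 (m : 'I_N.+1) : Q m -> (0 < m)%N by move=> /andP[/smooth_gt0].
  case Q1: (Q m1) => /=; last by case: ifP.
  case Q2: (Q m2) => /=; last by case: ifP.
  rewrite !Q0 //= conjcM; ring.
rewrite gcd_reindex; apply: eq_bigr => x /and3P[x1 x2 _].
rewrite /cross mulr_suml [RHS]big_mkcondr /=; apply: eq_bigr => g /and3P[g0 _ _].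
rewrite /G /Q; case: ifP => // _; congr (_ * _).
rewrite !unit_versionM // conjcM mulrACA.
by rewrite unit_version_conj mulr1.
Qed.

Lemma cross_le p a b : (0 < p)%N -> (0 < a)%N -> (0 < b)%N ->
  cabs (cross p a b) <= N%:R / (p%:R * (maxn a b)%:R).
Proof.
move=> p0 a0 b0.
have M0 : (0 < p * maxn a b)%N by rewrite muln_gt0 p0 leq_max a0.
apply: le_trans (_ : (N %/ (p * maxn a b))%:R <= _); last first.
  rewrite -natrM ler_pdivlMr ?ltr0n // -natrM ler_nat; exact: leq_trunc_div.
apply: le_trans (cabs_sum _ _ _) _.
rewrite -[X in _ <= X]mulr1; apply: sumr_pred_le => //.
  by move=> g _; rewrite cabsM cabs_conj !e_abs mulr1.
apply: leq_trans (card_ord_range N.+1 _); apply: subset_leq_card.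
apply/fintype.subsetP => g; rewrite unfold_in inE.
move=> /andP[/and3P[-> _ _] /andP[/andP[_ h1] /andP[_ h2]]] /=.
rewrite leq_divRL // mulnCA; case: (leqP a b) => ab.
  by rewrite [(g * b)%N]mulnC.
by rewrite [(g * a)%N]mulnC.
Qed.

(** By [parseval_reduced] this is a sum of squared coefficients, for which the trivial bound
    [1 / (p * max(a, b))] is enough. *)
Lemma coefficient_fourth p : prime p ->
  Ex P (fun t => cabs (A p t) ^+ 4) <= 2 * J%:R / p%:R ^+ 2.
Proof.
move=> pp; have p0 := prime_gt0 pp; have pR : (0 : R) < p%:R by rewrite ltr0n.
rewrite (@eq_Ex _ _ _ _ _ (fun t => cabs (\sum_(x : 'I_N.+1 * 'I_N.+1 | reduced x)
   (c N%:R^-1 * cross p x.1 x.2) * (F x.1 t * conjc (F x.2 t))) ^+ 2)); last first.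
  move=> t; have -> : cabs (A p t) ^+ 4 = cabs (A p t * conjc (A p t)) ^+ 2.
    by rewrite cabsM cabs_conj -expr2 -exprM.
  rewrite coefficient_sqr mulr_sumr; congr (cabs _ ^+ 2).
  by apply: eq_bigr => x _; rewrite mulrA.
rewrite parseval_reduced //.
apply: le_trans (_ : \sum_(x : 'I_N.+1 * 'I_N.+1 | (0 < x.1)%N && (0 < x.2)%N)
   (p%:R ^+ 2)^-1 * ((maxn x.1 x.2)%:R ^+ 2)^-1 <= _).
  rewrite big_mkcond [X in _ <= X]big_mkcond; apply: ler_sum => x _.
  case: ifPn => [/and3P[x1 x2 _]|_]; last first.
    by case: ifP => // _; rewrite mulr_ge0 ?invr_ge0 ?sqr_ge0.
  rewrite x1 x2 /= cabsM cabs_real ger0_norm ?invr_ge0 ?(ltW NR) //.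
  have MR : (0 : R) < (maxn x.1 x.2)%:R by rewrite ltr0n leq_max x1.
  have -> : (p%:R ^+ 2)^-1 * ((maxn x.1 x.2)%:R ^+ 2)^-1 =
    (N%:R^-1 * (N%:R / (p%:R * (maxn x.1 x.2)%:R))) ^+ 2 :> R.
    by field; rewrite !gt_eqF.
  rewrite ler_pXn2r ?nnegrE ?mulr_ge0 ?invr_ge0 ?cabs_ge0 ?(ltW NR) ?(ltW pR) ?(ltW MR) //.
  by rewrite ler_pM2l ?invr_gt0 // cross_le.
rewrite -mulr_sumr mulrC ler_wpM2r ?invr_ge0 ?sqr_ge0 //.
apply: le_trans (sum_inv_max_sqr R NJ); rewrite le_eqVlt; apply/orP; left; apply/eqP.
by rewrite pair_big.
Qed.

Lemma sum_coefficient_fourth :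
  \sum_(p < N.+1 | large_prime p) Ex P (fun t => cabs (A p t) ^+ 4) <=
  4 * J%:R / (2 ^ l)%:R.
Proof.
apply: le_trans (_ : \sum_(p < N.+1 | (2 ^ l < p)%N) 2 * J%:R * (p%:R ^+ 2)^-1 <= _).
  rewrite big_mkcond [X in _ <= X]big_mkcond; apply: ler_sum => p _.
  rewrite /large_prime; case: ifPn => [/andP[pp ->]|_].
    exact: coefficient_fourth.
  by case: ifP => // _; rewrite mulr_ge0 ?invr_ge0 ?sqr_ge0 // mulr_ge0.
rewrite -mulr_sumr.
have -> : 4 * J%:R / (2 ^ l)%:R = 2 * J%:R * (2 / (2 ^ l)%:R) :> R by ring.
rewrite ler_wpM2l ?mulr_ge0 //.
apply: le_trans (sum_inv_sqr _ _ _) _ => //.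
by rewrite ler_pM2l // lef_pV2 ?posrE ?ltr0n ?expn_gt0 // ler_nat.
Qed.

Lemma sum_factorizations (V : zmodType) (G : nat -> V) :
  \sum_(p < N.+1 | large_prime p)
    \sum_(g < N.+1 | smooth p g && (p * g <= N)%N) G (p * g)%N =
  \sum_(n < N.+1 | (0 < n)%N) G n *+ kap n.
Proof.
rewrite (eq_bigr (fun p : 'I_N.+1 =>
   \sum_(n < N.+1 | [&& (0 < n)%N, (p %| n)%N & smooth p (n %/ p)]) G n)); last first.
  by move=> p /andP[pp _]; exact: prime_multiple_reindex.
rewrite (exchange_big_dep (fun n : 'I_N.+1 => (0 < n)%N)) /=; last first.
  by move=> p n _ /andP[].
apply: eq_bigr => n n0.
rewrite -sumr_const; apply: eq_bigl => p.
by rewrite n0 inE /factors_at /large_prime -andbA.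
Qed.

Lemma decomposition t :
  c scaling * \sum_(n < N.+1 | (0 < n)%N) e n * F n t =
  \sum_(p < N.+1 | large_prime p) F p t * A p t + remainder t.
Proof.
have -> : \sum_(p < N.+1 | large_prime p) F p t * A p t =
    c scaling * \sum_(n < N.+1 | (0 < n)%N) (e n * F n t) *+ kap n.
  rewrite -(sum_factorizations (fun n => e n * F n t)) mulr_sumr.
  apply: eq_bigr => p /andP[pp _]; rewrite /A mulrCA mulr_sumr; congr (_ * _).
  apply: eq_bigr => m /andP[/smooth_gt0 m0 _].
  by rewrite (@unit_versionM _ _ _ f p m t (prime_gt0 pp) m0) mulrCA.
rewrite /remainder -mulrDr -big_split; congr (_ * _); apply: eq_bigr => n _ /=.
rewrite -mulr_natl rmorphB rmorph1 /= rmorph_nat; ring.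
Qed.

(** Orthogonality, and [(1 - kap n)^2 = 1 - kap n] because [kap n] is [0] or [1]. *)
Lemma remainder_second :
  Ex P (fun t => cabs (remainder t) ^+ 2) =
  N%:R^-1 * \sum_(n < N.+1 | (0 < n)%N) (1 - (kap n)%:R).
Proof.
rewrite (@eq_Ex _ _ _ _ _ (fun t => N%:R^-1 * cabs (\sum_(n < N.+1 | (0 < n)%N)
    c (1 - (kap n)%:R) * e n * F n t) ^+ 2)); last first.
  move=> t; rewrite /remainder cabsM exprMn cabs_real.
  by rewrite ger0_norm ?scaling_ge0 // scaling_sqr.
rewrite ExZ; last first.
  apply: bmeas_cabs_sqr; apply: cbmeas_sum => n n0.
  apply: cbmeasM; first exact: cbmeas_cst.
  exact: (cbmeas_unit_version f_steinhaus).
congr (_ * _); rewrite (parseval f_steinhaus) //; apply: eq_bigr => n n0.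
rewrite cabsM e_abs mulr1 cabs_real real_normK ?num_real //.
have := multiplicity_le1 N l n; case: (kap n) => [|[|]] // _.
  by rewrite subr0 expr1n.
by rewrite subrr expr0n.
Qed.

(** At [a = b = 1] all phases cancel and the terms are merely counted; this is [N] times the mean of
    [total_variance]. *)
Lemma cross11_sum :
  \sum_(p < N.+1 | large_prime p) cross p 1 1 =
  c (\sum_(n < N.+1 | (0 < n)%N) (kap n)%:R).
Proof.
rewrite rmorph_sum /=.
rewrite [RHS](eq_bigr (fun n : 'I_N.+1 => (1 : R[i]) *+ kap n)); last first.
  by move=> n _; rewrite rmorph_nat.
rewrite -(sum_factorizations (fun=> 1)); apply: eq_bigr => p pp.
rewrite /cross; apply: eq_big => [g|g _]; last by rewrite (phase_conj e_abs).
rewrite mul1n andbb; have -> : (g <= N)%N by rewrite -ltnS ltn_ord.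
rewrite andbT; case sg: (smooth p g) => /=; last by rewrite andbF.
by rewrite (smooth_gt0 sg) /= andbb.
Qed.

(** If [a] and [b] are both [p]-smooth, the two sums agree up to conjugation; otherwise [cross] is
    empty. *)
Lemma cross_le_inner p a b : prime p -> (0 < a)%N -> (0 < b)%N ->
  cabs (cross p a b) <= cabs (inner_sum e N (maxn a b) (distn a b) p).
Proof.
move=> pp; have p0 := prime_gt0 pp; move=> a0 b0.
wlog ba : a b a0 b0 / (b <= a)%N => [H|].
  case/orP: (leq_total b a) => ab; first exact: H.
  have := H _ _ b0 a0 ab; rewrite maxnC.
  have -> : distn b a = distn a b by rewrite /distn addnC.
  apply: le_trans.
  rewrite -cabs_conj /cross conjc_sum le_eqVlt; apply/orP; left; apply/eqP.
  congr cabs; apply: eq_big => [g|g _]; last by rewrite conjcM conjcK mulrC.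
  by congr (_ && _); [rewrite [X in _ && X]andbC|rewrite andbC].
have -> : maxn a b = a by apply/maxn_idPl.
have -> : distn a b = (a - b)%N by rewrite /distn; lia.
have [/andP[sa sb]|ns] := boolP (smooth p a && smooth p b); last first.
  rewrite /cross big_pred0 ?cabs0 ?cabs_ge0 // => g.
  apply/negbTE; apply: contra ns => /andP[_].
  by rewrite !smoothM => /andP[/andP[/andP[-> _] _] /andP[/andP[-> _] _]].
rewrite le_eqVlt; apply/orP; left; apply/eqP; congr cabs.
rewrite /cross /inner_sum; apply: eq_big => [g|g].
  rewrite !smoothM sa sb /= -[(p * g * a)%N]mulnA [(g * a)%N]mulnC.
  case sg: (smooth p g) => /=; last by rewrite !andbF.
  rewrite (smooth_gt0 sg) /=.
  have [h|] := leqP (p * (a * g)) N => /=; last by rewrite !andbF.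
  have h1 : (b * g <= a * g)%N by rewrite leq_mul2r ba orbT.
  have h2 : (a * g <= p * (a * g))%N by rewrite leq_pmull.
  have h3 : (p * (b * g) <= p * (a * g))%N by rewrite leq_mul2l h1 orbT.
  by rewrite (leq_trans h2 h) (leq_trans h1 (leq_trans h2 h)) (leq_trans h3 h).
move=> _; rewrite phase_sub //; last by rewrite leq_mul2l leq_mul2r ba !orbT.
by congr e; rewrite -mulnBr -mulnBl mulnC.
Qed.

(** On either side of the diagonal the pair is determined by its maximum and its difference, so
    [(M, h)] is hit at most twice. *)
Lemma sum_reduced_le (S : nat -> nat -> R) : (forall M h, 0 <= S M h) ->
  \sum_(x : 'I_N.+1 * 'I_N.+1 | reduced x && (x.1 != x.2))
     S (maxn x.1 x.2) (distn x.1 x.2) <=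
  2 * \sum_(M < N.+1 | (0 < M)%N) \sum_(h < N.+1 | (0 < h <= M)%N) S M h.
Proof.
move=> S0; rewrite (bigID (fun x : 'I_N.+1 * 'I_N.+1 => (x.2 < x.1)%N)) /=.
rewrite mulr2n mulrDl mul1r.
rewrite pair_big_dep /=; apply: lerD.
  have hh (x : 'I_N.+1 * 'I_N.+1) : (x.1 - x.2 < N.+1)%N.
    by rewrite (leq_ltn_trans (leq_subr _ _)).
  rewrite (eq_bigr (fun x : 'I_N.+1 * 'I_N.+1 =>
     (fun z : 'I_N.+1 * 'I_N.+1 => S z.1 z.2) (x.1, Ordinal (hh x)))); last first.
    move=> x /andP[_ lt] /=; congr S; first by apply/maxn_idPl; exact: ltnW.
    by rewrite /distn; lia.
  apply: sum_inj_le => //.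
    move=> [a b] [a' b'] /andP[_ /= l1] /andP[_ /= l2] [/= e1 e2]; congr pair.
      exact: e1.
    by apply: val_inj => /=; rewrite e1 in e2 l1; lia.
  by move=> x /andP[/andP[/and3P[x1 x2 _] _] lt] /=; rewrite x1 /=; lia.
have hh (x : 'I_N.+1 * 'I_N.+1) : (x.2 - x.1 < N.+1)%N.
  by rewrite (leq_ltn_trans (leq_subr _ _)).
rewrite (eq_bigr (fun x : 'I_N.+1 * 'I_N.+1 =>
   (fun z : 'I_N.+1 * 'I_N.+1 => S z.1 z.2) (x.2, Ordinal (hh x)))); last first.
  move=> x /andP[_]; rewrite -leqNgt => lt /=; congr S; first by apply/maxn_idPr.
  by rewrite /distn; lia.
apply: sum_inj_le => //.
  move=> [a b] [a' b'] /andP[_]; rewrite -leqNgt => /= l1 /andP[_].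
  rewrite -leqNgt => /= l2 [/= e1 e2]; congr pair; last exact: e1.
  by apply: val_inj => /=; rewrite e1 in e2 l1; lia.
move=> x /andP[/andP[/and3P[x1 x2 _] ne]]; rewrite -leqNgt => lt /=; rewrite x2 /=.
rewrite -val_eqE /= in ne.
by rewrite subn_gt0 ltn_neqAle ne lt leq_subr.
Qed.

(** Parseval for [total_variance - 1] in the system of reduced fractions: the coefficient at [1 / 1]
    is minus the proportion of exceptional integers, the others are off-diagonal and bounded by
    [prime_sum]. *)
Lemma variance_second :
  Ex P (fun t => (total_variance t - 1) ^+ 2) <=
  (N%:R^-1 * \sum_(n < N.+1 | (0 < n)%N) (1 - (kap n)%:R)) ^+ 2 +
  2 * (N%:R ^+ 2)^-1 * \sum_(M < N.+1 | (0 < M)%N) \sum_(h < N.+1 | (0 < h <= M)%N)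
        prime_sum e N l M h ^+ 2.
Proof.
have N1 : (1 < N.+1)%N by [].
(* The constant [1] is the character of the fraction [1 / 1]; a reduced pair with equal entries is
   this one. *)
pose x0 : 'I_N.+1 * 'I_N.+1 := (Ordinal N1, Ordinal N1).
have r0 : reduced x0 by [].
pose C (x : 'I_N.+1 * 'I_N.+1) : R[i] :=
  c N%:R^-1 * (\sum_(p < N.+1 | large_prime p) cross p x.1 x.2) - (x == x0)%:R.
rewrite (@eq_Ex _ _ _ _ _ (fun t => cabs (\sum_(x | reduced x)
   C x * (F x.1 t * conjc (F x.2 t))) ^+ 2)); last first.
  move=> t; rewrite -real_normK ?num_real // -cabs_real; congr (cabs _ ^+ 2).
  rewrite rmorphB rmorph1 /= /total_variance rmorph_sum /=.
  rewrite (eq_bigr (fun p : 'I_N.+1 => c N%:R^-1 *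
    \sum_(x : 'I_N.+1 * 'I_N.+1 | reduced x)
      cross p x.1 x.2 * (F x.1 t * conjc (F x.2 t)))); last first.
    by move=> p _; rewrite -mul_conjc coefficient_sqr.
  rewrite -mulr_sumr exchange_big /= mulr_sumr.
  rewrite /C; under [RHS]eq_bigr do rewrite mulrBl.
  rewrite sumrB; congr (_ - _).
    by apply: eq_bigr => x _; rewrite -mulr_suml mulrA.
  rewrite (bigD1 x0) //= big1 ?addr0 ?mul1r.
    by rewrite !unit_version1 mul1r conjc1.
  by move=> x /andP[_ /negbTE ->]; rewrite mul0r.
rewrite (parseval_reduced f_steinhaus) (bigD1 x0) //=; apply: lerD.
  rewrite /C eqxx /= cross11_sum -rmorphM -(rmorph1 c) -rmorphB cabs_real.
  rewrite real_normK ?num_real //.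
  have -> : \sum_(n < N.+1 | (0 < n)%N) (1 - (kap n)%:R) =
      N%:R - \sum_(n < N.+1 | (0 < n)%N) (kap n)%:R :> R.
    rewrite sumrB; congr (_ - _).
    by rewrite big_mkcond big_ord_recl /= add0r sumr_const card_ord.
  by rewrite mulrBr mulVf ?gt_eqF // -sqrrN opprB.
apply: le_trans (_ : (N%:R ^+ 2)^-1 * \sum_(x : 'I_N.+1 * 'I_N.+1 | reduced x && (x.1 != x.2))
  prime_sum e N l (maxn x.1 x.2) (distn x.1 x.2) ^+ 2 <= _); last first.
  set X := \sum_(M < _ | _) _.
  have -> : 2 * (N%:R ^+ 2)^-1 * X = (N%:R ^+ 2)^-1 * (2 * X) by ring.
  rewrite ler_wpM2l ?invr_ge0 ?sqr_ge0 //.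
  apply: (sum_reduced_le (S := fun M h => prime_sum e N l M h ^+ 2)).
  by move=> M h; exact: sqr_ge0.
rewrite mulr_sumr big_mkcond [X in _ <= X]big_mkcond; apply: ler_sum => x _.
case: ifPn => [/andP[rx xx0]|_]; last first.
  by case: ifP => // _; rewrite mulr_ge0 ?invr_ge0 ?sqr_ge0.
have /and3P[x1 x2 cx] := rx.
have ne : x.1 != x.2.
  apply: contra xx0 => /eqP e12; move: cx; rewrite e12 /coprime gcdnn => /eqP h1.
  by apply/eqP; case: x {rx x1 x2} e12 h1 => [a b] /= -> h1; congr pair; apply: val_inj.
rewrite rx ne /= -exprVn -exprMn ler_pXn2r ?nnegrE //.
- rewrite /C (negbTE xx0) subr0 cabsM cabs_real ger0_norm ?invr_ge0 ?(ltW NR) //.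
  rewrite ler_pM2l ?invr_gt0 //; apply: le_trans (cabs_sum _ _ _) _.
  by apply: ler_sum => p /andP[pp _]; exact: cross_le_inner.
- exact: cabs_ge0.
- by rewrite mulr_ge0 ?invr_ge0 ?(ltW NR) // sumr_ge0 // => p _; exact: cabs_ge0.
Qed.

End moments.

(** * The compensating weight *)

Section compensator.
Context (R : realType).
Variable s2 : R.
Hypothesis s2_ge0 : 0 <= s2.

(* Weighting [cos (partial n + c0)] by [compensator (clock n)] cancels its drift;
   truncating at clock value [s2] keeps the weight at most 1, and the error made
   beyond [s2] is controlled by [excess]. *)
Definition compensator (x : R) : R := expR (- (Num.max 0 (s2 - x) / 2)).
Definition excess (x : R) : R := Num.max 0 (x - s2).

Lemma compensator_ge0 x : 0 <= compensator x. Proof. exact: expR_ge0. Qed.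

Lemma compensator_le1 x : compensator x <= 1.
Proof. by rewrite -expR0 ler_expR oppr_le0 divr_ge0 // le_max lexx. Qed.

Lemma compensator_norm x : `|compensator x| <= 1.
Proof. by rewrite ger0_norm ?compensator_ge0 ?compensator_le1. Qed.

Lemma max0E (x : R) : Num.max 0 x = (x + `|x|) / 2.
Proof.
by case: (leP 0 x) => x0; [rewrite ger0_norm //; lra|rewrite ltr0_norm //; lra].
Qed.

Lemma continuous_compensator : continuous compensator.
Proof.
move=> x; rewrite /compensator; apply: continuous_comp; last exact: continuous_expR.
rewrite /prop_for /continuous_at; under eq_fun do rewrite max0E; rewrite max0E.
have h : (fun y : R => s2 - y) @ x --> s2 - x.
  by apply: cvgB; [exact: cvg_cst|exact: cvg_id].
apply: cvgN; apply: cvgMl; apply: cvgMl; apply: cvgD => //.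
exact: cvg_norm.
Qed.

Lemma continuous_excess : continuous excess.
Proof.
have -> : excess = fun x : R => (x - s2 + `|x - s2|) / 2.
  by apply/funext => x; rewrite /excess max0E.
move=> x; have h : (fun y : R => y - s2) @ x --> x - s2.
  by apply: cvgB; [exact: cvg_id|exact: cvg_cst].
by apply: cvgMl; apply: cvgD => //; exact: cvg_norm.
Qed.

(* [v + (s2 - x - v)^+ - (s2 - x)^+ = (x + v - s2)^+ - (x - s2)^+] *)
Lemma compensator_step x v : 0 <= v ->
  `|expR (- (v / 2)) * compensator (x + v) - compensator x| <=
  (excess (x + v) - excess x) / 2.
Proof.
move=> v0; rewrite /compensator -expRD -opprD -mulrDl.
have h y : 0 <= Num.max 0 y :> R by rewrite le_max lexx.
apply: le_trans (expR_lipschitz _ _) _; rewrite ?divr_ge0 ?addr_ge0 //.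
rewrite -mulrBl normrM [ `|2^-1|]ger0_norm ?invr_ge0 // ler_pM2r ?invr_gt0 //.
have E y : Num.max 0 y = y + Num.max 0 (- y) :> R.
  by case: (leP 0 y) => y0; case: (leP 0 (- y)) => y1; lra.
rewrite /excess (E (x + v - s2)) (E (x - s2)) !opprB.
have -> : v + Num.max 0 (s2 - (x + v)) - Num.max 0 (s2 - x) =
  x + v - s2 + Num.max 0 (s2 - (x + v)) - (x - s2 + Num.max 0 (s2 - x)) by ring.
rewrite ger0_norm //; case: (leP 0 (s2 - (x + v))); case: (leP 0 (s2 - x)); lra.
Qed.

(** Below [s2] there is no excess and [1 - exp(- y) <= y] applies; above [s2] the weight is [1] and
    the excess alone remains. *)
Lemma compensator_excess x : (1 - compensator x) + excess x / 2 <= `|x - s2| / 2.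
Proof.
have h y : 0 <= Num.max 0 y :> R by rewrite le_max lexx.
have := expR_ge1Dx (- (Num.max 0 (s2 - x) / 2)); rewrite -/(compensator x).
rewrite /excess; case: (leP 0 (s2 - x)); case: (leP 0 (x - s2)) => h1 h2 h3.
- rewrite ger0_norm //; lra.
- rewrite ltr0_norm //; lra.
- rewrite ger0_norm //; lra.
- lra.
Qed.

End compensator.

(** * A quantitative martingale central limit theorem *)

Section martingale.
Context (R : realType) (d : measure_display) (T : measurableType d).
Variables (P : probability T R) (f : nat -> T -> R[i]).
Hypothesis f_steinhaus : steinhaus P f.
Context (Lp : pred nat) (A : nat -> T -> R[i]).
Hypothesis Lp_prime : forall p, Lp p -> prime p.
Hypothesis A_adapted : forall p, Lp p -> cadapted f p (A p).
Context (w : R[i]) (c0 : R).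
Local Notation F := (unit_version f).

Definition increment (p : nat) (t : T) : R := complex.Re (w * A p t * F p t).
(** The conditional variance of [increment p] given the primes below [p] ([Ex_increment_sqr]). *)
Definition quadratic (p : nat) (t : T) : R := cabs (w * A p t) ^+ 2 / 2.
Definition partial (n : nat) (t : T) : R := \sum_(p < n | Lp p) increment p t.
Definition clock (n : nat) (t : T) : R := \sum_(p < n | Lp p) quadratic p t.
Local Notation u := increment.
Local Notation V := quadratic.
Local Notation U := partial.
Local Notation Tm := clock.
Let s2 : R := cabs w ^+ 2 / 2.
Local Notation Phi := (compensator s2).
Local Notation Psi := (excess s2).

Let s2_ge0 : 0 <= s2. Proof. by rewrite divr_ge0 // sqr_ge0. Qed.

Lemma quadratic_ge0 p t : 0 <= V p t. Proof. by rewrite divr_ge0 // sqr_ge0. Qed.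

Lemma wA_adapted p : Lp p -> cadapted f p (fun t => w * A p t).
Proof.
move=> Lpp; apply: (@cbmeasM R _ (past f p)); last exact: A_adapted.
exact: (@cbmeas_cst R _ (past f p)).
Qed.

Lemma quadratic_adapted p : Lp p -> adapted f p (V p).
Proof.
move=> Lpp; rewrite /adapted /V; under eq_fun do rewrite mulrC.
by apply: (@bmeasZ R _ (past f p)); apply: (@bmeas_cabs_sqr R _ (past f p)); exact: wA_adapted.
Qed.

Lemma increment_adapted p : Lp p -> adapted f p.+1 (u p).
Proof.
move=> Lpp; have := @cbmeasM R _ (past f p.+1) (fun t => w * A p t) (F p) _ _.
move=> h; apply: (proj1 (h _ _)).
  exact: (cadapted_le (leqnSn p) (wA_adapted Lpp)).
exact: (unit_part_bmeas f (Lp_prime Lpp) (ltnSn p)).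
Qed.

Lemma partial_adapted n : adapted f n (U n).
Proof.
apply: (@bmeas_sum R _ (past f n)) => p Lpp.
exact: (adapted_le (ltn_ord p) (increment_adapted Lpp)).
Qed.

Lemma clock_adapted n : adapted f n (Tm n).
Proof.
apply: (@bmeas_sum R _ (past f n)) => p Lpp.
exact: (adapted_le (ltnW (ltn_ord p)) (quadratic_adapted Lpp)).
Qed.

(** The martingale difference property, tested against adapted [H]. *)
Lemma Ex_increment p H : Lp p -> adapted f p H ->
  Ex P (fun t => H t * u p t) = 0.
Proof.
move=> Lpp hH; have [hr hi] := wA_adapted Lpp.
have pp := Lp_prime Lpp.
have hHr := @bmeasM R _ (past f p) _ _ hH hr.
have hHi := @bmeasM R _ (past f p) _ _ hH hi.
have [e1 _] := Ex_character f_steinhaus pp (leqnn p) (isT : (0 < 1)%N) hHr.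
have [_ e2] := Ex_character f_steinhaus pp (leqnn p) (isT : (0 < 1)%N) hHi.
have [fr fi] := cbmeas_unit_version f_steinhaus (prime_gt0 pp).
rewrite (@eq_Ex _ _ _ _ _ (fun t => H t * complex.Re (w * A p t) * complex.Re (F p t ^+ 1) -
  H t * complex.Im (w * A p t) * complex.Im (F p t ^+ 1))); last first.
  by move=> t; rewrite /u ReM expr1; ring.
rewrite ExB ?e1 ?e2 ?subrr //; apply: bmeasM.
- exact: (adapted_bmeas f_steinhaus hHr).
- by under eq_fun do rewrite expr1.
- exact: (adapted_bmeas f_steinhaus hHi).
- by under eq_fun do rewrite expr1.
Qed.

(** For unimodular [F], [(Re (z F))^2 = |z|^2 / 2 + Re (z^2 F^2) / 2], and [F^2] again has
    conditional mean zero. *)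
Lemma Ex_increment_sqr p H : Lp p -> adapted f p H ->
  Ex P (fun t => H t * u p t ^+ 2) = Ex P (fun t => H t * V p t).
Proof.
move=> Lpp hH; have [hr hi] := wA_adapted Lpp.
have pp := Lp_prime Lpp.
have hx : adapted f p (fun t => H t * ((complex.Re (w * A p t) ^+ 2 -
   complex.Im (w * A p t) ^+ 2) / 2)).
  apply: (@bmeasM R _ (past f p)) => //; under eq_fun do rewrite mulrC.
  by apply: (@bmeasZ R _ (past f p)); apply: (@bmeasB R _ (past f p)); exact: (@bmeasX R _ (past f p)).
have hy : adapted f p (fun t => H t * (complex.Re (w * A p t) * complex.Im (w * A p t))).
  by apply: (@bmeasM R _ (past f p)) => //; exact: (@bmeasM R _ (past f p)).
have [e1 _] := Ex_character f_steinhaus pp (leqnn p) (isT : (0 < 2)%N) hx.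
have [_ e2] := Ex_character f_steinhaus pp (leqnn p) (isT : (0 < 2)%N) hy.
have hF2 : cbmeas (fun t => F p t ^+ 2).
  by apply: cbmeasX; exact: (cbmeas_unit_version f_steinhaus (prime_gt0 pp)).
have [fr fi] := hF2.
have bHV : bmeas (fun t => H t * V p t).
  apply: (adapted_bmeas f_steinhaus (n := p)).
  by apply: (@bmeasM R _ (past f p)) => //; exact: quadratic_adapted.
have bx := bmeasM (adapted_bmeas f_steinhaus hx) fr.
have by_ := bmeasM (adapted_bmeas f_steinhaus hy) fi.
rewrite (@eq_Ex _ _ _ _ _ (fun t => H t * V p t + (
  H t * ((complex.Re (w * A p t) ^+ 2 - complex.Im (w * A p t) ^+ 2) / 2) *
     complex.Re (F p t ^+ 2) -
  H t * (complex.Re (w * A p t) * complex.Im (w * A p t)) * complex.Im (F p t ^+ 2)))).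
  by rewrite ExD ?ExB ?e1 ?e2 ?subrr ?addr0 //; exact: bmeasB.
move=> t; rewrite /u /V cabs_sqr; move: (w * A p t) => z.
have := cabs_sqr (F p t); rewrite cabs_unit_version expr1n.
have -> : complex.Re (F p t ^+ 2) = complex.Re (F p t) * complex.Re (F p t) -
   complex.Im (F p t) * complex.Im (F p t) by rewrite expr2 ReM.
have -> : complex.Im (F p t ^+ 2) = complex.Re (F p t) * complex.Im (F p t) +
   complex.Im (F p t) * complex.Re (F p t) by rewrite expr2 ImM.
rewrite ReM; move: (H t) (complex.Re z) (complex.Im z)
  (complex.Re (F p t)) (complex.Im (F p t)) => h x y r s hs.
have -> : (x ^+ 2 + y ^+ 2) / 2 = (x ^+ 2 + y ^+ 2) / 2 * (r ^+ 2 + s ^+ 2).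
  by rewrite -hs mulr1.
by field.
Qed.

(** The Taylor remainders of [cos u], of [sin u] and of [exp(- V / 2)]. *)
Definition step_error (p : nat) (t : T) : R :=
  u p t ^+ 4 / 8 + `|u p t| ^+ 3 / 2 + V p t ^+ 2 / 4.

(** The arbitrary phase [c0] covers the real and imaginary parts of a characteristic function at
    once. *)
Definition charac (n : nat) : R := Ex P (fun t => cos (U n t + c0) * Phi (Tm n t)).

Lemma increment_bmeas p : Lp p -> bmeas (u p).
Proof. by move=> Lpp; exact: (adapted_bmeas f_steinhaus (increment_adapted Lpp)). Qed.

Lemma quadratic_bmeas p : Lp p -> bmeas (V p).
Proof. by move=> Lpp; exact: (adapted_bmeas f_steinhaus (quadratic_adapted Lpp)). Qed.

Lemma step_error_bmeas p : Lp p -> bmeas (step_error p).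
Proof.
move=> Lpp; have bu := increment_bmeas Lpp; have bV := quadratic_bmeas Lpp.
rewrite /step_error; apply: bmeasD; first apply: bmeasD.
- by under eq_fun do rewrite mulrC; apply: bmeasZ; exact: bmeasX.
- by under eq_fun do rewrite mulrC; apply: bmeasZ; apply: bmeasX; exact: bmeas_norm.
- by under eq_fun do rewrite mulrC; apply: bmeasZ; exact: bmeasX.
Qed.

Lemma excess_bmeas n : bmeas (fun t => Psi (Tm n t)).
Proof.
have [mT [M bT]] := adapted_bmeas f_steinhaus (clock_adapted n).
split.
  apply: measurableT_comp => //; apply: continuous_measurable_fun.
  exact: continuous_excess.
exists (M + `|s2|) => t; rewrite /excess ger0_norm ?le_max ?lexx //.
have := bT t; rewrite ler_norml => /andP[h1 h2].
have := ler_norm s2; have := ler_norm (- s2); rewrite normrN => h3 h4.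
have h5 := normr_ge0 (Tm n t); have h6 := bT t.
by case: (leP 0 (Tm n t - s2)); lra.
Qed.

(** The weight after the step, [Phi (Tm p + V p)], is already known before it, as [V p] depends only
    on smaller primes. It may therefore multiply the terms whose conditional mean is zero. *)
Lemma charac_step p : Lp p ->
  `|charac p.+1 - charac p| <= Ex P (step_error p) +
     (Ex P (fun t => Psi (Tm p.+1 t)) - Ex P (fun t => Psi (Tm p t))) / 2.
Proof.
move=> Lpp.
have US t : U p.+1 t = U p t + u p t.
  by rewrite /U big_mkcond big_ord_recr /= Lpp -big_mkcond.
have TS t : Tm p.+1 t = Tm p t + V p t.
  by rewrite /Tm big_mkcond big_ord_recr /= Lpp -big_mkcond.
have bu := increment_bmeas Lpp; have bV := quadratic_bmeas Lpp.
have mU : @measurable_fun _ _ (past f p) _ setT (fun t => U p t + c0).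
  by apply: (@measurable_funD _ (past f p)) => //; case: (partial_adapted p).
have mT : @measurable_fun _ _ (past f p) _ setT (fun t => Tm p t + V p t).
  by apply: (@measurable_funD _ (past f p)); [case: (clock_adapted p)|case: (quadratic_adapted Lpp)].
have aPhi : adapted f p (fun t => Phi (Tm p t + V p t)).
  apply: (@bmeas_comp R _ (past f p)) => //; first exact: continuous_compensator.
  by exists 1 => x; exact: compensator_norm.
have aH1 : adapted f p (fun t => Phi (Tm p t + V p t) * cos (U p t + c0)).
  by apply: (@bmeasM R _ (past f p)) => //; exact: (@bmeas_cos R _ (past f p)).
have aH2 : adapted f p (fun t => Phi (Tm p t + V p t) * sin (U p t + c0)).
  by apply: (@bmeasM R _ (past f p)) => //; exact: (@bmeas_sin R _ (past f p)).
set H1 := (fun t => _) in aH1; set H2 := (fun t => _) in aH2.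
have bH1 := adapted_bmeas f_steinhaus aH1.
have bH2 := adapted_bmeas f_steinhaus aH2.
have bD n : bmeas (fun t => cos (U n t + c0) * Phi (Tm n t)).
  have [mUn _] := adapted_bmeas f_steinhaus (partial_adapted n).
  have [mTn _] := adapted_bmeas f_steinhaus (clock_adapted n).
  apply: bmeasM; first by apply: bmeas_cos; exact: measurable_funD.
  apply: bmeas_comp => //; first exact: continuous_compensator.
  by exists 1 => x; exact: compensator_norm.
have bHu2 : bmeas (fun t => H1 t * u p t ^+ 2) by apply: bmeasM => //; exact: bmeasX.
have bHV : bmeas (fun t => H1 t * V p t) by exact: bmeasM.
have bHu : bmeas (fun t => H2 t * u p t) by exact: bmeasM.
(* The added terms have mean zero, by [Ex_increment_sqr] and [Ex_increment]; they make the integrand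
   small at every point. *)
pose G t := cos (U p.+1 t + c0) * Phi (Tm p.+1 t) - cos (U p t + c0) * Phi (Tm p t) +
  (H1 t * u p t ^+ 2 - H1 t * V p t) / 2 + H2 t * u p t.
have bG : bmeas G.
  apply: bmeasD => //; apply: bmeasD; first exact: bmeasB.
  by under eq_fun do rewrite mulrC; apply: bmeasZ; exact: bmeasB.
have -> : charac p.+1 - charac p = Ex P G.
  rewrite /G ExD //; last first.
    apply: bmeasD; first exact: bmeasB.
    by under eq_fun do rewrite mulrC; apply: bmeasZ; exact: bmeasB.
  rewrite Ex_increment // addr0 ExD; first last.
  - by under eq_fun do rewrite mulrC; apply: bmeasZ; exact: bmeasB.
  - exact: bmeasB.
  rewrite ExB //.
  rewrite [X in _ = _ + X](_ : _ = 0) ?addr0 //.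
  rewrite (@eq_Ex _ _ _ _ _ (fun t => 2^-1 * (H1 t * u p t ^+ 2 - H1 t * V p t))).
    by rewrite ExZ ?ExB ?Ex_increment_sqr ?subrr ?mulr0 //; exact: bmeasB.
  by move=> t; rewrite mulrC.
apply: le_trans (Ex_norm P bG) _.
have bP1 := excess_bmeas p.+1; have bP0 := excess_bmeas p.
have bE := step_error_bmeas Lpp.
have bPP : bmeas (fun t => 2^-1 * (Psi (Tm p.+1 t) - Psi (Tm p t))).
  by apply: bmeasZ; exact: bmeasB.
rewrite -ExB // [X in _ <= _ + X]mulrC -ExZ; last exact: bmeasB.
rewrite -ExD //; apply: Ex_le => //; first exact: bmeas_norm.
  exact: bmeasD.
move=> t; rewrite /G US TS /H1 /H2 /step_error.
have -> : U p t + u p t + c0 = U p t + c0 + u p t by ring.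
rewrite cosD.
have V0 := quadratic_ge0 p t.
have := compensator_step s2 (Tm p t) V0.
have := cos_taylor (u p t); have := sin_taylor (u p t).
have V02 : 0 <= V p t / 2 by rewrite divr_ge0.
have := expR_taylor V02.
have := cos_max (U p t + c0); have := sin_max (U p t + c0).
have := compensator_norm s2 (Tm p t + V p t).
move: (V p t) (u p t) (sin (u p t)) (cos (u p t)) (Psi (Tm p t))
  (Psi (Tm p t + V p t)) (sin (U p t + c0)) (cos (U p t + c0))
  (expR (- (V p t / 2))) (Phi (Tm p t)) (Phi (Tm p t + V p t)) =>
  v x su cu p0 p1 S C E b a.
move=> ha hS hC hE hs hc hst.
(* The orders one and two cancel against the added terms, leaving three Taylor remainders and one
   step of the compensator. *)
have -> : (C * cu - S * su) * a - C * b + (a * C * x ^+ 2 - a * C * v) / 2 + a * S * x =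
  (a * C) * (cu - (1 - x ^+ 2 / 2)) + (- (a * S)) * (su - x) +
  (- (a * C)) * (E - (1 - v / 2)) + C * (E * a - b) by field.
have b1 y z : `|y| <= 1 -> `|z| <= 1 -> `|y * z| <= 1 :> R.
  by move=> hy hz; rewrite normrM -[1]mulr1 ler_pM.
have b2 y z k : `|y| <= 1 -> `|z| <= k -> `|y * z| <= k :> R.
  by move=> hy hz; rewrite normrM; apply: le_trans hz; rewrite ler_piMl.
apply: le_trans (ler_normD _ _) _; rewrite [X in _ <= _ + X]mulrC; apply: lerD; last exact: b2.
apply: le_trans (ler_normD _ _) _; apply: lerD.
  apply: le_trans (ler_normD _ _) _; apply: lerD; first by apply: b2 => //; exact: b1.
  by apply: b2 => //; rewrite normrN; exact: b1.
have -> : v ^+ 2 / 4 = (v / 2) ^+ 2 by field.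
by apply: b2 => //; rewrite normrN; exact: b1.
Qed.

Lemma charac_total n :
  `|charac n - cos c0 * expR (- (s2 / 2))| <=
  \sum_(p < n | Lp p) Ex P (step_error p) + Ex P (fun t => Psi (Tm n t)) / 2.
Proof.
elim: n => [|n IH].
  rewrite big_ord0 add0r /charac.
  rewrite (@eq_Ex _ _ _ _ _ (fun=> cos c0 * expR (- (s2 / 2)))); last first.
    move=> t; rewrite /U /Tm !big_ord0 add0r /compensator subr0.
    by rewrite (_ : Num.max 0 s2 = s2) //; apply/max_idPr.
  rewrite Ex_cst subrr normr0 divr_ge0 // Ex_ge0 // => t.
  by rewrite le_max lexx.
have [Lpn|nLp] := boolP (Lp n); last first.
  have -> : charac n.+1 = charac n.
    apply: eq_Ex => t; rewrite /U /Tm big_mkcond big_ord_recr /= (negbTE nLp) addr0.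
    by rewrite -big_mkcond [X in Phi X]big_mkcond big_ord_recr /= (negbTE nLp) addr0 -big_mkcond.
  rewrite big_mkcond big_ord_recr /= (negbTE nLp) addr0 -big_mkcond.
  rewrite (@eq_Ex _ _ _ _ _ (fun t => Psi (Tm n t))) // => t.
  by rewrite /Tm big_mkcond big_ord_recr /= (negbTE nLp) addr0 -big_mkcond.
have -> : \sum_(p < n.+1 | Lp p) Ex P (step_error p) =
    \sum_(p < n | Lp p) Ex P (step_error p) + Ex P (step_error n).
  by rewrite big_mkcond big_ord_recr /= Lpn -big_mkcond.
have h := charac_step Lpn.
apply: le_trans (ler_distD (charac n) _ _) _; lra.
Qed.

(** Removing the weight costs [1 - Phi]; together with the accumulated excess this is controlled by
    [compensator_excess]. *)
Lemma martingale_clt n :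
  `|Ex P (fun t => cos (U n t + c0)) - cos c0 * expR (- (s2 / 2))| <=
  \sum_(p < n | Lp p) Ex P (step_error p) + Ex P (fun t => `|Tm n t - s2|) / 2.
Proof.
have [mUn _] := adapted_bmeas f_steinhaus (partial_adapted n).
have bT := adapted_bmeas f_steinhaus (clock_adapted n).
have [mTn _] := bT.
have bc : bmeas (fun t => cos (U n t + c0)).
  by apply: bmeas_cos; exact: measurable_funD.
have bPhi : bmeas (fun t => Phi (Tm n t)).
  apply: bmeas_comp => //; first exact: continuous_compensator.
  by exists 1 => x; exact: compensator_norm.
have bcP := bmeasM bc bPhi.
have bPsi := excess_bmeas n.
have bTs : bmeas (fun t => `|Tm n t - s2|).
  by apply: bmeas_norm; apply: bmeasB => //; exact: bmeas_cst.
have b1P : bmeas (fun t => 1 - Phi (Tm n t)) by apply: bmeasB => //; exact: bmeas_cst.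
have h1 : `|Ex P (fun t => cos (U n t + c0)) - charac n| <= Ex P (fun t => 1 - Phi (Tm n t)).
  rewrite /charac -ExB //; apply: le_trans (Ex_norm P (bmeasB bc bcP)) _.
  apply: Ex_le => //; first by apply: bmeas_norm; exact: bmeasB.
  move=> t; rewrite -{1}[cos _]mulr1 -mulrBr normrM.
  rewrite [ `|1 - _|]ger0_norm ?subr_ge0 ?compensator_le1 //.
  by rewrite ler_piMl ?cos_max // subr_ge0 compensator_le1.
have h2 : Ex P (fun t => 1 - Phi (Tm n t)) + Ex P (fun t => Psi (Tm n t)) / 2 <=
   Ex P (fun t => `|Tm n t - s2|) / 2.
  rewrite [X in _ + X <= _]mulrC [X in _ <= X]mulrC -!ExZ // -ExD //; last exact: bmeasZ.
  apply: Ex_le; [by apply: bmeasD => //; exact: bmeasZ|exact: bmeasZ|].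
  move=> t; rewrite [2^-1 * _]mulrC [2^-1 * `| _ |]mulrC.
  exact: compensator_excess.
have := charac_total n.
move=> h3; apply: le_trans (ler_distD (charac n) _ _) _; lra.
Qed.

End martingale.

(** * Bernstein approximation by trigonometric polynomials *)

Section bernstein.
Context (R : realType).

(* The expectation of [phi] under the binomial law with parameters [n, s]. *)
Fixpoint bernstein (n : nat) (s : R) (phi : nat -> R) : R :=
  if n is m.+1 then
    s * bernstein m s (fun i => phi i.+1) + (1 - s) * bernstein m s phi
  else phi 0.

Lemma bernstein_le n s phi psi : 0 <= s <= 1 ->
  (forall i, (i <= n)%N -> phi i <= psi i) -> bernstein n s phi <= bernstein n s psi.
Proof.
move=> /andP[s0 s1]; elim: n phi psi => [|n IH] phi psi h /=; first exact: h.
apply: lerD; apply: ler_wpM2l; rewrite ?subr_ge0 //; apply: IH => i iN; apply: h; lia.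
Qed.

Lemma bernstein_cst n s c : bernstein n s (fun=> c) = c.
Proof. by elim: n => //= n ->; ring. Qed.

Lemma bernsteinD n s phi psi :
  bernstein n s (fun i => phi i + psi i) = bernstein n s phi + bernstein n s psi.
Proof. by elim: n phi psi => //= n IH phi psi; rewrite !IH; ring. Qed.

Lemma bernsteinZ n s c phi :
  bernstein n s (fun i => c * phi i) = c * bernstein n s phi.
Proof. by elim: n phi => //= n IH phi; rewrite !IH; ring. Qed.

Lemma bernstein_sqr n s x :
  bernstein n s (fun i => (i%:R - x) ^+ 2) = n%:R * s * (1 - s) + (n%:R * s - x) ^+ 2.
Proof.
elim: n x => [|n IH] x /=; first by ring.
have -> : (fun i : nat => ((i.+1)%:R - x) ^+ 2) = (fun i => (i%:R - (x - 1)) ^+ 2).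
  by apply/funext => i; rewrite -natr1; ring.
by rewrite !IH -natr1; ring.
Qed.

Lemma bernstein_variance n s : (0 < n)%N -> 0 <= s <= 1 ->
  bernstein n s (fun i => (s - i%:R / n%:R) ^+ 2) <= n%:R^-1.
Proof.
move=> n0 /andP[s0 s1]; have nR : (0 : R) < n%:R by rewrite ltr0n.
have -> : (fun i : nat => (s - i%:R / n%:R) ^+ 2) =
   (fun i => (n%:R ^+ 2)^-1 * (i%:R - n%:R * s) ^+ 2).
  by apply/funext => i; field; rewrite gt_eqF.
rewrite bernsteinZ bernstein_sqr subrr expr0n /= addr0.
have -> : (n%:R ^+ 2)^-1 * (n%:R * s * (1 - s)) = n%:R^-1 * (s * (1 - s)) :> R.
  by field; rewrite gt_eqF.
by rewrite ler_piMr ?invr_ge0 ?(ltW nR) //; nra.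
Qed.

(** Arbitrary phases make sines and constants special cases, so convergence for cosines of affine
    forms extends to the whole class by linearity. *)
Inductive trigpoly : (R * R -> R) -> Prop :=
| trigpoly_cos a b c : trigpoly (fun w => cos (a * w.1 + b * w.2 + c))
| trigpolyD h k : trigpoly h -> trigpoly k -> trigpoly (fun w => h w + k w)
| trigpolyZ s h : trigpoly h -> trigpoly (fun w => s * h w).

Lemma trigpoly_mul_cos h a b c : trigpoly h ->
  trigpoly (fun w => cos (a * w.1 + b * w.2 + c) * h w).
Proof.
elim=> [a' b' c'|h1 k1 _ IH1 _ IH2|s h1 _ IH].
- have -> : (fun w : R * R => cos (a * w.1 + b * w.2 + c) * cos (a' * w.1 + b' * w.2 + c')) =
    (fun w => 2^-1 * (cos ((a + a') * w.1 + (b + b') * w.2 + (c + c')) +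
                      cos ((a - a') * w.1 + (b - b') * w.2 + (c - c')))).
    apply/funext => w.
    have -> : (a + a') * w.1 + (b + b') * w.2 + (c + c') =
      (a * w.1 + b * w.2 + c) + (a' * w.1 + b' * w.2 + c') by ring.
    have -> : (a - a') * w.1 + (b - b') * w.2 + (c - c') =
      (a * w.1 + b * w.2 + c) - (a' * w.1 + b' * w.2 + c') by ring.
    move: (a * w.1 + b * w.2 + c) (a' * w.1 + b' * w.2 + c') => x y.
    by rewrite cosD cosB; field.
  by apply: trigpolyZ; apply: trigpolyD; exact: trigpoly_cos.
- have -> : (fun w => cos (a * w.1 + b * w.2 + c) * (h1 w + k1 w)) =
    (fun w => cos (a * w.1 + b * w.2 + c) * h1 w + cos (a * w.1 + b * w.2 + c) * k1 w).
    by apply/funext => w; rewrite mulrDr.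
  exact: trigpolyD.
- have -> : (fun w => cos (a * w.1 + b * w.2 + c) * (s * h1 w)) =
    (fun w => s * (cos (a * w.1 + b * w.2 + c) * h1 w)).
    by apply/funext => w; rewrite mulrCA.
  exact: trigpolyZ.
Qed.

Lemma trigpoly_cst c : trigpoly (fun=> c).
Proof.
have := trigpolyZ c (trigpoly_cos 0 0 0); congr trigpoly; apply/funext => w.
by rewrite !mul0r !addr0 cos0 mulr1.
Qed.

(** The recursion only multiplies by [sg] and [1 - sg], which are affine in a cosine. *)
Lemma trigpoly_bernstein n (sg : R * R -> R) (Phi : nat -> R * R -> R) a b c :
  (forall w, sg w = 2^-1 + 2^-1 * cos (a * w.1 + b * w.2 + c)) ->
  (forall i, trigpoly (Phi i)) ->
  trigpoly (fun w => bernstein n (sg w) (fun i => Phi i w)).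
Proof.
move=> sgE; elim: n Phi => [|n IH] Phi hPhi /=; first exact: hPhi.
have m1 h : trigpoly h -> trigpoly (fun w => sg w * h w).
  move=> hh; have -> : (fun w => sg w * h w) = (fun w => 2^-1 * h w +
      2^-1 * (cos (a * w.1 + b * w.2 + c) * h w)).
    by apply/funext => w; rewrite sgE; ring.
  by apply: trigpolyD; apply: trigpolyZ => //; exact: trigpoly_mul_cos.
apply: trigpolyD; first by apply: m1; apply: IH => i; exact: hPhi.
have -> : (fun w => (1 - sg w) * bernstein n (sg w) (Phi^~ w)) =
  (fun w => bernstein n (sg w) (Phi^~ w) + (-1) * (sg w * bernstein n (sg w) (Phi^~ w))).
  by apply/funext => w; ring.
by apply: trigpolyD; [exact: IH|apply: trigpolyZ; apply: m1; exact: IH].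
Qed.

Lemma trigpoly_bounded h : trigpoly h -> exists M : R, forall w, `|h w| <= M.
Proof.
elim=> [a b c|h1 k1 _ [M1 H1] _ [M2 H2]|s h1 _ [M1 H1]].
- by exists 1 => w; exact: cos_max.
- exists (M1 + M2) => w; apply: le_trans (ler_normD _ _) _; exact: lerD.
- by exists (`|s| * M1) => w; rewrite normrM ler_wpM2l.
Qed.

Lemma trigpoly_measurable h : trigpoly h -> measurable_fun setT h.
Proof.
elim=> [a b c|h1 k1 _ H1 _ H2|s h1 _ H1].
- apply: measurableT_comp; first exact: continuous_measurable_fun (@continuous_cos R).
  by apply: measurable_funD => //; apply: measurable_funD; apply: measurable_funM.
- exact: measurable_funD.
- exact: measurable_funM.
Qed.

(** Write [sin x - sin y = 2 sin ((x - y) / 2) cos ((x + y) / 2)]. Restricting [x] to [[-1, 1]]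
    keeps both half-angles within [B = (1 + pi / 2) / 2 < pi / 2], where [cos] is at least
    [cos B > 0]; this gives [k = (cos B)^2]. *)
Lemma sin_expanding : exists2 k : R, 0 < k & forall x y,
  `|x| <= 1 -> `|y| <= pi / 2 -> k * `|x - y| <= `|sin x - sin y|.
Proof.
have p1 : 1 < pi / 2 :> R.
  rewrite lt_neqAle pihalf_ge1 andbT; apply/eqP => h.
  by have := @cos1_gt0 R; rewrite h cos_pihalf ltxx.
pose B : R := (1 + pi / 2) / 2.
have B1 : B < pi / 2 by rewrite /B; lra.
have B0 : 0 < B by rewrite /B; lra.
have cB : 0 < cos B by apply: cos_gt0_pihalf; rewrite B1 andbT; lra.
have cos_ge x : `|x| <= B -> cos B <= cos x.
  move=> xB; rewrite -(cos_norm x).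
  have h1 : `|x| \in `[0, pi] by rewrite in_itv /= normr_ge0 /=; lra.
  have h2 : B \in `[0, pi] by rewrite in_itv /= (ltW B0) /=; lra.
  by rewrite leNgt ltr_cos // -leNgt.
have sin_ge y : `|y| <= B -> cos B * `|y| <= `|sin y|.
  wlog y0 : y / 0 <= y => [H|].
    have [/H//|y0] := leP 0 y.
    by have := H (- y); rewrite sinN !normrN; apply; rewrite oppr_ge0 ltW.
  move: y0; rewrite le_eqVlt => /predU1P[<-|y0]; first by rewrite normr0 mulr0.
  have [c cx] := @MVT R sin cos 0 y y0 (fun y _ => is_derive_sin y)
    (continuous_subspaceT (@continuous_sin R)).
  rewrite sin0 !subr0 => -> yB; rewrite normrM ler_pM2r ?normr_gt0 ?gt_eqF //.
  move: cx; rewrite in_itv /= => /andP[c0 cy].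
  apply: le_trans (ler_norm _); apply: cos_ge.
  by rewrite gtr0_norm // (le_trans (ltW cy)) // -(gtr0_norm y0).
exists (cos B ^+ 2); first exact: exprn_gt0.
move=> x y hx hy; move: (hx) (hy); rewrite !ler_norml => /andP[x1 x2] /andP[y1 y2].
have -> : sin x - sin y = 2 * sin ((x - y) / 2) * cos ((x + y) / 2).
  have id s t : sin (s + t) - sin (s - t) = 2 * sin t * cos s.
    by rewrite sinD sinB; ring.
  rewrite -id; congr (sin _ - sin _); by field.
have h1 : `|(x - y) / 2| <= B by rewrite ler_norml /B; apply/andP; split; lra.
have h2 : `|(x + y) / 2| <= B by rewrite ler_norml /B; apply/andP; split; lra.
rewrite !normrM [ `|2|]ger0_norm //.
have := sin_ge _ h1; rewrite normrM [ `|2^-1|]ger0_norm ?invr_ge0 // => h3.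
have h4 : cos B <= `|cos ((x + y) / 2)| by apply: le_trans (ler_norm _); exact: cos_ge.
have -> : cos B ^+ 2 * `|x - y| = 2 * (cos B * (`|x - y| / 2)) * cos B by field.
by apply: ler_pM => //; rewrite ?mulr_ge0 ?(ltW cB) ?ler_pM2l.
Qed.

(** The point [q] may leave the square, which is needed because the Bernstein nodes range over
    [[- L pi / 2, L pi / 2]]. *)
Lemma compact_uniform (g : R * R -> R) (A eta : R) : continuous g -> 0 < eta ->
  exists2 dl : R, 0 < dl & forall p q : R * R, `|p.1| <= A -> `|p.2| <= A ->
    `|p.1 - q.1| < dl -> `|p.2 - q.2| < dl -> `|g p - g q| <= eta.
Proof.
move=> cg eta0.
pose K : set (R * R) := `[- A, A]%classic `*` `[- A, A]%classic.
have cK : compact K by apply: compact_setX; exact: segment_compact.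
pose Q (dl : R) (p : R * R) := forall q : R * R, `|p.1 - q.1| < dl ->
  `|p.2 - q.2| < dl -> `|g p - g q| <= eta.
have /compact_near_coveringP/(_ R (0^'+) Q _) H := cK.
have {}H : \forall dl \near (0 : R)^'+, K `<=` Q dl.
  apply: H => x Kx.
  have e2 : 0 < eta / 2 by rewrite divr_gt0.
  have /cvgrPdist_lt/(_ _ e2) := cg x.
  move=> /nbhs_ballP [r /= r0 hr].
  exists (ball x (r / 2), [set dl | 0 < dl < r / 2]) => /=.
    split; first by apply: nbhsx_ballx; rewrite divr_gt0.
    near=> z; apply/andP; split; near: z; first exact: nbhs_right_gt.
    by apply: nbhs_right_lt; rewrite divr_gt0.
  move=> [p dl] /= [[bp1 bp2] /andP[d0 dr]] q h1 h2.
  have hp : `|g x - g p| < eta / 2.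
    apply: hr; split => /=; rewrite /ball /=.
      by apply: lt_le_trans bp1 _; lra.
    by apply: lt_le_trans bp2 _; lra.
  have hq : `|g x - g q| < eta / 2.
    apply: hr; split => /=; rewrite /ball /=.
      apply: le_lt_trans (ler_distD p.1 _ _) _; move: bp1; rewrite /ball /= => bp1; lra.
    apply: le_lt_trans (ler_distD p.2 _ _) _; move: bp2; rewrite /ball /= => bp2; lra.
  apply: le_trans (ler_distD (g x) _ _) _; rewrite [ `|g p - g x|]distrC; lra.
near (0 : R)^'+ => dl; exists dl; first by near: dl; exact: nbhs_right_gt.
move=> p q p1 p2; have hdl : K `<=` Q dl by near: dl.
by apply: hdl; split; rewrite /= in_itv /= -ler_norml.
Unshelve. all: by end_near. Qed.

Definition outside (L : R) (w : R * R) : R :=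
  (~~ ((`|w.1| <= L) && (`|w.2| <= L)))%:R.

(* Bernstein approximation in the variables [(1 + sin (x / L)) / 2], which are
   trigonometric polynomials and separate the points of the square [-L, L]^2. *)
Lemma trigpoly_approx (g : R * R -> R) (M L eta : R) : continuous g ->
  (forall w, `|g w| <= M) -> 0 < L -> 0 < eta ->
  exists2 h, trigpoly h & forall w, `|g w - h w| <= eta + 2 * M * outside L w.
Proof.
move=> cg bg L0 eta0.
have M0 : 0 <= M by apply: le_trans (bg (0, 0)).
have [k k0 hk] := sin_expanding.
have e2 : 0 < eta / 2 by rewrite divr_gt0.
have [dl dl0 hdl] := @compact_uniform g L (eta / 2) cg e2.
(* Where [g] varies by more than [eta / 2], its variation [2 M] is dominated by [2 M / dl^2] times
   the squared distance; [2 L / k] turns distances of points into distances of the parameters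
   [sg]. *)
pose C := 2 * M / dl ^+ 2 * (2 * L / k) ^+ 2.
have C0 : 0 <= C.
  rewrite /C; apply: mulr_ge0; last exact: sqr_ge0.
  by apply: divr_ge0; [exact: mulr_ge0 | exact: sqr_ge0].
pose n := (Num.truncn (4 * C / eta)).+1.
have nR : (0 : R) < n%:R by rewrite ltr0n.
have hn : 4 * C / eta <= n%:R.
  apply: ltW; rewrite /n; apply: truncnS_gt.
(* The node at which [sg] takes the value [i / n]. *)
pose pt (i : nat) : R := L * asin (2 * (i%:R / n%:R) - 1).
pose sg (x : R) : R := 2^-1 + 2^-1 * cos (L^-1 * x + (- (pi / 2))).
have sgE x : sg x = (1 + sin (x / L)) / 2.
  by rewrite /sg cosBpihalf mulrC [L^-1 * x]mulrC; field.
have sg01 x : 0 <= sg x <= 1.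
  rewrite sgE; have := sin_geN1 (x / L); have := sin_le1 (x / L); lra.
pose h (w : R * R) := bernstein n (sg w.1) (fun i => bernstein n (sg w.2)
   (fun j => g (pt i, pt j))).
exists h.
  apply: (@trigpoly_bernstein n (fun w => sg w.1)
    (fun i w => bernstein n (sg w.2) (fun j => g (pt i, pt j))) L^-1 0 (- (pi / 2))).
    by move=> w; rewrite /sg mul0r addr0.
  move=> i; apply: (@trigpoly_bernstein n (fun w => sg w.2)
    (fun j w => g (pt i, pt j)) 0 L^-1 (- (pi / 2))).
    by move=> w; rewrite /sg mul0r add0r.
  by move=> j; exact: trigpoly_cst.
have bern_bound s phi B : 0 <= s <= 1 ->
    (forall i, (i <= n)%N -> `|phi i| <= B) -> `|bernstein n s phi| <= B.
  move=> s01 hp; rewrite ler_norml; apply/andP; split.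
    rewrite -(bernstein_cst n s (- B)); apply: bernstein_le => // i /hp.
    by rewrite ler_norml => /andP[].
  rewrite -[X in _ <= X](bernstein_cst n s B); apply: bernstein_le => // i /hp.
  by rewrite ler_norml => /andP[].
move=> w; rewrite /outside; case: (boolP (_ && _)) => [/andP[w1 w2]|_] /=; last first.
  rewrite mulr1; apply: le_trans (_ : M + M <= _); last by lra.
  apply: le_trans (ler_normB _ _) _; apply: lerD; first exact: bg.
  by apply: (bern_bound) => // i _; apply: (bern_bound).
rewrite mulr0 addr0.
have pt_close x i : `|x| <= L -> (i <= n)%N ->
    `|x - pt i| <= 2 * L / k * `|sg x - i%:R / n%:R|.
  move=> xL iN; pose y : R := 2 * (i%:R / n%:R) - 1.
  have y1 : -1 <= y <= 1.
    have h0 : 0 <= i%:R / n%:R :> R by rewrite divr_ge0.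
    have h1 : i%:R / n%:R <= 1 :> R by rewrite ler_pdivrMr // mul1r ler_nat.
    by rewrite /y; lra.
  have hx : `|x / L| <= 1.
    by rewrite normrM normfV (gtr0_norm L0) ler_pdivrMr // mul1r.
  have ha : `|asin y| <= pi / 2.
    by rewrite ler_norml asin_geNpi2 // asin_lepi2.
  have := hk _ _ hx ha; rewrite asinK ?in_itv //= => hh.
  have -> : x - pt i = L * (x / L - asin y) by rewrite /pt -/y; field; rewrite gt_eqF.
  have -> : sg x - i%:R / n%:R = (sin (x / L) - y) / 2.
    by rewrite sgE /y; move: (i%:R / n%:R) => q; field.
  rewrite !normrM (gtr0_norm L0) [ `|2^-1|]ger0_norm ?invr_ge0 //.
  have -> : 2 * L / k * (`|sin (x / L) - y| / 2) = L * (`|sin (x / L) - y| / k).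
    by field; rewrite gt_eqF.
  by rewrite ler_pM2l // ler_pdivlMr // mulrC.
have main i j : (i <= n)%N -> (j <= n)%N -> `|g w - g (pt i, pt j)| <=
   eta / 2 + C * ((sg w.1 - i%:R / n%:R) ^+ 2 + (sg w.2 - j%:R / n%:R) ^+ 2).
  move=> iN jN; have h1 := pt_close _ _ w1 iN; have h2 := pt_close _ _ w2 jN.
  have sq (z z' : R) : `|z| <= 2 * L / k * `|z'| -> z ^+ 2 <= (2 * L / k) ^+ 2 * z' ^+ 2.
    move=> hz; rewrite -(real_normK (num_real z)) -(real_normK (num_real z')) -exprMn.
    by rewrite ler_pXn2r ?nnegrE ?mulr_ge0 ?invr_ge0 ?(ltW k0) ?(ltW L0).
  have q1 := sq _ _ h1; have q2 := sq _ _ h2.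
  set A1 := (sg w.1 - _) ^+ 2 in q1 *; set A2 := (sg w.2 - _) ^+ 2 in q2 *.
  have hC : 2 * M / dl ^+ 2 * ((w.1 - pt i) ^+ 2 + (w.2 - pt j) ^+ 2) <= C * (A1 + A2).
    rewrite /C -[X in _ <= X]mulrA; apply: ler_wpM2l.
      by apply: divr_ge0; [exact: mulr_ge0 | exact: sqr_ge0].
    by rewrite [X in _ <= X]mulrDr; exact: lerD.
  have d2 : 0 < dl ^+ 2 by rewrite exprn_gt0.
  have big (z z' : R) : dl <= `|z| -> 2 * M <= 2 * M / dl ^+ 2 * (z ^+ 2 + z' ^+ 2).
    move=> hz; have : dl ^+ 2 <= z ^+ 2 + z' ^+ 2.
      rewrite -(real_normK (num_real z)); have : dl ^+ 2 <= `|z| ^+ 2.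
        by rewrite ler_pXn2r ?nnegrE // ltW.
      by have := sqr_ge0 z'; lra.
    move=> hh; rewrite mulrAC ler_pdivlMr // ler_wpM2l // mulr_ge0 //.
  have triv : `|g w - g (pt i, pt j)| <= 2 * M.
    apply: le_trans (ler_normB _ _) _; have := bg w; have := bg (pt i, pt j); lra.
  have AA : 0 <= C * (A1 + A2) by rewrite mulr_ge0 // addr_ge0 // sqr_ge0.
  have [c1|c1] := ltP `|w.1 - pt i| dl; last first.
    have := big _ (w.2 - pt j) c1; lra.
  have [c2|c2] := ltP `|w.2 - pt j| dl; last first.
    have := big _ (w.1 - pt i) c2; rewrite [(w.2 - _) ^+ 2 + _]addrC; lra.
  have := hdl w (pt i, pt j) w1 w2 c1 c2; lra.
have -> : g w - h w = bernstein n (sg w.1) (fun i => bernstein n (sg w.2)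
   (fun j => g w - g (pt i, pt j))).
  rewrite /h -{1}(bernstein_cst n (sg w.1) (g w)) -mulN1r -bernsteinZ -bernsteinD.
  congr (bernstein n (sg w.1)); apply/funext => i.
  rewrite -{1}(bernstein_cst n (sg w.2) (g w)) -bernsteinZ -bernsteinD.
  by congr (bernstein n (sg w.2)); apply/funext => j; rewrite mulN1r.
have V1 := bernstein_variance (ltn0Sn _ : (0 < n)%N) (sg01 w.1).
have V2 := bernstein_variance (ltn0Sn _ : (0 < n)%N) (sg01 w.2).
pose U i j := eta / 2 + C * ((sg w.1 - i%:R / n%:R) ^+ 2 + (sg w.2 - j%:R / n%:R) ^+ 2).
have UE : bernstein n (sg w.1) (fun i => bernstein n (sg w.2) (U i)) <= eta.
  have -> : (fun i : nat => bernstein n (sg w.2) (U i)) = (fun i =>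
    (eta / 2 + C * bernstein n (sg w.2) (fun j => (sg w.2 - j%:R / n%:R) ^+ 2)) +
     C * (sg w.1 - i%:R / n%:R) ^+ 2).
    apply/funext => i; rewrite /U.
    have -> : (fun j : nat => eta / 2 + C * ((sg w.1 - i%:R / n%:R) ^+ 2 +
       (sg w.2 - j%:R / n%:R) ^+ 2)) = (fun j =>
       (eta / 2 + C * (sg w.1 - i%:R / n%:R) ^+ 2) + C * (sg w.2 - j%:R / n%:R) ^+ 2).
      by apply/funext => j; ring.
    by rewrite bernsteinD bernstein_cst bernsteinZ; ring.
  rewrite bernsteinD bernstein_cst bernsteinZ.
  have h1 : C * n%:R^-1 <= eta / 4.
    by rewrite ler_pdivrMr //; move: hn; rewrite ler_pdivrMr //; lra.
  have := ler_wpM2l C0 V1; have := ler_wpM2l C0 V2; lra.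
apply: le_trans UE; rewrite ler_norml; apply/andP; split.
  rewrite -mulN1r -bernsteinZ; apply: bernstein_le => // i iN.
  rewrite -bernsteinZ; apply: bernstein_le => // j jN.
  by have := main i j iN jN; rewrite ler_norml mulN1r => /andP[].
apply: bernstein_le => // i iN; apply: bernstein_le => // j jN.
by have := main i j iN jN; rewrite ler_norml => /andP[].
Qed.

End bernstein.

(** * From cosines to bounded continuous functions *)

Section weak_convergence.
Context (R : realType).
Implicit Types (g h : R * R -> R).

Lemma outside_ge0 (L : R) w : 0 <= outside L w.
Proof. by rewrite /outside ler0n. Qed.

Lemma outside_le1 (L : R) w : outside L w <= 1.
Proof. by rewrite /outside; case: (~~ _). Qed.

Lemma outside0 (L : R) w : `|w.1| <= L -> `|w.2| <= L -> outside L w = 0.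
Proof. by rewrite /outside => -> ->. Qed.

Lemma measurable_outside (L : R) : measurable_fun setT (outside L).
Proof.
apply: (@measurableT_comp _ _ _ _ _ _ (fun b : bool => (b%:R : R))) => //.
apply: measurable_neg; apply: measurable_and.
  by apply: measurable_fun_ler => //; apply: measurableT_comp.
by apply: measurable_fun_ler => //; apply: measurableT_comp.
Qed.

Lemma outside_chebyshev (L : R) w : 0 < L ->
  outside L w <= (w.1 ^+ 2 + w.2 ^+ 2) / L ^+ 2.
Proof.
move=> L0; have L2 : 0 < L ^+ 2 by rewrite exprn_gt0.
rewrite ler_pdivlMr // /outside; have s1 := sqr_ge0 w.1; have s2 := sqr_ge0 w.2.
case: (boolP (_ && _)) => [_|] /=; first by rewrite mul0r addr_ge0.
rewrite mul1r negb_and -!ltNge => /orP[] h.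
  have : L ^+ 2 <= `|w.1| ^+ 2 by rewrite ler_pXn2r ?nnegrE // ltW.
  by rewrite real_normK ?num_real //; lra.
have : L ^+ 2 <= `|w.2| ^+ 2 by rewrite ler_pXn2r ?nnegrE // ltW.
by rewrite real_normK ?num_real //; lra.
Qed.

(** Measurability for the product sigma-algebra: [g] is the pointwise limit of its trigonometric
    approximations on growing squares with error [1 / n.+1]. *)
Lemma measurable_bounded_continuous g (M : R) : continuous g ->
  (forall w, `|g w| <= M) -> measurable_fun setT g.
Proof.
move=> cg bg.
have /choice[h hh] : forall n : nat, exists h, trigpoly h /\
    forall w, `|g w - h w| <= n.+1%:R^-1 + 2 * M * outside n.+1%:R w.
  move=> n; have [//| |h th hh] := @trigpoly_approx R g M n.+1%:R n.+1%:R^-1 cg bg.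
    by rewrite invr_gt0.
  by exists h.
apply: (@measurable_fun_cvg _ _ _ setT h g) => //.
  by move=> n; apply: trigpoly_measurable; have [] := hh n.
move=> w _; apply/cvgrPdist_le => e e0; near=> n.
have [_ /(_ w)] := hh n; rewrite outside0.
- rewrite mulr0 addr0 => /le_trans; apply; near: n.
  by apply: filterS (near_infty_natSinv_lt (PosNum e0)) => k /ltW.
- near: n; exists (Num.truncn `|w.1|) => // n /= hn; apply: ltW.
  by apply: lt_le_trans (truncnS_gt _) _; rewrite ler_nat ltnS.
- near: n; exists (Num.truncn `|w.2|) => // n /= hn; apply: ltW.
  by apply: lt_le_trans (truncnS_gt _) _; rewrite ler_nat ltnS.
Unshelve. all: by end_near. Qed.

Lemma bmeas_bounded_continuous (d : measure_display) (T : measurableType d) g (M : R)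
    (Z : T -> R * R) : continuous g -> (forall w, `|g w| <= M) ->
  measurable_fun setT Z -> bmeas (fun t => g (Z t)).
Proof.
move=> cg bg mZ; split; last by exists M => t; exact: bg.
apply: (measurableT_comp _ mZ); exact: measurable_bounded_continuous bg.
Qed.

Lemma bmeas_trigpoly (d : measure_display) (T : measurableType d) h
    (Z : T -> R * R) : trigpoly h -> measurable_fun setT Z -> bmeas (fun t => h (Z t)).
Proof.
move=> th mZ; have [M bM] := trigpoly_bounded th.
split; last by exists M => t; exact: bM.
by apply: (measurableT_comp _ mZ); exact: trigpoly_measurable.
Qed.

Lemma bmeas_outside (d : measure_display) (T : measurableType d) (L : R)
    (Z : T -> R * R) : measurable_fun setT Z -> bmeas (fun t => outside L (Z t)).
Proof.
move=> mZ; split; last by exists 1 => t; rewrite ger0_norm ?outside_ge0 ?outside_le1.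
by apply: (measurableT_comp _ mZ); exact: measurable_outside.
Qed.

(** Dominated convergence: each point lies in all large squares. *)
Lemma tight_single (d : measure_display) (T : measurableType d) (P : probability T R)
    (W : T -> R * R) (e : R) : measurable_fun setT W -> 0 < e ->
  \forall n \near \oo, Ex P (fun t => outside n%:R (W t)) <= e.
Proof.
move=> mW e0.
have h : (\int[P]_t (outside n%:R (W t))%:E @[n --> \oo] --> \int[P]_t (cst 0%:E t))%E.
  apply: (@dominated_cvg _ _ _ P setT _ _ _ (cst 1%:E)) => //.
  - by move=> n; apply/measurable_EFinP; have [] := bmeas_outside n%:R mW.
  - move=> t _; apply: cvg_near_cst; near=> n; congr EFin; apply: outside0.
      near: n; exists (Num.truncn `|(W t).1|).+1 => // n /= hn; apply: ltW.
      by apply: lt_le_trans (truncnS_gt _) _; rewrite ler_nat.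
    near: n; exists (Num.truncn `|(W t).2|).+1 => // n /= hn; apply: ltW.
    by apply: lt_le_trans (truncnS_gt _) _; rewrite ler_nat.
  - exact: finite_measure_integrable_cst.
  - by move=> n t _; rewrite abse_EFin lee_fin ger0_norm ?outside_ge0 ?outside_le1.
rewrite integral0 in h.
move/fine_cvg: h => /cvgrPdist_le/(_ _ e0); apply: filterS => n /=.
by rewrite sub0r normrN => /(le_trans (ler_norm _)).
Unshelve. all: by end_near. Qed.

Lemma weak_cvg_of_cos (d : measure_display) (T : measurableType d) (P : probability T R)
    (Z : nat -> T -> R * R)
    (d' : measure_display) (T' : measurableType d') (P' : probability T' R)
    (W : T' -> R * R) g (M K : R) :
  (forall n, measurable_fun setT (Z n)) -> measurable_fun setT W ->
  (forall a b c, Ex P (fun t => cos (a * (Z n t).1 + b * (Z n t).2 + c)) @[n --> \oo] -->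
     Ex P' (fun t => cos (a * (W t).1 + b * (W t).2 + c))) ->
  (forall n L, 0 < L -> Ex P (fun t => outside L (Z n t)) <= K / L ^+ 2) ->
  continuous g -> (forall w, `|g w| <= M) ->
  Ex P (fun t => g (Z n t)) @[n --> \oo] --> Ex P' (fun t => g (W t)).
Proof.
move=> mZ mW hcos tZ cg bg.
have M0 : 0 <= M by apply: le_trans (bg (0, 0)).
have htrig h : trigpoly h ->
    Ex P (fun t => h (Z n t)) @[n --> \oo] --> Ex P' (fun t => h (W t)).
  elim=> [a b c|h1 h2 t1 IH1 t2 IH2|s h1 t1 IH1]; first exact: hcos.
    rewrite ExD; [|exact: bmeas_trigpoly|exact: bmeas_trigpoly].
    rewrite (_ : (fun n => Ex P _) = (fun n => Ex P (fun t => h1 (Z n t)) + Ex P (fun t => h2 (Z n t)))).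
      exact: cvgD.
    by apply/funext => n; rewrite ExD //; exact: bmeas_trigpoly.
  rewrite ExZ; last exact: bmeas_trigpoly.
  rewrite (_ : (fun n => Ex P _) = (fun n => s * Ex P (fun t => h1 (Z n t)))).
    by apply: cvgM => //; exact: cvg_cst.
  by apply/funext => n; rewrite ExZ //; exact: bmeas_trigpoly.
apply/cvgrPdist_le => e e0.
(* Replacing [g] by [h] costs [e / 8 + 2 M dl <= 3 e / 8] on either side, and convergence for [h]
   the remaining [e / 4]. *)
pose dl := e / (8 * (M + 1)).
have M1 : 0 < M + 1 by lra.
have dl0 : 0 < dl by rewrite divr_gt0 // mulr_gt0.
have dlM : 2 * M * dl <= e / 4.
  have -> : e / 4 = 2 * (M + 1) * dl by rewrite /dl; field; rewrite gt_eqF.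
  by rewrite ler_pM2r //; lra.
have [L L0 [LZ LW]] : exists2 L : R, 0 < L &
    (forall n, Ex P (fun t => outside L (Z n t)) <= dl) /\
    Ex P' (fun t => outside L (W t)) <= dl.
  have hW := tight_single P' mW dl0.
  near \oo => m; exists m%:R.
    by rewrite ltr0n; near: m; exists 1%N.
  split; last by near: m.
  move=> n; have m0 : (0 : R) < m%:R by rewrite ltr0n; near: m; exists 1%N.
  apply: le_trans (tZ n _ m0) _.
  have hm : K / dl <= m%:R.
    near: m; exists (Num.truncn (K / dl)).+1 => // k /= hk; apply: ltW.
    by apply: lt_le_trans (truncnS_gt _) _; rewrite ler_nat.
  rewrite ler_pdivrMr ?exprn_gt0 //.
  have m1 : (1 : R) <= m%:R by rewrite ler1n -(ltr0n R).
  move: hm; rewrite ler_pdivrMr // => /le_trans; apply.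
  rewrite [_ * dl]mulrC ler_pM2l // expr2 ler_peMl //; exact: ltW.
have e8 : 0 < e / 8 by rewrite divr_gt0.
have [h th hh] := trigpoly_approx cg bg L0 e8.
have close (d0 : measure_display) (T0 : measurableType d0) (P0 : probability T0 R)
    (V : T0 -> R * R) : measurable_fun setT V ->
    Ex P0 (fun t => outside L (V t)) <= dl ->
    `|Ex P0 (fun t => g (V t)) - Ex P0 (fun t => h (V t))| <= 3 * e / 8.
  move=> mV hV.
  have b1 := bmeas_bounded_continuous cg bg mV.
  have b2 := bmeas_trigpoly th mV.
  have b3 := bmeas_outside L mV.
  rewrite -ExB //; apply: le_trans (Ex_norm _ (bmeasB b1 b2)) _.
  have b4 := bmeasD (bmeas_cst T0 (e / 8)) (bmeasZ (2 * M) b3).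
  apply: le_trans (Ex_le _ (bmeas_norm (bmeasB b1 b2)) b4 (fun t => hh (V t))) _.
  rewrite (ExD _ (bmeas_cst _ _) (bmeasZ _ b3)) Ex_cst ExZ //.
  have : 2 * M * Ex P0 (fun t => outside L (V t)) <= 2 * M * dl.
    by apply: ler_wpM2l => //; rewrite mulr_ge0.
  lra.
have e4 : 0 < e / 4 by rewrite divr_gt0.
have /cvgrPdist_le/(_ _ e4) := htrig h th; apply: filterS => n hn.
have h1 := close _ _ _ _ (mZ n) (LZ n); have h2 := close _ _ _ _ mW LW.
apply: le_trans (ler_distD (Ex P' (fun t => h (W t))) _ _) _.
have : `|Ex P' (fun t => h (W t)) - Ex P (fun t => g (Z n t))| <= 5 * e / 8.
  apply: le_trans (ler_distD (Ex P (fun t => h (Z n t))) _ _) _.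
  by rewrite [X in _ + X]distrC; lra.
lra.
Unshelve. all: by end_near. Qed.

End weak_convergence.

(** * Integrals against the normal law *)

Section normal_integral.
Context (R : realType).
Local Notation mu := (@lebesgue_measure R).

Lemma integral_normal_prob (m s : R) (f : measurableTypeR R -> \bar R) :
  (normal_prob m s).-integrable setT f ->
  (\int[normal_prob m s]_x f x = \int[mu]_x (f x * (normal_pdf m s x)%:E))%E.
Proof.
move=> intf; have mf := measurable_int _ intf.
rewrite -(Radon_Nikodym_change_of_variables (normal_prob_dominates m s)) //=.
apply: ae_eq_integral => //.
- apply: emeasurable_funM => //; apply: (measurable_int mu).
  by apply: Radon_Nikodym_integrable; exact: normal_prob_dominates.
- apply: emeasurable_funM => //; apply/measurable_EFinP.
  exact: measurable_normal_pdf.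
- apply: ae_eqe_mul2l => /=.
  rewrite Radon_NikodymE //=; first exact: normal_prob_dominates.
  move=> dom; case: cid => /= h [h1 h2 h3].
  apply: integral_ae_eq => //=.
  + by apply/measurable_EFinP; exact: measurable_normal_pdf.
  + by move=> E _ mE; rewrite -h3.
Qed.

Lemma cvg_integral_segments (F : measurableTypeR R -> R) : mu.-integrable setT (EFin \o F) ->
  (\int[mu]_(x in `[(- n%:R)%R, n%:R]) (F x)%:E @[n --> \oo] --> \int[mu]_x (F x)%:E)%E.
Proof.
move=> iF.
have mF := measurable_int _ iF.
under eq_fun do rewrite integral_mkcond.
apply: (@dominated_cvg _ _ _ mu setT _ _ _ (fun x => `|F x|%:E)) => //.
- move=> n; apply/(measurable_restrictT _ _).1 => //.
  exact: measurable_funTS.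
- move=> x _; apply: cvg_near_cst; exists (Num.truncn `|x|).+1 => // n /= hn.
  rewrite patchE ifT // inE /= in_itv /= -ler_norml.
  apply: ltW; apply: lt_le_trans (truncnS_gt _) _; by rewrite ler_nat.
- by have := integrable_abse iF.
- move=> n x _; rewrite patchE; case: ifP => // _.
  by rewrite abse0 lee_fin.
Qed.

End normal_integral.

(** * Fourier transform of the Gaussian *)

Section gaussian_fourier.
Context (R : realType).
Local Notation mu := (@lebesgue_measure R).
Local Notation g := (@gauss_fun R).

(** The function [exp(- x^2 / 2)], written through the normal density to inherit its integrability;
    it dominates both integrands and the derivative in [a]. *)
Let G (x : R) : R := (normal_peak 1)^-1 * normal_pdf 0 1 x.

Let G_ge0 x : 0 <= G x.
Proof. by rewrite mulr_ge0 ?invr_ge0 ?normal_peak_ge0 ?normal_pdf_ge0. Qed.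

Let G_integrable : mu.-integrable setT (EFin \o G).
Proof.
have -> : EFin \o G = (fun x => ((normal_peak 1)^-1%:E * (normal_pdf 0 1 x)%:E)%E).
  by apply/funext => x.
by apply: integrableZl => //; exact: integrable_normal_pdf.
Qed.

Let GE x : G x = expR (- (x ^+ 2 / 2)).
Proof.
rewrite /G normal_pdfE ?oner_eq0 // mulrA mulVf ?mul1r; last first.
  by rewrite gt_eqF // normal_peak_gt0 // oner_eq0.
by rewrite /normal_fun subr0 expr1n mulNr.
Qed.

Let xg_le x : `|x| * g x <= G x.
Proof.
rewrite GE /gauss_fun.
have -> : expR (- x ^+ 2) = expR (- (x ^+ 2 / 2)) * expR (- (x ^+ 2 / 2)).
  by rewrite -expRD; congr expR; field.
rewrite mulrA ler_piMl ?expR_ge0 //.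
rewrite expRN ler_pdivrMr ?expR_gt0 // mul1r.
apply: le_trans (expR_ge1Dx _).
have := sqr_ge0 (`|x| - 1); have : x ^+ 2 = `|x| ^+ 2 by rewrite real_normK // num_real.
by move=> ->; nra.
Qed.

Let g_le x : g x <= G x.
Proof.
rewrite GE /gauss_fun ler_expR lerN2.
by have := sqr_ge0 x; lra.
Qed.

Variable c : R.

Let mcos a : measurable_fun setT (fun x : R => cos (a * x + c)).
Proof. by apply: (proj1 (bmeas_cos _)); apply: measurable_funD. Qed.

Let msin a : measurable_fun setT (fun x : R => sin (a * x + c)).
Proof. by apply: (proj1 (bmeas_sin _)); apply: measurable_funD. Qed.

Let mg : measurable_fun setT g. Proof. exact: measurable_gauss_fun. Qed.

Let cos_gauss (a : R) (x : measurableTypeR R) : R := cos (a * x + c) * g x.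
Let xsin_gauss (a : R) (x : measurableTypeR R) : R := x * sin (a * x + c) * g x.

Lemma integrable_cos_gauss a : mu.-integrable setT (EFin \o cos_gauss a).
Proof.
apply: (le_integrable _ _ _ G_integrable) => //.
  apply/measurable_EFinP; apply: measurable_funM; [exact: mcos | exact: mg].
move=> x _; rewrite /comp !abse_EFin lee_fin normrM (ger0_norm (G_ge0 x)).
rewrite (ger0_norm (gauss_fun_ge0 x)); apply: le_trans (g_le x).
by rewrite ler_piMl ?gauss_fun_ge0 // cos_max.
Qed.

Let int_xsin a : mu.-integrable setT (EFin \o xsin_gauss a).
Proof.
apply: (le_integrable _ _ _ G_integrable) => //.
  apply/measurable_EFinP; apply: measurable_funM; last exact: mg.
  by apply: measurable_funM; last exact: msin.
move=> x _; rewrite /comp !abse_EFin lee_fin (ger0_norm (G_ge0 x)) !normrM.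
rewrite (ger0_norm (gauss_fun_ge0 x)); apply: le_trans (xg_le x).
by rewrite ler_wpM2r ?gauss_fun_ge0 // ler_piMr // sin_max.
Qed.

Definition gauss_cos (a : R) : R := \int[mu]_x cos_gauss a x.
Definition gauss_xsin (a : R) : R := \int[mu]_x xsin_gauss a x.

Let is_derive_aff a x : is_derive x (1 : R) (fun y : R => a * y + c) a.
Proof.
rewrite -[X in is_derive _ _ _ X]addr0; apply: is_deriveD.
rewrite -[X in is_derive _ _ _ X]mulr1.
exact: is_deriveZ.
Qed.

Let is_derive_gauss (x : R) : is_derive x (1 : R) g (- (2 * x) * g x).
Proof.
have h0 : is_derive x (1 : R) (fun y : R => y * y) (2 * x).
  have hi := is_derive_id x (1 : R).
  have := @is_deriveM R R _ _ x 1 _ _ hi hi.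
  rewrite (_ : 2 * x = x *: (1 : R) + x *: (1 : R)) //.
  by rewrite /GRing.scale /=; ring.
have h1 := @is_deriveN _ _ _ _ _ _ _ h0.
have h2 := @is_derive1_comp R expR _ x _ _ (is_derive_expR _) h1.
rewrite (_ : g = expR \o (- (fun y : R => y * y))); last first.
  by apply/funext => y; rewrite /gauss_fun /= expr2.
rewrite (_ : - (2 * x) * _ = expR (- (x * x)) * (- (2 * x))) //.
by rewrite mulrC.
Qed.

Lemma gauss_cos_derive a : is_derive a (1 : R) gauss_cos (- gauss_xsin a).
Proof.
have df b (x : R) : is_derive b (1 : R) (cos_gauss ^~ x) (- xsin_gauss b x).
  have h1 : is_derive b (1 : R) (fun y : R => y * x + c) x.
    rewrite -[X in is_derive _ _ _ X]addr0; apply: is_deriveD.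
    under eq_fun do rewrite mulrC.
    rewrite -[X in is_derive _ _ _ X]mulr1; exact: is_deriveZ.
  have h2 := @is_derive1_comp R cos (fun y => y * x + c) b _ _ (is_derive_cos _) h1.
  have h3 := @is_deriveZ _ _ _ (cos \o (fun y => y * x + c)) (g x) b 1 _ h2.
  rewrite (_ : - xsin_gauss b x = g x *: (- sin (b * x + c) * x)).
    rewrite (_ : cos_gauss^~ x = (g x \*: (cos \o (fun y => y * x + c)))); first exact: h3.
    by apply/funext => y; rewrite /cos_gauss mulrC.
  by rewrite /xsin_gauss /GRing.scale /=; ring.
have d1E b (x : R) : partial1of2 cos_gauss b x = - xsin_gauss b x.
  by rewrite partial1of2E derive_val.
have H : h^-1 *: (gauss_cos (h + a) - gauss_cos a) @[h --> 0^'] --> - gauss_xsin a.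
  have -> : - gauss_xsin a = \int[mu]_x partial1of2 cos_gauss a x.
    rewrite -mulN1r /gauss_xsin -RintegralZl //.
    by apply: eq_Rintegral => x _; rewrite d1E mulN1r.
  have Ia : `]a - 1, a + 1[%classic a by rewrite /= in_itv /=; apply/andP; split; lra.
  have hder b (x : measurableTypeR R) : `]a - 1, a + 1[%classic b -> [set: measurableTypeR R] x ->
    derivable (cos_gauss ^~ x) b 1 by move=> _ _; exact: ex_derive.
  have hub b (x : measurableTypeR R) : `]a - 1, a + 1[%classic b -> [set: measurableTypeR R] x ->
    `|partial1of2 cos_gauss b x| <= G x.
    move=> _ _; rewrite d1E normrN !normrM.
    rewrite (ger0_norm (gauss_fun_ge0 x)); apply: le_trans (xg_le x).
    by rewrite ler_wpM2r ?gauss_fun_ge0 // ler_piMr // sin_max.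
  exact: (@cvg_differentiation_under_integral R _ _ mu cos_gauss setT measurableT
     a (a - 1) (a + 1) Ia (fun b _ => integrable_cos_gauss b) hder G G_ge0 G_integrable hub).
apply: DeriveDef.
  apply/cvg_ex; exists (- gauss_xsin a).
  by under eq_fun do rewrite scaler1.
by rewrite -derive1E; apply/cvg_lim.
Qed.

(** Integration by parts: the derivative of [sin (a x + c) exp(- x^2)] has integral [0], as the
    limit of boundary terms over [[-n, n]]. *)
Lemma gauss_xsinE a : gauss_xsin a = a / 2 * gauss_cos a.
Proof.
pose H (x : R) : R := sin (a * x + c) * g x.
pose H' (x : R) : R := a * cos_gauss a x - 2 * xsin_gauss a x.
have dH (x : R) : is_derive x (1 : R) H (H' x).
  have h2 := @is_derive1_comp R sin _ x _ _ (is_derive_sin _) (is_derive_aff a x).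
  have := @is_deriveM R R _ _ x 1 _ _ h2 (is_derive_gauss x).
  rewrite (_ : H' x = sin (a * x + c) *: (- (2 * x) * g x) +
     g x *: (cos (a * x + c) * a)) //.
  by rewrite /H' /cos_gauss /xsin_gauss /GRing.scale /=; ring.
have cc : continuous (fun x : R => a * x + c).
  move=> x; apply: differentiable_continuous; apply/derivable1_diffP.
  by apply: ex_derive; exact: is_derive_aff.
have cg : continuous g by exact: continuous_gauss_fun.
have cH' : continuous H'.
  move=> x; apply: cvgB; apply: cvgM; try exact: cvg_cst.
    apply: cvgM; last exact: cg.
    apply: continuous_comp; [exact: cc | exact: continuous_cos].
  apply: cvgM; last exact: cg.
  apply: cvgM; first exact: cvg_id.
  apply: continuous_comp; [exact: cc | exact: continuous_sin].
have i1 : mu.-integrable setT (EFin \o (fun x => a * cos_gauss a x)).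
  exact: (integrableZl _ a (integrable_cos_gauss a)).
have i2 : mu.-integrable setT (EFin \o (fun x => 2 * xsin_gauss a x)).
  exact: (integrableZl _ 2 (int_xsin a)).
have iH' : mu.-integrable setT (EFin \o (H' : measurableTypeR R -> R)).
  exact: (integrableB _ i1 i2).
have RH' : \int[mu]_x (H' : measurableTypeR R -> R) x = a * gauss_cos a - 2 * gauss_xsin a.
  rewrite RintegralB //; congr (_ - _).
    by rewrite RintegralZl //; exact: integrable_cos_gauss.
  by rewrite RintegralZl //; exact: int_xsin.
suff : \int[mu]_x (H' : measurableTypeR R -> R) x = 0 by rewrite RH'; lra.
have h := cvg_integral_segments iH'.
rewrite -(fineK (integrable_fin_num measurableT iH')) in h.
move/fine_cvg: h => /cvg_lim h.
rewrite -[LHS]h //; apply/cvg_lim => //.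
have gc : (fun n : nat => g n%:R) @ \oo --> (0 : R).
  apply: (cvg_comp (fun n : nat => n%:R) g); last exact: cvg_gauss_fun.
  exact: cvgr_idn.
apply/cvgr0Pnorm_le => e e0.
have /cvgr0Pnorm_le/(_ (e / 2)) := gc; rewrite divr_gt0 // => /(_ isT) hg.
near=> n.
have n0 : (0 < n)%N by near: n; exists 1%N.
rewrite /= (integral_primitive _ dH cH') /=; last by rewrite gtrN // ltr0n.
have hn : g n%:R <= e / 2.
  have : `|g n%:R| <= e / 2 by near: n.
  by rewrite ger0_norm // gauss_fun_ge0.
have gN : g (- n%:R) = g n%:R by rewrite /gauss_fun sqrrN.
rewrite /H gN -mulrBl normrM (ger0_norm (gauss_fun_ge0 _)).
apply: le_trans (_ : 2 * g n%:R <= _); last by lra.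
apply: ler_wpM2r; first exact: gauss_fun_ge0.
apply: le_trans (ler_normB _ _) _.
have := sin_max (a * n%:R + c); have := sin_max (a * - n%:R + c); lra.
Unshelve. all: by end_near. Qed.

(** The two preceding lemmas give [y' = - (a / 2) y], so [y * exp(a^2 / 4)] is constant; at [a = 0]
    it is the Gaussian integral. *)
Lemma gauss_cosE a : gauss_cos a = Num.sqrt pi * cos c * expR (- (a ^+ 2 / 4)).
Proof.
pose K (b : R) := gauss_cos b * expR (b * b / 4).
have dK b : is_derive b (1 : R) K 0.
  have h0 : is_derive b (1 : R) (fun y : R => y * y / 4) (b / 2).
    have hi := is_derive_id b (1 : R).
    have hh := @is_deriveM R R _ _ b 1 _ _ hi hi.
    have := @is_deriveZ _ _ _ _ (4^-1 : R) b 1 _ hh.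
    rewrite (_ : (4^-1 \*: _) = (fun y : R => y * y / 4)); last first.
      apply/funext => y; rewrite [RHS]mulrC; reflexivity.
    rewrite (_ : _ *: _ = b / 2) //.
    by rewrite /GRing.scale /=; field.
  have h2 := @is_derive1_comp R expR _ b _ _ (is_derive_expR _) h0.
  have := @is_deriveM R R _ _ b 1 _ _ (gauss_cos_derive b) h2.
  rewrite (_ : _ + _ = 0) //.
  by rewrite gauss_xsinE /GRing.scale /=; field.
have K0 : K a = K 0 by apply: is_derive_0_is_cst.
have G0 : gauss_cos 0 = Num.sqrt pi * cos c.
  rewrite /gauss_cos.
  under eq_Rintegral do rewrite /cos_gauss mul0r add0r.
  by rewrite RintegralZl //= /Rintegral ?integralT_gauss ?integrableT_gauss //= mulrC.
have : K a = Num.sqrt pi * cos c by rewrite K0 /K G0 mul0r mul0r expR0 mulr1.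
rewrite /K => <-; rewrite -[RHS]mulrA -expRD expr2.
by rewrite subrr expR0 mulr1.
Qed.

End gaussian_fourier.

Section normal_fourier.
Context (R : realType).

Lemma normal_pdf_gauss (x : R) :
  normal_pdf 0 (Num.sqrt 2^-1) x = (Num.sqrt pi)^-1 * gauss_fun x.
Proof.
have s0 : Num.sqrt 2^-1 != 0 :> R by rewrite gt_eqF // sqrtr_gt0 invr_gt0.
rewrite normal_pdfE // /normal_peak /normal_fun /gauss_fun subr0 sqr_sqrtr ?invr_ge0 //.
congr (_^-1 * _); first by congr Num.sqrt; rewrite -mulr_natr; field.
by congr expR; rewrite -mulr_natr mulVf // divr1.
Qed.

Lemma Ex_normal_cos (a c : R) :
  Ex (normal_prob (0 : R) (Num.sqrt 2^-1)) (fun x : measurableTypeR R => cos (a * x + c)) =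
  cos c * expR (- (a ^+ 2 / 4)).
Proof.
have hb : bmeas (fun x : measurableTypeR R => cos (a * x + c)).
  by apply: bmeas_cos; apply: measurable_funD => //; exact: (@measurable_funM _ _ R).
rewrite /Ex integral_normal_prob; last exact: bmeas_integrable.
have -> : (\int[lebesgue_measure]_x ((cos (a * x + c))%:E *
   (normal_pdf 0 (Num.sqrt 2^-1) x)%:E))%E =
   (\int[lebesgue_measure]_x ((Num.sqrt pi)^-1 * (cos (a * x + c) * gauss_fun x))%:E)%E.
  apply: eq_integral => x _; rewrite normal_pdf_gauss -EFinM; congr EFin; ring.
rewrite -[LHS]/(\int[lebesgue_measure]_x
  ((Num.sqrt pi)^-1 * (cos (a * x + c) * gauss_fun x))).
rewrite RintegralZl //; last exact: integrable_cos_gauss.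
rewrite -[\int[_]_x _]/(gauss_cos c a) gauss_cosE !mulrA mulVf ?mul1r //.
by rewrite gt_eqF // sqrtr_gt0 pi_gt0.
Qed.

End normal_fourier.

(** The cosine of the sum splits by the addition formula; sines are cosines shifted by [pi / 2], and
    the product of sines has mean zero because one of its phases is [- pi / 2]. *)
Lemma Ex_complex_normal (R : realType) (d : measure_display) (T : measurableType d)
    (P : probability T R) (W : T -> R[i]) (a b c : R) : std_complex_normal P W ->
  Ex P (fun t => cos (a * (ReIm (W t)).1 + b * (ReIm (W t)).2 + c)) =
  cos c * expR (- ((a ^+ 2 + b ^+ 2) / 4)).
Proof.
move=> [X [Y [WE lX lY iXY]]].
have mX := @measurable_funPT _ _ _ _ X.
have mY := @measurable_funPT _ _ _ _ Y.
have bc u v : bmeas (fun x : R => cos (u * x + v)).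
  by apply: bmeas_cos; apply: measurable_funD.
have law (Z : {RV P >-> R}) u v : (forall A, measurable A ->
    distribution P Z A = normal_prob 0 (Num.sqrt 2^-1) A) ->
    Ex P (fun t => cos (u * Z t + v)) = cos v * expR (- (u ^+ 2 / 4)).
  move=> lZ; rewrite -Ex_normal_cos; have mZ := @measurable_funPT _ _ _ _ Z.
  apply: (@Ex_same_law R _ _ _ T (measurableTypeR R) (measurableTypeR R) P _ Z id
     (fun x => cos (u * x + v))) => //.
  exact: bc.
have ind u v u' v' : Ex P (fun t => cos (u * X t + v) * cos (u' * Y t + v')) =
    cos v * cos v' * expR (- ((u ^+ 2 + u' ^+ 2) / 4)).
  rewrite (@Ex_mul_indep R _ _ _ T _ _ P X Y (fun x => cos (u * x + v))
     (fun y => cos (u' * y + v'))) //.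
  by rewrite !law // mulrACA -expRD; congr (_ * expR _); field.
have -> : Ex P (fun t => cos (a * (ReIm (W t)).1 + b * (ReIm (W t)).2 + c)) =
    Ex P (fun t => cos (a * X t + c) * cos (b * Y t + 0) -
      cos (a * X t + (c - pi / 2)) * cos (b * Y t + (0 - pi / 2))).
  apply: eq_Ex => t; rewrite WE /= addr0 sub0r addrA cosBpihalf.
  have -> : b * Y t + - (pi / 2) = b * Y t - pi / 2 by [].
  by rewrite cosBpihalf -cosD; congr cos; ring.
rewrite ExB; first last.
- by apply: bmeasM; apply: bmeas_cos; apply: measurable_funD => //; apply: measurable_funM.
- by apply: bmeasM; apply: bmeas_cos; apply: measurable_funD => //; apply: measurable_funM.
rewrite !ind cos0 mulr1 sub0r cosN cos_pihalf mulr0 mul0r subr0 //.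
Qed.

(** * From the Diophantine condition to phase gaps *)

Section diophantine_gap.
Context (R : realType).

Lemma expi_2pi : expi (2 * pi) = 1 :> R[i].
Proof. by rewrite /expi mulr_natl cos2pi sin2pi. Qed.

Lemma expi_2pi_int (m : int) : expi (2 * pi * m%:~R) = 1 :> R[i].
Proof.
have hn (n : nat) : expi (2 * pi * n%:R) = 1 :> R[i].
  by rewrite mulrC -expiX expi_2pi expr1n.
case: (intP m) => [|n|n]; first by rewrite mulr0 expi0.
  exact: (hn n.+1).
have := expiD (2 * pi * n.+1%:R) (2 * pi * (- n.+1%:Z)%:~R : R).
by rewrite hn mul1r => <-; rewrite mulrNz mulrN subrr expi0.
Qed.

Lemma cabs_one_sub_expi (z : R) : cabs (1 - expi (2 * z)) = 2 * `|sin z|.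
Proof.
apply: (@pexpIrn _ 2) => //; rewrite ?nnegrE ?cabs_ge0 ?mulr_ge0 //.
rewrite cabs_sqr exprMn real_normK ?num_real // /expi /=.
have h := cos2Dsin2 z; have h2 : cos (2 * z) = 1 - 2 * sin z ^+ 2.
  by rewrite mulr_natl cos_mulr2n; lra.
have := cos2Dsin2 (2 * z); rewrite h2; lra.
Qed.

(** Subtract the nearest integer [m]; then [|1 - exp(2 i z)| = 2 |sin z|] with [|z| <= pi / 2], and
    [sin_expanding] at [x = 0] bounds the sine from below. *)
Lemma expi_gap : exists2 k : R, 0 < k &
  forall x : R, k * dist_int x <= cabs (1 - expi (2 * pi * x)).
Proof.
have [k k0 hk] := @sin_expanding R; exists k => // x.
pose m := Num.floor (x + 2^-1).
pose z := pi * (x - m%:~R).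
have m1 : m%:~R <= x + 2^-1 by exact: floor_le_tmp.
have m2 : x + 2^-1 < m%:~R + 1.
  have := floorD1_gt (x + 2^-1); by rewrite intrD.
have hx : `|x - m%:~R| <= 2^-1 by rewrite ler_norml; apply/andP; split; lra.
have -> : expi (2 * pi * x) = expi (2 * z) :> R[i].
  rewrite -[RHS]mulr1 -(expi_2pi_int m) -expiD; congr expi; rewrite /z; ring.
rewrite cabs_one_sub_expi.
have pi0 := @pi_gt0 R.
have hz : `|z| <= pi / 2 by rewrite /z normrM (gtr0_norm pi0) ler_pM2l.
have n0 : `|0 : R| <= 1 by rewrite normr0.
have := hk 0 z n0 hz; rewrite sub0r normrN sin0 sub0r normrN.
have hd : dist_int x <= `|x - m%:~R|.
  apply: ge_inf; last by exists m.
  by exists 0 => _ [n _ <-].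
have hz2 : `|x - m%:~R| <= `|z|.
  rewrite /z normrM (gtr0_norm pi0) ler_peMl //.
  by have := @pi_ge2 R; lra.
have := ler_wpM2l (ltW k0) hd; have := ler_wpM2l (ltW k0) hz2.
have : 0 <= `|sin z| by [].
lra.
Qed.

Lemma expR1_le4 : expR 1 <= 4 :> R.
Proof.
have h := @expR_ge1Dx R (- 2^-1).
have h2 : expR (2^-1) <= 2 :> R.
  rewrite -[2^-1]opprK expRN -[X in _ <= X]invrK lef_pV2 ?posrE ?expR_gt0 //.
  by apply: le_trans h; lra.
have -> : (1 : R) = 2^-1 + 2^-1 by field.
rewrite expRD; have := @expR_ge0 R (2^-1).
by move=> h3; apply: le_trans (ler_pM h3 h3 h2 h2) _; lra.
Qed.

Lemma expR_nat_le (n : nat) : expR n%:R <= (4 ^ n)%:R :> R.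
Proof.
elim: n => [|n IH]; first by rewrite expR0 expn0.
rewrite -natr1 expRD expnS natrM mulrC.
by apply: ler_pM; rewrite ?expR_ge0 // ?expR1_le4.
Qed.

(** The only use of the exponent [1/50]: [150 / 50 = 3] is the degree of [l] in [lam]. *)
Lemma root50 (q lam : nat) : (q <= lam ^ 150)%N ->
  (q%:R : R) `^ 50%:R^-1 <= (lam ^ 3)%:R.
Proof.
move=> h; apply: le_trans (_ : ((lam ^ 3)%:R ^+ 50 : R) `^ 50%:R^-1 <= _).
  apply: ge0_ler_powR; rewrite ?nnegrE ?invr_ge0 ?exprn_ge0 //.
  by rewrite -natrX ler_nat -expnM.
rewrite -powR_mulrn // -powRrM mulfV ?powRr1 // pnatr_eq0 //.
Qed.

(** The exponent [l] pays for the saving [2 ^ (2 * lam)] and for [exp(lam^3) <= 2 ^ (2 * lam^3)];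
    the rest, at least [lam], absorbs the constants. *)
Lemma gap_exponents (lam : nat) : (2 <= lam)%N ->
  (4 * lam ^ 3 = 2 * lam + 2 * lam ^ 3 + 2 * (lam ^ 3 - lam))%N /\
  (lam <= 2 * (lam ^ 3 - lam))%N.
Proof.
move=> lam2; have : (2 * 2 * lam <= lam ^ 3)%N.
  by rewrite !expnS expn0 muln1 mulnA; apply: leq_mul => //; apply: leq_mul.
by move: (lam ^ 3)%N => z; lia.
Qed.

Lemma phase_gap_large (theta C : R) : 0 < C ->
  (forall q : nat, (0 < q)%N ->
     C * expR (- (q%:R `^ 50%:R^-1)) <= dist_int (q%:R * theta)) ->
  \forall lam \near \oo, forall q : nat, (0 < q <= (lam ^ 75) ^ 2)%N ->
    8 * (2 ^ (2 * lam))%:R / (2 ^ (4 * lam ^ 3))%:R <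
    phase_gap (fun n => expi (2 * pi * n%:R * theta)) q.
Proof.
move=> C0 hC; have [k k0 hk] := expi_gap.
have kC : 0 < k * C by rewrite mulr_gt0.
near=> lam => q /andP[q0 qD].
have lam2 : (2 <= lam)%N by near: lam; exists 2%N.
have hlam : 8 / (k * C) < lam%:R.
  near: lam; exists (Num.truncn (8 / (k * C))).+1 => // n /= hn.
  by apply: lt_le_trans (truncnS_gt _) _; rewrite ler_nat.
have q150 : (q <= lam ^ 150)%N by rewrite -expnM in qD.
have h1 : k * (C * expR (- (lam ^ 3)%:R)) <=
    phase_gap (fun n => expi (2 * pi * n%:R * theta)) q.
  rewrite /phase_gap -[2 * pi * q%:R * theta]mulrA; apply: le_trans (hk _).
  rewrite ler_pM2l //; apply: le_trans (hC _ q0); rewrite ler_pM2l // ler_expR lerN2.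
  exact: root50.
apply: lt_le_trans h1; rewrite mulrA expRN ltr_pdivlMr ?expR_gt0 //.
rewrite mulrAC ltr_pdivrMr ?ltr0n ?expn_gt0 //.
have hE := expR_nat_le (lam ^ 3).
apply: le_lt_trans (_ : 8 * (2 ^ (2 * lam))%:R * (4 ^ lam ^ 3)%:R < _).
  by rewrite ler_wpM2l // mulr_ge0.
have -> : (4 ^ lam ^ 3 = 2 ^ (2 * lam ^ 3))%N by rewrite expnM.
have [hex hge] := gap_exponents lam2.
rewrite hex expnD natrM expnD natrM.
have -> x y z : k * C * (x * y * z) = (k * C * z) * x * y :> R by ring.
rewrite !ltr_pM2r ?ltr0n ?expn_gt0 //.
rewrite mulrC -ltr_pdivrMr // .
apply: lt_le_trans hlam _; rewrite ler_nat.
apply: leq_trans (ltnW (ltn_expl lam (isT : 1 < 2)%N)) _.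
by rewrite leq_exp2l.
Unshelve. all: by end_near. Qed.

End diophantine_gap.

(** * Explicit rates in terms of [lam] *)

Section error_rates.
Context (R : realType).

(** Apply [q < 2 ^ q] to the quotient [q] of [n] by the degree, and raise to that degree. *)
Lemma power_le_exponential (k : nat) :
  exists2 K : R, 0 <= K & forall n : nat, n%:R ^+ k <= K * (2 ^ n)%:R.
Proof.
case: k => [|k]; first by exists 1 => // n; rewrite expr0 mul1r ler1n expn_gt0.
exists (k.+1%:R ^+ k.+1) => [|n]; first exact: exprn_ge0.
pose q := (n %/ k.+1)%N.
apply: le_trans (_ : (k.+1%:R * (2 ^ q)%:R) ^+ k.+1 <= _).
  rewrite ler_pXn2r ?nnegrE ?mulr_ge0 // -natrM ler_nat mulnC.
  apply: ltnW; apply: leq_trans (ltn_ceil n (ltn0Sn k)) _.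
  by rewrite leq_mul2r ltn_expl ?orbT.
rewrite exprMn ler_wpM2l ?exprn_ge0 // -natrX -expnM ler_nat leq_exp2l //.
exact: leq_trunc_div.
Qed.

Lemma power_exp_rate (k : nat) : exists2 K : R, 0 <= K &
  forall n : nat, (0 < n)%N -> n%:R ^+ k / (2 ^ n)%:R <= K / n%:R.
Proof.
have [K K0 hK] := power_le_exponential k.+1; exists K => // n n0.
rewrite ler_pdivrMr ?ltr0n ?expn_gt0 // mulrAC ler_pdivlMr ?ltr0n // -exprSr.
exact: hK.
Qed.

Lemma inv_pow2_rate (m n : nat) : (0 < n <= m)%N -> (2 ^ m)%:R^-1 <= n%:R^-1 :> R.
Proof.
move=> /andP[n0 nm]; rewrite lef_pV2 ?posrE ?ltr0n ?expn_gt0 // ler_nat.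
apply: leq_trans nm _; exact/ltnW/ltn_expl.
Qed.

Context (lam N : nat).
Hypothesis lam5 : (5 <= lam)%N.
Hypothesis N_ge : (2 ^ (lam ^ 12) <= N)%N.
Hypothesis N_lt : (N < 2 ^ ((lam + 1) ^ 12))%N.
Local Notation l := (4 * lam ^ 3)%N.
Local Notation J := ((lam + 1) ^ 12)%N.

Let lam0 : (0 < lam)%N. Proof. exact: leq_trans lam5. Qed.
Let lamR : (0 : R) < lam%:R. Proof. by rewrite ltr0n. Qed.
Let N0 : (0 < N)%N. Proof. by apply: leq_trans N_ge; rewrite expn_gt0. Qed.
Let NR : (0 : R) < N%:R. Proof. by rewrite ltr0n. Qed.

Let lam_l : (lam <= l)%N.
Proof.
apply: leq_trans (_ : lam ^ 3 <= _)%N; last by move: (lam ^ 3)%N => z; lia.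
by rewrite -{1}[lam]expn1 leq_exp2l // (leq_trans _ lam5).
Qed.

(** The choice [t = lam^8] gives [l * t = 4 * lam^11], well below [lam^12] once [5 <= lam], and
    [l / t] of order [lam^-5]. *)
Lemma exceptional_rate :
  N%:R^-1 * \sum_(n < N.+1 | (0 < n)%N) (1 - (multiplicity N l n)%:R) <=
  13 / lam%:R :> R.
Proof.
have l0 : (0 < l)%N by apply: leq_trans lam_l.
have t0 : (0 < lam ^ 8)%N by rewrite expn_gt0 lam0.
apply: le_trans (ler_wpM2l _ (exceptional_bound R N l0 t0)) _.
  by rewrite invr_ge0 ltW.
rewrite !mulrDr.
have h1 : N%:R^-1 * (2 ^ (l * lam ^ 8))%:R <= lam%:R^-1 :> R.
  rewrite mulrC ler_pdivrMr // mulrC ler_pdivlMr // -natrM ler_nat.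
  apply: leq_trans N_ge.
  apply: leq_trans (_ : 2 ^ (l * lam ^ 8) * 2 ^ lam <= _)%N.
    by rewrite leq_mul2l (ltnW (ltn_expl lam _)) ?orbT.
  rewrite -expnD leq_exp2l // -mulnA -expnD.
  apply: leq_trans (_ : 5 * lam ^ 11 <= _)%N; last first.
    by rewrite [(lam ^ 12)%N]expnS leq_mul2r lam5 orbT.
  have : (lam <= lam ^ (3 + 8))%N.
    by rewrite -{1}[lam]expn1 leq_exp2l // (leq_trans _ lam5).
  by rewrite (_ : 3 + 8 = 11)%N //; move: (lam ^ 11)%N => z; lia.
have h2 : N%:R^-1 * (2 * N%:R * l.+1%:R / (lam ^ 8)%:R) <= 10 / lam%:R :> R.
  have -> : N%:R^-1 * (2 * N%:R * l.+1%:R / (lam ^ 8)%:R) =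
     2 * l.+1%:R / (lam ^ 8)%:R :> R.
    by field; rewrite !gt_eqF // ltr0n.
  rewrite ler_pdivrMr ?ltr0n // mulrAC ler_pdivlMr //.
  rewrite -!natrM ler_nat.
  have h3 : (0 < lam ^ 3)%N by rewrite expn_gt0 lam0.
  have h4 : (lam ^ 3 * lam <= lam ^ 8)%N.
    by rewrite -expnSr leq_exp2l // (leq_trans _ lam5).
  apply: leq_trans (_ : 10 * (lam ^ 3 * lam) <= _)%N; last first.
    by rewrite leq_mul2l h4 orbT.
  rewrite mulnA leq_mul2r; apply/orP; right.
  by move: (lam ^ 3)%N h3 => z; lia.
have h3 : N%:R^-1 * (2 * N%:R / (2 ^ l)%:R) <= 2 / lam%:R :> R.
  have -> : N%:R^-1 * (2 * N%:R / (2 ^ l)%:R) = 2 * (2 ^ l)%:R^-1 :> R.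
    field; rewrite !gt_eqF // ltr0n expn_gt0 //.
  by rewrite ler_pM2l // inv_pow2_rate // lam0.
apply: le_trans (lerD (lerD h1 h2) h3) _.
lra.
Qed.

End error_rates.

Section uniform_rates.
Context (R : realType).

Lemma fourth_moment_rate : exists K : R, forall lam : nat, (5 <= lam)%N ->
  4 * ((lam + 1) ^ 12)%:R / (2 ^ (4 * lam ^ 3))%:R <= K / lam%:R.
Proof.
have [K K0 hK] := power_exp_rate R 12; pose c : R := 2 ^+ 12; have c0 : 0 < c by rewrite exprn_gt0.
exists (4 * c * K) => lam lam5.
have lam0 : (0 < lam)%N by apply: leq_trans lam5.
have hJ : ((lam + 1) ^ 12)%:R <= c * lam%:R ^+ 12 :> R.
  by rewrite /c -exprMn natrX ler_pXn2r ?nnegrE ?mulr_ge0 // -natrM ler_nat; lia.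
have hl : (2 ^ (4 * lam ^ 3))%:R^-1 <= (2 ^ lam)%:R^-1 :> R.
  rewrite lef_pV2 ?posrE ?ltr0n ?expn_gt0 // ler_nat leq_exp2l //.
  apply: leq_trans (_ : lam ^ 3 <= _)%N; last by move: (lam ^ 3)%N => z; lia.
  by rewrite -{1}[lam]expn1 leq_exp2l // (leq_trans _ lam5).
have h2 : 4 * ((lam + 1) ^ 12)%:R <= 4 * (c * lam%:R ^+ 12) :> R by rewrite ler_pM2l.
apply: le_trans (ler_pM _ _ h2 hl) _; rewrite ?mulr_ge0 ?invr_ge0 //.
apply: le_trans (_ : 4 * c * (lam%:R ^+ 12 / (2 ^ lam)%:R) <= _); first by rewrite !mulrA.
rewrite -[X in _ <= X]mulrA ler_pM2l ?mulr_gt0 //; exact: hK.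
Qed.

(** The loss [J^3], of order [lam^36], is beaten by [D0 = lam^75] and by [2 ^ (2 * lam)]. The blocks
    near the top give [(2 * lam)^2 / (4 * lam^3) = 1 / lam], which is why [l] is cubic. *)
Lemma off_diagonal_rate : exists K : R, forall lam : nat, (5 <= lam)%N ->
  2 * (8 * ((lam + 1) ^ 12)%:R ^+ 3 * ((2 ^ (2 * lam))%:R^-1 + (lam ^ 75)%:R^-1) +
       128 * (2 * lam)%:R ^+ 2 / (4 * lam ^ 3)%:R) <= K / lam%:R.
Proof.
have [K K0 hK] := power_exp_rate R 36.
pose c : R := 2 ^+ 36; have c0 : 0 < c by rewrite exprn_gt0.
exists (16 * c * (K + 1) + 256) => lam lam5.
have lam0 : (0 < lam)%N by apply: leq_trans lam5.
have lamR : (0 : R) < lam%:R by rewrite ltr0n.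
have hJ : ((lam + 1) ^ 12)%:R ^+ 3 <= c * lam%:R ^+ 36 :> R.
  rewrite /c -exprMn natrX -exprM ler_pXn2r ?nnegrE ?mulr_ge0 // -natrM ler_nat; lia.
have h1 : ((lam + 1) ^ 12)%:R ^+ 3 * (2 ^ (2 * lam))%:R^-1 <= c * (K / lam%:R) :> R.
  have hl : (2 ^ (2 * lam))%:R^-1 <= (2 ^ lam)%:R^-1 :> R.
    by rewrite lef_pV2 ?posrE ?ltr0n ?expn_gt0 // ler_nat leq_exp2l //; lia.
  apply: le_trans (ler_pM _ _ hJ hl) _; rewrite ?exprn_ge0 ?invr_ge0 //.
  by rewrite -mulrA ler_pM2l //; exact: hK.
have h2 : ((lam + 1) ^ 12)%:R ^+ 3 * (lam ^ 75)%:R^-1 <= c * lam%:R^-1 :> R.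
  apply: le_trans (ler_wpM2r _ hJ) _; first by rewrite invr_ge0.
  rewrite -mulrA ler_pM2l // natrX ler_pdivrMr ?exprn_gt0 // mulrC ler_pdivlMr //.
  by rewrite -exprSr ler_weXn2l // ler1n.
have h3 : 128 * (2 * lam)%:R ^+ 2 / (4 * lam ^ 3)%:R = 128 / lam%:R :> R.
  by rewrite [(4 * _)%:R]natrM natrX [(2 * lam)%:R]natrM; field; rewrite gt_eqF.
rewrite h3; move: h1 h2.
move: (((lam + 1) ^ 12)%:R ^+ 3) ((2 ^ (2 * lam))%:R^-1) ((lam ^ 75)%:R^-1) => x y z.
lra.
Qed.

End uniform_rates.

(** * From moment bounds to a bound on cosine expectations *)

Section central_limit_bound.
Context (R : realType) (d : measure_display) (T : measurableType d).
Variables (P : probability T R) (f : nat -> T -> R[i]).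
Hypothesis f_steinhaus : steinhaus P f.
Context (e : nat -> R[i]).
Context (N l : nat) (w : R[i]) (c0 eps : R).
Hypothesis eps_gt0 : 0 < eps.
Hypothesis eps_le1 : eps <= 1.
Local Notation F := (unit_version f).
Local Notation c := (real_complex R).
Local Notation A := (coefficient f e N).
Local Notation V := (total_variance f e N l).
Local Notation rem := (remainder f e N l).
Hypothesis fourth : \sum_(p < N.+1 | large_prime l p)
   Ex P (fun t => cabs (A p t) ^+ 4) <= eps ^+ 2.
Hypothesis variance : Ex P (fun t => (V t - 1) ^+ 2) <= eps ^+ 2.
Hypothesis rem_small : Ex P (fun t => cabs (rem t) ^+ 2) <= eps ^+ 2.

(** Stands in for Cauchy-Schwarz: if [E X^2 <= eps^2], taking expectations gives [E |X| <= eps]. *)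
Let am_gm (x : R) : `|x| <= (eps + x ^+ 2 / eps) / 2.
Proof.
rewrite -(real_normK (num_real x)); have x0 : 0 <= `|x| by [].
move: `|x| x0 => y y0.
have := sqr_ge0 (y - eps); rewrite sqrrB => h.
have -> : (eps + y ^+ 2 / eps) / 2 = (eps ^+ 2 + y ^+ 2) / (2 * eps).
  by field; rewrite gt_eqF.
by rewrite ler_pdivlMr ?mulr_gt0 //; lra.
Qed.

(** Third moments are interpolated between second moments, whose sum is bounded, and fourth moments,
    whose sum is at most [eps^2]. *)
Let am_gm3 (x : R) : 0 <= x -> x ^+ 3 <= (eps * x ^+ 2 + x ^+ 4 / eps) / 2.
Proof.
move=> x0; have := ler_wpM2l (sqr_ge0 x) (am_gm x); rewrite ger0_norm // -exprSr.
by move=> /le_trans; apply; rewrite le_eqVlt; apply/orP; left; apply/eqP; ring.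
Qed.

Let bA p : cbmeas (A p). Proof. exact: (coefficient_cbmeas f_steinhaus). Qed.
Let bA2 p : bmeas (fun t => cabs (A p t) ^+ 2). Proof. exact: (bmeas_cabs_sqr (bA p)). Qed.
Let bA4 p : bmeas (fun t => cabs (A p t) ^+ 4).
Proof. by have := bmeasX 2 (bA2 p); under eq_fun do rewrite -exprM. Qed.

Let bV : bmeas V.
Proof. by apply: bmeas_sum => p _; exact: bA2. Qed.

Let EV : Ex P V <= 2 + eps ^+ 2.
Proof.
have b1 := bmeasX 2 (bmeasB bV (bmeas_cst T 1)).
have h t : V t <= 2 + (V t - 1) ^+ 2 by have := sqr_ge0 (V t - 1 - 2^-1); nra.
apply: le_trans (Ex_le P bV (bmeasD (bmeas_cst T 2) b1) h) _.
by rewrite ExD ?Ex_cst ?lerD2l //; exact: bmeas_cst.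
Qed.

Let brem : cbmeas rem.
Proof.
apply: cbmeasM; first exact: cbmeas_cst.
apply: cbmeas_sum => n n0; apply: cbmeasM; first exact: cbmeas_cst.
exact: (cbmeas_unit_version f_steinhaus n0).
Qed.

Let a : R := cabs w.
Let a0 : 0 <= a. Proof. exact: cabs_ge0. Qed.

Let Lpr p : large_prime l p -> prime p. Proof. by case/andP. Qed.
Let Aad p : large_prime l p -> cadapted f p (A p).
Proof. by move=> _; exact: coefficient_adapted. Qed.

Let step_le p : large_prime l p -> Ex P (step_error f A w p) <=
  (a ^+ 4 / 4 + a ^+ 3 / (4 * eps)) * Ex P (fun t => cabs (A p t) ^+ 4) +
  a ^+ 3 * eps / 4 * Ex P (fun t => cabs (A p t) ^+ 2).
Proof.
move=> Lp; rewrite -(ExZ _ _ (bA4 p)) -(ExZ _ _ (bA2 p)).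
rewrite -(ExD _ (bmeasZ _ (bA4 p)) (bmeasZ _ (bA2 p))).
apply: Ex_le.
- exact: (step_error_bmeas f_steinhaus Lpr Aad).
- by apply: bmeasD; exact: bmeasZ.
move=> t; rewrite /step_error /quadratic /increment.
have hu : `|complex.Re (w * A p t * F p t)| <= a * cabs (A p t).
  apply: le_trans (normr_Re_le _) _.
  by rewrite !cabsM cabs_unit_version mulr1.
rewrite cabsM -/a; move: (complex.Re _) hu => u hu.
have x0 := cabs_ge0 (A p t); move: (cabs (A p t)) x0 hu => x x0 hu.
have ax : 0 <= a * x by rewrite mulr_ge0.
have h4 : u ^+ 4 <= a ^+ 4 * x ^+ 4.
  have -> : u ^+ 4 = `|u| ^+ 4 by rewrite -normrX ger0_norm // exprn_even_ge0.
  by rewrite -exprMn ler_pXn2r ?nnegrE.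
have h3 : `|u| ^+ 3 <= a ^+ 3 * x ^+ 3 by rewrite -exprMn ler_pXn2r ?nnegrE.
have h5 := ler_wpM2l (exprn_ge0 3 a0) (am_gm3 x0).
have -> : ((a * x) ^+ 2 / 2) ^+ 2 / 4 = a ^+ 4 * x ^+ 4 / 16 by field.
have -> : (a ^+ 4 / 4 + a ^+ 3 / (4 * eps)) * x ^+ 4 + a ^+ 3 * eps / 4 * x ^+ 2 =
   a ^+ 4 * x ^+ 4 / 4 + a ^+ 3 * ((eps * x ^+ 2 + x ^+ 4 / eps) / 2) / 2.
  by field; rewrite gt_eqF.
have h6 : 0 <= a ^+ 4 * x ^+ 4 by rewrite mulr_ge0 // exprn_ge0.
lra.
Qed.

Let sum_step : \sum_(p < N.+1 | large_prime l p) Ex P (step_error f A w p) <=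
  (a ^+ 4 + a ^+ 3) * eps.
Proof.
apply: le_trans (ler_sum _ (fun (p : 'I_N.+1) Lp => step_le Lp)) _.
rewrite big_split /= -!mulr_sumr.
have -> : \sum_(p < N.+1 | large_prime l p) Ex P (fun t => cabs (A p t) ^+ 2) = Ex P V.
  by symmetry; apply: Ex_sum => p _; exact: bA2.
have p4 := exprn_ge0 4 a0; have p3 := exprn_ge0 3 a0.
have h1 : (a ^+ 4 / 4 + a ^+ 3 / (4 * eps)) *
    \sum_(p < N.+1 | large_prime l p) Ex P (fun t => cabs (A p t) ^+ 4) <=
    a ^+ 4 / 4 * eps ^+ 2 + a ^+ 3 * eps / 4.
  apply: le_trans (ler_wpM2l _ fourth) _.
    by rewrite addr_ge0 // divr_ge0 // mulr_ge0 // ltW.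
  by rewrite le_eqVlt; apply/orP; left; apply/eqP; field; rewrite gt_eqF.
have h2 : a ^+ 3 * eps / 4 * Ex P V <= a ^+ 3 * eps / 4 * 3.
  apply: ler_wpM2l; first by rewrite divr_ge0 // mulr_ge0 // ltW.
  apply: le_trans EV _; have : eps ^+ 2 <= 1 by rewrite expr_le1 // ltW.
  lra.
have h3 : a ^+ 4 * eps ^+ 2 <= a ^+ 4 * eps.
  by apply: ler_wpM2l => //; rewrite expr2 ler_piMr // ltW.
have h4 : 0 <= a ^+ 4 * eps by rewrite mulr_ge0 // ltW.
have h5 : 0 <= a ^+ 3 * eps by rewrite mulr_ge0 // ltW.
rewrite mulrDl; lra.
Qed.

Let clock_le : Ex P (fun t => `|clock (large_prime l) A w N.+1 t - a ^+ 2 / 2|) / 2 <=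
  a ^+ 2 * eps.
Proof.
have cl t : clock (large_prime l) A w N.+1 t = a ^+ 2 / 2 * V t.
  rewrite /clock /total_variance mulr_sumr; apply: eq_bigr => p _.
  by rewrite /quadratic cabsM exprMn -/a; ring.
rewrite (@eq_Ex _ _ _ _ _ (fun t => a ^+ 2 / 2 * `|V t - 1|)); last first.
  move=> t; rewrite cl -{2}[a ^+ 2 / 2]mulr1 -mulrBr normrM ger0_norm //.
  by rewrite divr_ge0 // sqr_ge0.
have bV1 := bmeasB bV (bmeas_cst T 1).
rewrite ExZ; last exact: bmeas_norm.
have h : Ex P (fun t => `|V t - 1|) <= eps.
  have b2 := bmeasD (bmeas_cst T (eps / 2)) (bmeasZ (2 * eps)^-1 (bmeasX 2 bV1)).
  apply: le_trans (Ex_le P (bmeas_norm bV1) b2 _) _.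
    move=> t; apply: le_trans (am_gm _) _.
    by rewrite le_eqVlt; apply/orP; left; apply/eqP; field; rewrite gt_eqF.
  rewrite ExD ?Ex_cst ?ExZ; [|exact: bmeasX|exact: bmeas_cst|by apply: bmeasZ; exact: bmeasX].
  apply: le_trans (lerD (lexx _) (ler_wpM2l _ variance)) _.
    by rewrite invr_ge0 mulr_ge0 // ltW.
  by rewrite le_eqVlt; apply/orP; left; apply/eqP; field; rewrite gt_eqF.
have := ler_wpM2l (sqr_ge0 a) h; have : 0 <= a ^+ 2 * eps by rewrite mulr_ge0 ?sqr_ge0 // ltW.
lra.
Qed.

(** The linear form is the martingale plus a remainder, which a Lipschitz bound on the cosine
    removes at cost [a * eps]. *)
Lemma central_limit_bound :
  `|Ex P (fun t => cos (complex.Re (w * (c (scaling R N) *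
       \sum_(n < N.+1 | (0 < n)%N) e n * F n t)) + c0)) -
    cos c0 * expR (- (cabs w ^+ 2 / 4))| <= (a + a ^+ 2 + a ^+ 3 + a ^+ 4) * eps.
Proof.
have dec t : complex.Re (w * (c (scaling R N) * \sum_(n < N.+1 | (0 < n)%N) e n * F n t)) =
   partial f (large_prime l) A w N.+1 t + complex.Re (w * rem t).
  rewrite (decomposition f e N l t) mulrDr ReD; congr (_ + _).
  rewrite /partial mulr_sumr Re_sum; apply: eq_bigr => p _.
  by rewrite /increment; congr complex.Re; ring.
have bU := adapted_bmeas f_steinhaus (partial_adapted Lpr Aad w N.+1).
have bwr : cbmeas (fun t => w * rem t) by apply: cbmeasM => //; exact: cbmeas_cst.
have bRe : bmeas (fun t => complex.Re (w * rem t)) by case: bwr.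
have mclt := martingale_clt f_steinhaus Lpr Aad w c0 N.+1.
rewrite -/a in mclt.
have e1 : a ^+ 2 / 2 / 2 = a ^+ 2 / 4 by field.
rewrite e1 in mclt.
rewrite (@eq_Ex _ _ _ _ _ (fun t => cos (partial f (large_prime l) A w N.+1 t +
   complex.Re (w * rem t) + c0))); last by move=> t; rewrite dec.
have b1 : bmeas (fun t => cos (partial f (large_prime l) A w N.+1 t +
   complex.Re (w * rem t) + c0)).
  apply: bmeas_cos; apply: measurable_funD => //.
  by apply: measurable_funD; [case: bU | case: bRe].
have b2 : bmeas (fun t => cos (partial f (large_prime l) A w N.+1 t + c0)).
  by apply: bmeas_cos; apply: measurable_funD => //; case: bU.
have hrem : `|Ex P (fun t => cos (partial f (large_prime l) A w N.+1 t +
   complex.Re (w * rem t) + c0)) -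
   Ex P (fun t => cos (partial f (large_prime l) A w N.+1 t + c0))| <= a * eps.
  rewrite -ExB //; apply: le_trans (Ex_norm _ (bmeasB b1 b2)) _.
  have br2 := bmeas_cabs_sqr brem.
  have b3 := bmeasZ a (bmeasD (bmeas_cst T (eps / 2)) (bmeasZ (2 * eps)^-1 br2)).
  apply: le_trans (Ex_le P (bmeas_norm (bmeasB b1 b2)) b3 _) _.
    move=> t; apply: le_trans (cos_lipschitz _ _) _.
    rewrite opprD addrACA subrr addr0 addrC addKr.
    apply: le_trans (normr_Re_le _) _; rewrite cabsM -/a ler_wpM2l //.
    have := am_gm (cabs (rem t)); rewrite ger0_norm ?cabs_ge0 // => /le_trans; apply.
    by rewrite le_eqVlt; apply/orP; left; apply/eqP; field; rewrite gt_eqF.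
  rewrite ExZ; last by apply: bmeasD; [exact: bmeas_cst | exact: bmeasZ].
  rewrite ExD ?Ex_cst ?ExZ //; [|exact: bmeas_cst|exact: bmeasZ].
  apply: ler_wpM2l => //.
  apply: le_trans (lerD (lexx _) (ler_wpM2l _ rem_small)) _.
    by rewrite invr_ge0 mulr_ge0 // ltW.
  by rewrite le_eqVlt; apply/orP; left; apply/eqP; field; rewrite gt_eqF.
apply: le_trans (ler_distD (Ex P (fun t => cos (partial f (large_prime l) A w N.+1 t + c0))) _ _) _.
apply: le_trans (lerD hrem (le_trans mclt (lerD sum_step clock_le))) _.
by rewrite !mulrDl; lra.
Qed.

End central_limit_bound.

(** * Measurability, almost sure replacement and tightness of the normalized sum *)

Definition cmeasurable (R : realType) (d : measure_display) (T : measurableType d)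
    (Z : T -> R[i]) : Prop :=
  measurable_fun setT (fun t => complex.Re (Z t)) /\
  measurable_fun setT (fun t => complex.Im (Z t)).

Section complex_measurability.
Context (R : realType) (d : measure_display) (T : measurableType d).
Implicit Types Z Y : T -> R[i].

Lemma cmeasurable_cst z : cmeasurable (fun _ : T => z : R[i]).
Proof. by split; exact: measurable_cst. Qed.

Lemma cmeasurableD Z Y : cmeasurable Z -> cmeasurable Y ->
  cmeasurable (fun t => Z t + Y t).
Proof.
by move=> [a b] [a' b']; split; [under eq_fun do rewrite ReD|under eq_fun do rewrite ImD];
  exact: measurable_funD.
Qed.

Lemma cmeasurableM Z Y : cmeasurable Z -> cmeasurable Y ->
  cmeasurable (fun t => Z t * Y t).
Proof.
move=> [a b] [a' b']; split.
  by under eq_fun do rewrite ReM; apply: measurable_funB; exact: measurable_funM.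
by under eq_fun do rewrite ImM; apply: measurable_funD; exact: measurable_funM.
Qed.

Lemma cmeasurable_sum (I : Type) (s : seq I) (Q : pred I) (Z : I -> T -> R[i]) :
  (forall i, Q i -> cmeasurable (Z i)) ->
  cmeasurable (fun t => \sum_(i <- s | Q i) Z i t).
Proof.
move=> h; elim: s => [|i s IH].
  by under eq_fun do rewrite big_nil; exact: cmeasurable_cst.
under eq_fun do rewrite big_cons; case: (boolP (Q i)) => // Qi.
by apply: cmeasurableD => //; exact: h.
Qed.

Lemma cmeasurable_ReIm Z : cmeasurable Z -> measurable_fun setT (fun t => ReIm (Z t)).
Proof. by move=> [a b]; exact: measurable_fun_pair. Qed.

End complex_measurability.

Section normalized_sum.
Context (R : realType) (d : measure_display) (T : measurableType d).
Variables (P : probability T R) (f : nat -> T -> R[i]).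
Hypothesis f_steinhaus : steinhaus P f.
Context (theta : R).
Local Notation F := (unit_version f).

(** Measurability is assumed at primes only; the smallest prime factor is split off repeatedly. *)
Lemma cmeasurable_steinhaus n : (0 < n)%N -> cmeasurable (f n).
Proof.
have [f_mult _ _] := f_steinhaus.
elim/ltn_ind: n => n IH n0.
have [->|n1] := eqVneq n 1%N.
  rewrite (_ : f 1 = fun=> 1); first exact: cmeasurable_cst.
  by apply/funext => t; have [] := f_mult t.
have n2 : (1 < n)%N by rewrite ltn_neqAle eq_sym n1.
have pp := pdiv_prime n2; have pn := pdiv_dvd n.
have q0 : (0 < n %/ pdiv n)%N by rewrite divn_gt0 ?pdiv_gt0 // dvdn_leq.
have -> : f n = fun t => f (pdiv n) t * f (n %/ pdiv n)%N t.
  apply/funext => t; have [_ <-] := f_mult t; rewrite ?pdiv_gt0 //.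
  by rewrite mulnC divnK.
apply: cmeasurableM.
  have mp := measurable_ReIm f_steinhaus pp.
  by split; [exact: (measurableT_comp measurable_fst mp)
            |exact: (measurableT_comp measurable_snd mp)].
by apply: IH => //; rewrite ltn_Pdiv ?prime_gt1.
Qed.

Lemma normalized_sumE (h : nat -> T -> R[i]) N t : normalized_sum theta h N t =
  real_complex R (scaling R N) *
  \sum_(n < N.+1 | (0 < n)%N) expi (2 * pi * n%:R * theta) * h n t.
Proof.
rewrite /normalized_sum /scaling; congr (_ * _).
by rewrite [RHS]big_mkcond big_ord_recl /= add0r big_add1 /= big_mkord.
Qed.

Lemma cmeasurable_normalized_sum (h : nat -> T -> R[i]) N :
  (forall n, (0 < n)%N -> cmeasurable (h n)) -> cmeasurable (normalized_sum theta h N).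
Proof.
move=> mh; rewrite (_ : normalized_sum _ _ _ = fun t => real_complex R (scaling R N) *
  \sum_(n < N.+1 | (0 < n)%N) expi (2 * pi * n%:R * theta) * h n t); last first.
  by apply/funext => t; exact: normalized_sumE.
apply: cmeasurableM; first exact: cmeasurable_cst.
apply: cmeasurable_sum => n n0; apply: cmeasurableM; first exact: cmeasurable_cst.
exact: mh.
Qed.

(** Almost surely the two sums coincide, so expectations of [f] may be computed with its unimodular
    version. *)
Lemma normalized_sum_unit_version (g : R * R -> R) (M : R) N :
  continuous g -> (forall w, `|g w| <= M) ->
  ('E_P[fun t => g (ReIm (normalized_sum theta f N t))] =
   (Ex P (fun t => g (ReIm (normalized_sum theta F N t))))%:E)%E.
Proof.
move=> cg bg.
have mF : measurable_fun setT (fun t => ReIm (normalized_sum theta F N t)).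
  apply: cmeasurable_ReIm; apply: cmeasurable_normalized_sum => n n0.
  by have [[a _] [b _]] := cbmeas_unit_version f_steinhaus n0; split.
have mf : measurable_fun setT (fun t => ReIm (normalized_sum theta f N t)).
  apply: cmeasurable_ReIm; apply: cmeasurable_normalized_sum => n n0.
  exact: cmeasurable_steinhaus.
have bF := bmeas_bounded_continuous cg bg mF.
have bf := bmeas_bounded_continuous cg bg mf.
rewrite -(expectation_Ex _ bF) unlock; apply: ae_eq_integral => //.
- by apply/measurable_EFinP; case: bf.
- by apply/measurable_EFinP; case: bF.
apply: negligibleS (unit_version_ae f_steinhaus N) => t /= h1 h2; apply: h1 => _.
congr (g (ReIm _))%:E; rewrite !normalized_sumE; congr (_ * _).
apply: eq_bigr => n n0; congr (_ * _); symmetry; apply: h2.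
by rewrite n0 -ltnS ltn_ord.
Qed.

(** Orthogonality gives exactly [1] for [N > 0]; at [N = 0] the sum is [0]. With Chebyshev this
    yields tightness uniformly in [N]. *)
Lemma normalized_sum_second N :
  Ex P (fun t => cabs (normalized_sum theta F N t) ^+ 2) <= 1.
Proof.
have [->|N0] := posnP N.
  rewrite (@eq_Ex _ _ _ _ _ (fun=> 0)) ?Ex_cst // => t.
  by rewrite normalized_sumE /scaling sqrtr0 invr0 mul0r cabs0 expr0n.
rewrite (@eq_Ex _ _ _ _ _ (fun t => N%:R^-1 * cabs (\sum_(n < N.+1 | (0 < n)%N)
    expi (2 * pi * n%:R * theta) * F n t) ^+ 2)); last first.
  move=> t; rewrite normalized_sumE cabsM exprMn cabs_real.
  by rewrite ger0_norm ?scaling_ge0 // scaling_sqr.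
rewrite ExZ; last first.
  apply: bmeas_cabs_sqr; apply: cbmeas_sum => n n0.
  apply: cbmeasM; first exact: cbmeas_cst.
  exact: (cbmeas_unit_version f_steinhaus).
rewrite (parseval f_steinhaus) // (eq_bigr (fun=> 1)); last first.
  by move=> n _; rewrite cabs_expi expr1n.
have -> : \sum_(n < N.+1 | (0 < n)%N) (1 : R) = N%:R.
  by rewrite big_mkcond big_ord_recl /= add0r sumr_const card_ord.
by rewrite mulVf // pnatr_eq0 -lt0n.
Qed.

End normalized_sum.

(** The largest admissible [lam]; any prescribed lower bound on it is reached once [N] is large. *)
Lemma dyadic_scale N lam0 : (2 ^ (lam0 ^ 12) <= N)%N ->
  exists lam, [/\ lam0 <= lam, 2 ^ (lam ^ 12) <= N & N < 2 ^ ((lam + 1) ^ 12)]%N.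
Proof.
move=> h; pose Q lam := (2 ^ (lam ^ 12) <= N)%N.
have ub lam : Q lam -> (lam <= N)%N.
  move=> hl; apply: leq_trans hl; apply: leq_trans (ltnW (ltn_expl _ (isT : 1 < 2)%N)).
  by case: lam => // lam; rewrite -{1}[lam.+1]expn1 leq_pexp2l.
have ex : exists lam, Q lam by exists lam0.
case: (ex_maxnP ex ub) => lam Ql max; exists lam; split => //; first exact: max.
by rewrite ltnNge; apply/negP => hl; have := max (lam + 1)%N hl; rewrite addn1 ltnn.
Qed.

(** * Limits of the cosine expectations *)

Section cosine_limit.
Context (R : realType) (theta C : R).
Hypothesis C_gt0 : 0 < C.
Hypothesis theta_dioph : forall q : nat, (0 < q)%N ->
  C * expR (- (q%:R `^ 50%:R^-1)) <= dist_int (q%:R * theta).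
Context (d : measure_display) (T : measurableType d) (P : probability T R).
Context (f : nat -> T -> R[i]).
Hypothesis f_steinhaus : steinhaus P f.
Local Notation F := (unit_version f).
Let e (n : nat) : R[i] := expi (2 * pi * n%:R * theta).

Let eD m n : e (m + n)%N = e m * e n.
Proof. by rewrite /e -expiD natrD; congr expi; ring. Qed.

Let e_abs n : cabs (e n) = 1. Proof. exact: cabs_expi. Qed.

(* With [2 ^ (lam ^ 12) <= N], the threshold [2 ^ (4 * lam ^ 3)] for large primes
   is small enough for almost all [n <= N] to have one, and exceeds
   [expR (lam ^ 3)], the loss allowed by the Diophantine condition for
   [q <= lam ^ 150]. *)
Lemma moments_small (eps : R) : 0 < eps -> \forall lam \near \oo, forall N,
  (2 ^ (lam ^ 12) <= N)%N -> (N < 2 ^ ((lam + 1) ^ 12))%N ->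
  [/\ \sum_(p < N.+1 | large_prime (4 * lam ^ 3) p)
        Ex P (fun t => cabs (coefficient f e N p t) ^+ 4) <= eps,
      Ex P (fun t => (total_variance f e N (4 * lam ^ 3) t - 1) ^+ 2) <= eps &
      Ex P (fun t => cabs (remainder f e N (4 * lam ^ 3) t) ^+ 2) <= eps].
Proof.
move=> eps0.
have [K1 hK1] := fourth_moment_rate R.
have [K2 hK2] := off_diagonal_rate R.
have small (K : R) : \forall lam \near \oo, K / lam%:R <= eps.
  near=> lam; have lam0 : (0 : R) < lam%:R by rewrite ltr0n; near: lam; exists 1%N.
  rewrite ler_pdivrMr // mulrC -ler_pdivrMr //; near: lam.
  exists (Num.truncn (K / eps)).+1 => // n /= hn; apply: ltW.
  by apply: lt_le_trans (truncnS_gt _) _; rewrite ler_nat.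
have gap := phase_gap_large C_gt0 theta_dioph.
near=> lam => N N1 N2.
have hgap : forall q, (0 < q <= (lam ^ 75) ^ 2)%N ->
    8 * (2 ^ (2 * lam))%:R / (2 ^ (4 * lam ^ 3))%:R < phase_gap e q.
  by near: lam; exact: gap.
set l := (4 * lam ^ 3)%N in hgap *.
have lam5 : (5 <= lam)%N by near: lam; exists 5%N.
have lam13 : (13 <= lam)%N by near: lam; exists 13%N.
have lamR : (0 : R) < lam%:R by rewrite ltr0n (leq_trans _ lam5).
have N0 : (0 < N)%N by apply: leq_trans N1; rewrite expn_gt0.
have NR : (0 : R) < N%:R by rewrite ltr0n.
have hexc := exceptional_rate R lam5 N1 N2.
have ge0 : 0 <= N%:R^-1 * \sum_(n < N.+1 | (0 < n)%N) (1 - (multiplicity N l n)%:R) :> R.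
  by rewrite -(remainder_second f_steinhaus e_abs); apply: Ex_ge0 => t; exact: sqr_ge0.
split.
- apply: le_trans (sum_coefficient_fourth f_steinhaus e_abs l N0 N2) _.
  by apply: le_trans (hK1 _ lam5) _; near: lam; exact: small.
- apply: le_trans (variance_second f_steinhaus eD e_abs l N0 N2) _.
  have D0 : (0 < lam ^ 75)%N by rewrite expn_gt0 (leq_trans _ lam5).
  have [hl1 hl2] : (1 < l)%N /\ (2 * (2 * lam) <= l)%N.
    have : (lam <= lam ^ 3)%N by rewrite -{1}[lam]expn1 leq_pexp2l ?(leq_trans _ lam5).
    by rewrite /l; move: (lam ^ 3)%N lam5 => z; clear; lia.
  have hoff := off_diagonal_bound eD e_abs N2 D0 hl1 hl2 hgap.
  have c0 : 0 <= 2 / N%:R ^+ 2 :> R by rewrite divr_ge0 // sqr_ge0.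
  apply: le_trans (lerD _ (ler_wpM2l c0 hoff)) _.
    exact: (ler_pM ge0 ge0 hexc hexc).
  rewrite [2 / _ * _]mulrA divfK ?gt_eqF ?exprn_gt0 //.
  apply: le_trans (lerD _ (hK2 _ lam5)) _.
    (* For [13 <= lam] the number [13 / lam] is at most [1], so its square is at most itself. *)
    apply: (@le_trans _ _ (13 / lam%:R)).
      rewrite ler_piMl ?divr_ge0 // ler_pdivrMr // mul1r.
      by rewrite (ler_nat R 13).
    exact: lexx.
  by rewrite -mulrDl; near: lam; exact: small.
- rewrite (remainder_second f_steinhaus e_abs); apply: le_trans hexc _.
  by near: lam; exact: small.
Unshelve. all: by end_near. Qed.

Lemma cosine_limit (a b c : R) :
  Ex P (fun t => cos (a * (ReIm (normalized_sum theta F N t)).1 +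
                      b * (ReIm (normalized_sum theta F N t)).2 + c)) @[N --> \oo] -->
  cos c * expR (- ((a ^+ 2 + b ^+ 2) / 4)).
Proof.
(* With [w = a - i b], the real part of [w z] is [a Re z + b Im z]. *)
pose w : R[i] := Complex a (- b).
have w2 : cabs w ^+ 2 = a ^+ 2 + b ^+ 2 by rewrite cabs_sqr /= sqrrN.
pose K := cabs w + cabs w ^+ 2 + cabs w ^+ 3 + cabs w ^+ 4.
have K0 : 0 <= K by rewrite !addr_ge0 ?exprn_ge0 ?cabs_ge0.
apply/cvgrPdist_le => ep ep0.
pose eps := Num.min 1 (ep / (K + 1)).
have K1 : 0 < K + 1 by lra.
have eps0 : 0 < eps by rewrite lt_min ltr01 divr_gt0.
have eps1 : eps <= 1 by rewrite ge_min lexx.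
have epsK : K * eps <= ep.
  apply: le_trans (_ : (K + 1) * (ep / (K + 1)) <= _).
    by apply: ler_pM => //; [exact: ltW | lra | rewrite ge_min lexx orbT].
  by rewrite mulrC divfK // gt_eqF.
have [lam0 _ hlam] := moments_small (exprn_gt0 2 eps0).
exists (2 ^ (lam0 ^ 12))%N => // N /= hN.
have [lam [l0 N1 N2]] := dyadic_scale hN.
have [m1 m2 m3] := hlam lam l0 N N1 N2.
rewrite distrC; apply: le_trans epsK.
have := central_limit_bound f_steinhaus w c eps0 eps1 m1 m2 m3.
rewrite {1}w2 => h; apply: le_trans h; rewrite le_eqVlt; apply/orP; left; apply/eqP.
congr (`|_ - _|); apply: eq_Ex => t; congr (cos (_ + c)).
have -> : real_complex R (scaling R N) * \sum_(n < N.+1 | (0 < n)%N) e n * F n t =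
    normalized_sum theta F N t by rewrite normalized_sumE.
by move: (normalized_sum _ _ _ _) => z; rewrite [RHS]ReM /w /ReIm /=; ring.
Qed.

End cosine_limit.

Theorem theorem1p6 (R : realType) (theta : R)
    (theta_irrational : irrational theta)
    (theta_dioph : exists2 C : R, 0 < C &
       forall q : nat, (0 < q)%N ->
         C * expR (- (q%:R `^ 50%:R^-1)) <= dist_int (q%:R * theta))
    (d : measure_display) (T : measurableType d) (P : probability T R)
    (f : nat -> T -> R[i]) (f_steinhaus : steinhaus P f)
    (d' : measure_display) (T' : measurableType d') (P' : probability T' R)
    (W : T' -> R[i]) (W_normal : std_complex_normal P' W) :
  cvg_in_distribution P (normalized_sum theta f) P' W.
Proof.
have [C C0 hC] := theta_dioph.
have mW : measurable_fun setT (fun t => ReIm (W t)).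
  have [X [Y [WE _ _ _]]] := W_normal; under eq_fun do rewrite WE.
  by apply: measurable_fun_pair; exact: measurable_funPT.
move=> g cg [M bg].
rewrite (expectation_Ex _ (bmeas_bounded_continuous cg bg mW)).
under eq_fun do rewrite (normalized_sum_unit_version f_steinhaus theta _ cg bg).
apply/fine_cvgP; split; first by apply: nearW => N.
pose Z N t := ReIm (normalized_sum theta (unit_version f) N t).
have bZ N : cbmeas (normalized_sum theta (unit_version f) N).
  rewrite (_ : normalized_sum _ _ N = fun t => real_complex R (scaling R N) *
     \sum_(n < N.+1 | (0 < n)%N) expi (2 * pi * n%:R * theta) * unit_version f n t).
    apply: cbmeasM; first exact: cbmeas_cst.
    apply: cbmeas_sum => n n0; apply: cbmeasM; first exact: cbmeas_cst.
    exact: (cbmeas_unit_version f_steinhaus).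
  by apply/funext => t; rewrite normalized_sumE.
have mZ N : measurable_fun setT (Z N).
  by apply: cmeasurable_ReIm; have [[a _] [b _]] := bZ N; split.
(* The tightness constant [1] is the bound on the second moment. *)
apply: (@weak_cvg_of_cos R d T P Z d' T' P' (fun t => ReIm (W t)) g M 1) => //.
- move=> a b c; rewrite (Ex_complex_normal _ _ _ W_normal).
  exact: (cosine_limit C0 hC f_steinhaus).
- move=> N L L0.
  have b2 := bmeas_cabs_sqr (bZ N).
  apply: le_trans (Ex_le P (bmeas_outside L (mZ N)) (bmeasZ (L ^+ 2)^-1 b2) _) _.
    by move=> t; apply: le_trans (outside_chebyshev _ L0) _; rewrite cabs_sqr mulrC.
  rewrite ExZ // mulrC ler_wpM2r ?invr_ge0 ?sqr_ge0 //.
  exact: normalized_sum_second.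
Qed.
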